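(* Let $\alpha\in[0,1)$ and let $f=h+\overline{g}\in\check{L}_H^{\alpha}$ with $g(z)=\sum_{n=1}^\infty b_nz^n$. Then $$|b_2|\leq 2\alpha+\frac{1-\alpha^2}{2}$$ and $$|b_n|\leq \alpha+\sqrt{(n-\alpha^2)(n-1)},\quad n=3,4,5,\dots.$$
   Context: $\Delta$ is the open unit disc in $\mathbb{C}$. Every complex-valued harmonic function $f$ in $\Delta$ is uniquely represented as $f=h+\overline{g}$ with $h,g$ analytic in $\Delta$ and $g(0)=0$; write $h(z)=\sum_{n=0}^\infty a_nz^n$, $g(z)=\sum_{n=1}^\infty b_nz^n$. The Jacobian of $f$ is $J_f(z)=|h'(z)|^2-|g'(z)|^2$; $f$ is locally one-to-one and sense-preserving in $\Delta$ if and only if $J_f(z)>0$ for all $z\in\Delta$. $L_H$ denotes the set of all locally one-to-one and sense-preserving harmonic functions $f=h+\overline{g}$ in $\Delta$ with $h(0)=0$, $h'(0)=1$ (and $g(0)=0$). A starlike analytic function is a one-to-one analytic function in $\Delta$ fixing $0$ whose image is starlike with respect to the origin. For $\alpha\in[0,1)$, $\check{L}_H^{\alpha}$ is the class of all $f=h+\overline{g}\in L_H$ such that $|b_1|=|g'(0)|=\alpha$ and $h$ is a starlike analytic function. *)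

(* Defs.v *)
From Stdlib Require Import Reals.
From Coquelicot Require Import Coquelicot.

Local Open Scope R_scope.

(* Complex functions are total maps [C -> C]; only their values on the open
   unit disc are constrained. *)
Definition disc (z : C) : Prop := Cmod z < 1.

(* Complex differentiability: the scalar field is [C_AbsRing], not [R]. *)
Definition analytic_in_disc (h : C -> C) : Prop :=
  forall z : C, disc z -> ex_derive (K := C_AbsRing) (V := C_NormedModule) h z.

Definition power_series_in_disc (a : nat -> C) (h : C -> C) : Prop :=
  forall z : C, disc z ->
    is_pseries (K := C_AbsRing) (V := C_NormedModule) a z (h z).

(* The pair (h, g) is determined on the disc by f, thanks to g(0) = 0. *)
Definition harmonic_decomposition (f h g : C -> C) : Prop :=
  analytic_in_disc h /\ analytic_in_disc g /\ g 0%C = 0%C /\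
  (forall z : C, disc z -> f z = (h z + Cconj (g z))%C).

(* The Jacobian of h + conj g.  [C_derive] is the complex derivative wherever
   the function is complex differentiable, and is arbitrary elsewhere. *)
Definition jacobian (h g : C -> C) (z : C) : R :=
  Cmod (C_derive h z) ^ 2 - Cmod (C_derive g z) ^ 2.

Definition one_to_one_in_disc (f : C -> C) : Prop :=
  forall z w : C, disc z -> disc w -> f z = f w -> z = w.

Definition locally_one_to_one (f : C -> C) : Prop :=
  forall z0 : C, disc z0 ->
    exists eps : R, 0 < eps /\
      forall z w : C, disc z -> disc w ->
        Cmod (z - z0) < eps -> Cmod (w - z0) < eps -> f z = f w -> z = w.

(* For f = h + conj g. *)
Definition sense_preserving (h g : C -> C) : Prop :=
  forall z : C, disc z -> 0 < jacobian h g z.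

(* f belongs to L_H, with harmonic decomposition f = h + conj g. *)
Definition LH (f h g : C -> C) : Prop :=
  harmonic_decomposition f h g /\
  locally_one_to_one f /\ sense_preserving h g /\
  h 0%C = 0%C /\ C_derive h 0%C = 1%C.

Definition image_of_disc (h : C -> C) (w : C) : Prop :=
  exists z : C, disc z /\ h z = w.

Definition starlike_set (D : C -> Prop) : Prop :=
  forall (w : C) (t : R), D w -> 0 <= t <= 1 -> D (RtoC t * w)%C.

Definition starlike_function (h : C -> C) : Prop :=
  analytic_in_disc h /\ one_to_one_in_disc h /\ h 0%C = 0%C /\
  starlike_set (image_of_disc h).

(* The class L_H-check with parameter alpha, f = h + conj g. *)
Definition LH_check (alpha : R) (f h g : C -> C) : Prop :=
  LH f h g /\ Cmod (C_derive g 0%C) = alpha /\ starlike_function h.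

(* Main.v *)
(* The dilation [t h] of a starlike [h] factors as [h o w_t] with [w_t] a self-map
   of the disc fixing 0.  Following [t -> w_t z], the pull-back of a segment, gives
   two facts: [|g| <= |h|] because [|g'| < |h'|], and [Re (z h'/h) >= 0] by
   Schwarz's lemma.  Put [h = z s^2] as formal power series.  Since
   [(z h' - h) / (z h' + h)] is bounded by 1, Clunie's method shows that the
   coefficients of [s] have modulus at most 1.  Now [g = (psi s) z s] with
   [psi = g / h] bounded by 1 and [|psi 0| = alpha]; multiplication by [psi] is a
   contraction on initial segments of coefficients, and Cauchy-Schwarz gives the
   bound on [b_n].  For [n = 2] one uses [g' = omega h'] with
   [|omega_1| <= 1 - alpha^2] and [|a_2| = 2 |s_1| <= 2] instead.

   The hypotheses only provide pointwise complex differentiability, so Taylor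
   expansions are obtained from Goursat's lemma and Fourier series on circles. *)

Require Import Defs.
From Stdlib Require Import Reals Arith Lra Lia FunctionalExtensionality Classical ClassicalChoice.
From Coquelicot Require Import Coquelicot.
(* [Reals] also exports a constant named [disc]. *)
Import Defs.
Local Open Scope R_scope.

(** * Limits and derivatives *)

(** The model is the Koebe function [z / (1 - z)^2], for which [s = 1 / (1 - z)] has all
    coefficients equal to 1; the constants of the theorem come from counting such coefficients. The
    coefficient of index [n - 1] in [(psi s) s] splits into its leading product, of modulus at most
    [alpha], and a tail. In the tail the entries of [psi s] after the first have square sum at most
    [n - alpha^2], and the [n - 1] entries of [s] facing them have square sum at most [n - 1]. For
    [n = 2] the same count would give [alpha + sqrt (2 - alpha^2)], which exceeds the stated bound.

    Keeping [s] formal avoids choosing an analytic branch of [sqrt (h / z)]: the contraction and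
    Clunie's method see only finitely many coefficients of the factor being multiplied, so its
    convergence is never at stake. In the same spirit, products of power series are compared through
    asymptotic expansions at 0 instead of by multiplying convergent series. *)

Definition Clim {T : Type} (D : (T -> Prop) -> Prop) (f : T -> C) (l : C) : Prop :=
  forall eps : R, 0 < eps -> D (fun x => Cmod (f x - l) < eps).

(** [C] carries two uniform structures, with square balls and with modulus balls. This is the second
    one, the one over which complex [is_derive] is defined. *)
Definition nearC (z : C) : (C -> Prop) -> Prop :=
  @locally (AbsRing_UniformSpace C_AbsRing) z.

Global Instance nearC_filter (z : C) : ProperFilter (nearC z).
Proof. exact (@locally_filter (AbsRing_UniformSpace C_AbsRing) z). Qed.

Lemma nearC_intro (z : C) (P : C -> Prop) (d : R) :
  0 < d -> (forall w : C, Cmod (w - z) < d -> P w) -> nearC z P.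
Proof. intros Hd H. exists (mkposreal d Hd). intros w Hw. apply H. exact Hw. Qed.

Lemma nearC_elim (z : C) (P : C -> Prop) :
  nearC z P -> exists d, 0 < d /\ forall w : C, Cmod (w - z) < d -> P w.
Proof.
  intros [d H]. exists d. split; [apply cond_pos|]. intros w Hw. apply H. exact Hw.
Qed.

Lemma Cmod_sub_sym (x y : C) : Cmod (x - y) = Cmod (y - x).
Proof. rewrite <- Cmod_opp. f_equal. ring. Qed.

Lemma Cmod_le_sub (x y : C) : Cmod x <= Cmod y + Cmod (x - y).
Proof. replace x with (y + (x - y))%C at 1 by ring. apply Cmod_triangle. Qed.

Lemma Cmod_sq_conj (x : C) : RtoC (Cmod x ^ 2) = (x * Cconj x)%C.
Proof. apply Cmod2_conj. Qed.

Section Limits.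
Context {T : Type} (D : (T -> Prop) -> Prop) {FD : Filter D}.

Lemma Clim_const (c : C) : Clim D (fun _ => c) c.
Proof.
  intros e He. apply filter_forall. intros x.
  replace (c - c)%C with (RtoC 0) by ring. rewrite Cmod_0. exact He.
Qed.

Lemma Clim_eq (f : T -> C) (a b : C) : a = b -> Clim D f a -> Clim D f b.
Proof. now intros ->. Qed.

Lemma Clim_ext (f g : T -> C) (l : C) :
  D (fun x => f x = g x) -> Clim D f l -> Clim D g l.
Proof.
  intros H Hf e He. generalize (filter_and _ _ H (Hf e He)). apply filter_imp.
  intros x [E K]. now rewrite <- E.
Qed.

Lemma Clim_plus (f g : T -> C) (a b : C) :
  Clim D f a -> Clim D g b -> Clim D (fun x => f x + g x)%C (a + b)%C.
Proof.
  intros Hf Hg e He.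
  assert (He2 : 0 < e / 2) by lra.
  generalize (filter_and _ _ (Hf _ He2) (Hg _ He2)). apply filter_imp.
  intros x [A B].
  replace (f x + g x - (a + b))%C with ((f x - a) + (g x - b))%C by ring.
  generalize (Cmod_triangle (f x - a) (g x - b)). lra.
Qed.

Lemma Clim_bounded (f : T -> C) (a : C) :
  Clim D f a -> D (fun x => Cmod (f x) <= Cmod a + 1).
Proof.
  intros Hf. generalize (Hf 1 Rlt_0_1). apply filter_imp. intros x Hx.
  generalize (Cmod_le_sub (f x) a). lra.
Qed.

Lemma Clim_mult (f g : T -> C) (a b : C) :
  Clim D f a -> Clim D g b -> Clim D (fun x => f x * g x)%C (a * b)%C.
Proof.
  intros Hf Hg e He.
  set (M := Cmod a + Cmod b + 1).
  assert (HM : 0 < M) by (unfold M; generalize (Cmod_ge_0 a) (Cmod_ge_0 b); lra).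
  assert (He2 : 0 < e / (2 * M)) by (apply Rdiv_lt_0_compat; lra).
  generalize (filter_and _ _ (filter_and _ _ (Hf _ He2) (Hg _ He2)) (Clim_bounded _ _ Hf)).
  apply filter_imp. intros x [[A B] K].
  replace (f x * g x - a * b)%C with (f x * (g x - b) + (f x - a) * b)%C by ring.
  eapply Rle_lt_trans; [apply Cmod_triangle|]. rewrite 2!Cmod_mult.
  assert (Cmod (f x) * Cmod (g x - b) <= M * Cmod (g x - b)).
  { apply Rmult_le_compat_r; [apply Cmod_ge_0|].
    unfold M; generalize (Cmod_ge_0 b); lra. }
  assert (Cmod (f x - a) * Cmod b <= Cmod (f x - a) * M).
  { apply Rmult_le_compat_l; [apply Cmod_ge_0|].
    unfold M; generalize (Cmod_ge_0 a); lra. }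
  assert (M * Cmod (g x - b) < M * (e / (2 * M))) by (apply Rmult_lt_compat_l; lra).
  assert (Cmod (f x - a) * M < (e / (2 * M)) * M) by (apply Rmult_lt_compat_r; lra).
  replace (M * (e / (2 * M))) with (e / 2) in * by (field; lra).
  replace (e / (2 * M) * M) with (e / 2) in * by (field; lra).
  lra.
Qed.

Lemma Clim_opp (f : T -> C) (a : C) :
  Clim D f a -> Clim D (fun x => - f x)%C (- a)%C.
Proof.
  intros Hf e He. generalize (Hf e He). apply filter_imp. intros x Hx.
  replace (- f x - - a)%C with (- (f x - a))%C by ring. now rewrite Cmod_opp.
Qed.

Lemma Clim_minus (f g : T -> C) (a b : C) :
  Clim D f a -> Clim D g b -> Clim D (fun x => f x - g x)%C (a - b)%C.
Proof. intros Hf Hg. apply Clim_plus; [exact Hf|]. now apply Clim_opp. Qed.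

Lemma Clim_conj (f : T -> C) (a : C) :
  Clim D f a -> Clim D (fun x => Cconj (f x)) (Cconj a).
Proof.
  intros Hf e He. generalize (Hf e He). apply filter_imp. intros x Hx.
  now rewrite <- Cminus_conj, Cmod_conj.
Qed.

Lemma Clim_neq_0 (f : T -> C) (a : C) :
  a <> 0%C -> Clim D f a -> D (fun x => Cmod a / 2 < Cmod (f x)).
Proof.
  intros Ha Hf. apply Cmod_gt_0 in Ha.
  assert (H2 : 0 < Cmod a / 2) by lra.
  generalize (Hf _ H2). apply filter_imp. intros x Hx.
  generalize (Cmod_le_sub a (f x)). rewrite (Cmod_sub_sym a). lra.
Qed.

Lemma Clim_inv (f : T -> C) (a : C) :
  a <> 0%C -> Clim D f a -> Clim D (fun x => / f x)%C (/ a)%C.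
Proof.
  intros Ha Hf e He.
  assert (Hm : 0 < Cmod a) by now apply Cmod_gt_0.
  assert (He2 : 0 < e * (Cmod a * Cmod a / 2)).
  { apply Rmult_lt_0_compat; [lra|]. apply Rmult_lt_0_compat; [|lra]. nra. }
  generalize (filter_and _ _ (Hf _ He2) (Clim_neq_0 f a Ha Hf)). apply filter_imp.
  intros x [A B].
  assert (Hx : f x <> 0%C) by (apply Cmod_gt_0; lra).
  replace (/ f x - / a)%C with ((a - f x) / (f x * a))%C by (field; auto).
  rewrite Cmod_div, Cmod_mult, (Cmod_sub_sym a) by (apply Cmult_neq_0; auto).
  apply Rmult_lt_reg_r with (Cmod (f x) * Cmod a); [nra|].
  replace (Cmod (f x - a) / (Cmod (f x) * Cmod a) * (Cmod (f x) * Cmod a))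
    with (Cmod (f x - a)) by (field; lra).
  apply Rlt_le_trans with (1 := A). apply Rmult_le_compat_l; nra.
Qed.

Lemma Clim_comp (F : C -> C) (g : T -> C) (z l : C) :
  Clim (nearC z) F l -> Clim D g z -> Clim D (fun x => F (g x)) l.
Proof.
  intros HF Hg e He. destruct (nearC_elim _ _ (HF e He)) as [d [Hd K]].
  generalize (Hg d Hd). apply filter_imp. intros x Hx. apply K. exact Hx.
Qed.
End Limits.

Lemma Clim_unique {T} (D : (T -> Prop) -> Prop) {FD : ProperFilter D} (f : T -> C) (a b : C) :
  Clim D f a -> Clim D f b -> a = b.
Proof.
  intros Ha Hb. destruct (Ceq_dec a b) as [E|E]; [exact E|exfalso].
  assert (H : 0 < Cmod (a - b)) by (apply Cmod_gt_0; now apply Cminus_eq_contra).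
  assert (H2 : 0 < Cmod (a - b) / 2) by lra.
  destruct (filter_ex _ (filter_and _ _ (Ha _ H2) (Hb _ H2))) as [x [A B]].
  generalize (Cmod_triangle (f x - b) (- (f x - a))). rewrite Cmod_opp.
  replace (f x - b + - (f x - a))%C with (a - b)%C by ring. lra.
Qed.

Lemma Clim_Cmod_le {T} (D : (T -> Prop) -> Prop) {FD : ProperFilter D} (f : T -> C) (a : C) (M : R) :
  Clim D f a -> D (fun x => Cmod (f x) <= M) -> Cmod a <= M.
Proof.
  intros Ha Hb. apply Rnot_lt_le. intros H.
  assert (H2 : 0 < Cmod a - M) by lra.
  destruct (filter_ex _ (filter_and _ _ (Ha _ H2) Hb)) as [x [A B]].
  generalize (Cmod_le_sub a (f x)). rewrite (Cmod_sub_sym a). lra.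
Qed.

Lemma Clim_id (z : C) : Clim (nearC z) (fun w => w) z.
Proof. intros e He. apply (nearC_intro _ _ e He). auto. Qed.

(** [nearC z] is not punctured: [z] belongs to all its sets, so a limit there must be the value. *)
Lemma Clim_point (f : C -> C) (z l : C) : Clim (nearC z) f l -> f z = l.
Proof.
  intros H. destruct (Ceq_dec (f z) l) as [E|E]; [exact E|exfalso].
  assert (K : 0 < Cmod (f z - l)) by (apply Cmod_gt_0; now apply Cminus_eq_contra).
  destruct (nearC_elim _ _ (H _ K)) as [d [Hd L]].
  specialize (L z). replace (z - z)%C with (RtoC 0) in L by ring.
  rewrite Cmod_0 in L. generalize (L Hd). lra.
Qed.

Lemma Clim_RtoC (t : R) : Clim (locally t) RtoC (RtoC t).
Proof.
  intros e He. exists (mkposreal e He). intros y Hy.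
  rewrite <- RtoC_minus, Cmod_R. exact Hy.
Qed.

(* Caratheodory's form of differentiability at [x], for functions on a space
   [T] carrying a neighbourhood filter [D] and a coordinate [iota : T -> C];
   it covers complex derivatives and derivatives of curves at once. *)
Definition gder {T : Type} (D : (T -> Prop) -> Prop) (iota : T -> C)
  (f : T -> C) (x : T) (d : C) : Prop :=
  exists q : T -> C, Clim D q d /\
    D (fun y => f y = (f x + (iota y - iota x) * q y)%C).

Notation cder f z d := (gder (nearC z%C) (fun w : C => w) f z%C d%C).
Notation rder f t d := (gder (locally t%R) RtoC f t%R d%C).

Section Derivatives.
Context {T : Type} (D : (T -> Prop) -> Prop) {FD : Filter D} (iota : T -> C) (x : T).
Hypothesis iota_cont : Clim D iota (iota x).

Lemma gder_cont (f : T -> C) (d : C) : gder D iota f x d -> Clim D f (f x).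
Proof.
  intros [q [Hq H]].
  apply Clim_ext with (f := fun y => (f x + (iota y - iota x) * q y)%C); [exact FD| |].
  - revert H. apply filter_imp. intros y E. now rewrite E.
  - apply Clim_eq with (f x + (iota x - iota x) * d)%C; [ring|].
    apply Clim_plus; [exact FD|apply Clim_const; exact FD|].
    apply Clim_mult; [exact FD| |exact Hq].
    apply Clim_minus; [exact FD|exact iota_cont|apply Clim_const; exact FD].
Qed.

Lemma gder_ext (f g : T -> C) (d : C) :
  D (fun y => f y = g y) -> f x = g x -> gder D iota f x d -> gder D iota g x d.
Proof.
  intros E E0 [q [Hq H]]. exists q. split; [exact Hq|].
  generalize (filter_and _ _ E H). apply filter_imp. intros y [A B]. now rewrite <- A, B, E0.
Qed.

Lemma gder_const (c : C) : gder D iota (fun _ => c) x 0%C.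
Proof.
  exists (fun _ => RtoC 0). split; [apply Clim_const; exact FD|].
  apply filter_forall. intros y. ring.
Qed.

Lemma gder_iota : gder D iota iota x 1%C.
Proof.
  exists (fun _ => RtoC 1). split; [apply Clim_const; exact FD|].
  apply filter_forall. intros y. ring.
Qed.

Lemma gder_plus (f g : T -> C) (a b : C) :
  gder D iota f x a -> gder D iota g x b ->
  gder D iota (fun y => f y + g y)%C x (a + b)%C.
Proof.
  intros [p [Hp A]] [q [Hq B]]. exists (fun y => p y + q y)%C.
  split; [now apply Clim_plus|].
  generalize (filter_and _ _ A B). apply filter_imp. intros y [E F]. rewrite E, F. ring.
Qed.

Lemma gder_mult (f g : T -> C) (a b : C) :
  gder D iota f x a -> gder D iota g x b ->
  gder D iota (fun y => f y * g y)%C x (a * g x + f x * b)%C.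
Proof.
  intros Hf Hg. assert (Cg := gder_cont _ _ Hg).
  destruct Hf as [p [Hp A]], Hg as [q [Hq B]].
  exists (fun y => p y * g y + f x * q y)%C. split.
  - apply Clim_plus; [exact FD| |]; apply Clim_mult; auto. apply Clim_const; exact FD.
  - generalize (filter_and _ _ A B). apply filter_imp. intros y [E F]. rewrite E, F. ring.
Qed.

Lemma gder_scal (f : T -> C) (c a : C) :
  gder D iota f x a -> gder D iota (fun y => c * f y)%C x (c * a)%C.
Proof.
  intros H. replace (c * a)%C with (0 * f x + c * a)%C by ring.
  apply (gder_mult (fun _ => c)); [apply gder_const|exact H].
Qed.

Lemma gder_opp (f : T -> C) (a : C) :
  gder D iota f x a -> gder D iota (fun y => - f y)%C x (- a)%C.
Proof.
  intros H. replace (- a)%C with ((- (1)) * a)%C by ring.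
  apply gder_ext with (f := fun y => (- (1) * f y)%C).
  - apply filter_forall. intros y. ring.
  - ring.
  - now apply gder_scal.
Qed.

Lemma gder_minus (f g : T -> C) (a b : C) :
  gder D iota f x a -> gder D iota g x b ->
  gder D iota (fun y => f y - g y)%C x (a - b)%C.
Proof. intros A B. apply gder_plus; [exact A|now apply gder_opp]. Qed.

Lemma gder_inv (f : T -> C) (a : C) : f x <> 0%C ->
  gder D iota f x a -> gder D iota (fun y => / f y)%C x (- a / (f x * f x))%C.
Proof.
  intros H0 Hf. assert (Cf := gder_cont _ _ Hf). destruct Hf as [p [Hp A]].
  exists (fun y => - p y * / (f y * f x))%C. split.
  - apply Clim_mult; [exact FD|now apply Clim_opp|].
    apply Clim_inv; [exact FD|now apply Cmult_neq_0|].
    apply Clim_mult; auto. apply Clim_const; exact FD.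
  - generalize (filter_and _ _ A (Clim_neq_0 D f _ H0 Cf)). apply filter_imp.
    intros y [E F].
    assert (Hy : f y <> 0%C).
    { apply Cmod_gt_0. generalize (Cmod_ge_0 (f x)). lra. }
    assert (K : ((iota y - iota x) * p y = f y - f x)%C) by (rewrite E; ring).
    replace (/ f x + (iota y - iota x) * (- p y * / (f y * f x)))%C
      with (/ f x - ((iota y - iota x) * p y) * / (f y * f x))%C by ring.
    rewrite K. field. auto.
Qed.

Lemma gder_div (f g : T -> C) (a b : C) : g x <> 0%C ->
  gder D iota f x a -> gder D iota g x b ->
  exists d, gder D iota (fun y => f y / g y)%C x d.
Proof.
  intros H0 Hf Hg. eexists. exact (gder_mult _ _ _ _ Hf (gder_inv _ _ H0 Hg)).
Qed.

Lemma gder_comp (F : C -> C) (f : T -> C) (a b : C) :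
  cder F (f x) a -> gder D iota f x b -> gder D iota (fun y => F (f y)) x (a * b)%C.
Proof.
  intros [p [Hp A]] Hf. assert (Cf := gder_cont _ _ Hf). destruct Hf as [q [Hq B]].
  exists (fun y => p (f y) * q y)%C. split.
  - apply Clim_mult; [exact FD| |exact Hq]. now apply Clim_comp with (f x).
  - destruct (nearC_elim _ _ A) as [e [He K]].
    generalize (filter_and _ _ B (Cf e He)). apply filter_imp. intros y [E L].
    rewrite (K _ L). rewrite E at 1. ring.
Qed.
End Derivatives.

(** The slope is the difference quotient, completed by [d] where [iota y = iota x]. The first
    hypothesis covers those points, at which the quotient says nothing about [f y]. *)
Lemma gder_of_eps {T} (D : (T -> Prop) -> Prop) {FD : Filter D} (iota f : T -> C) (x : T) (d : C) :
  (forall y, iota y = iota x -> f y = f x) ->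
  (forall eps, 0 < eps ->
    D (fun y => Cmod (f y - f x - (iota y - iota x) * d) <= eps * Cmod (iota y - iota x))) ->
  gder D iota f x d.
Proof.
  intros Hi H.
  exists (fun y => if Ceq_dec (iota y) (iota x) then d else ((f y - f x) / (iota y - iota x))%C).
  split.
  - intros e He. assert (He2 : 0 < e / 2) by lra.
    generalize (H _ He2). apply filter_imp. intros y K.
    destruct (Ceq_dec (iota y) (iota x)) as [E|E].
    + replace (d - d)%C with (RtoC 0) by ring. rewrite Cmod_0. exact He.
    + assert (N : (iota y - iota x)%C <> 0%C) by now apply Cminus_eq_contra.
      assert (P := proj1 (Cmod_gt_0 _) N).
      replace ((f y - f x) / (iota y - iota x) - d)%C
        with ((f y - f x - (iota y - iota x) * d) / (iota y - iota x))%C by (field; exact N).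
      rewrite Cmod_div by exact N.
      apply Rmult_lt_reg_r with (1 := P). unfold Rdiv at 1.
      rewrite Rmult_assoc, Rinv_l, Rmult_1_r by lra. nra.
  - apply filter_forall. intros y. destruct (Ceq_dec (iota y) (iota x)) as [E|E].
    + rewrite E, (Hi _ E). ring.
    + field. now apply Cminus_eq_contra.
Qed.

Lemma gder_eps {T} (D : (T -> Prop) -> Prop) {FD : Filter D} (iota f : T -> C) (x : T) (d : C) (eps : R) :
  gder D iota f x d -> 0 < eps ->
  D (fun y => Cmod (f y - f x - (iota y - iota x) * d) <= eps * Cmod (iota y - iota x)).
Proof.
  intros [q [Hq H]] He. generalize (filter_and _ _ H (Hq _ He)). apply filter_imp.
  intros y [A B]. rewrite A.
  replace (f x + (iota y - iota x) * q y - f x - (iota y - iota x) * d)%C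
    with ((q y - d) * (iota y - iota x))%C by ring.
  rewrite Cmod_mult. apply Rmult_le_compat_r; [apply Cmod_ge_0|lra].
Qed.

Lemma is_derive_cder (f : C -> C) (z d : C) :
  is_derive (K := C_AbsRing) (V := C_NormedModule) f z d <-> cder f z d.
Proof.
  split.
  - intros [_ H]. specialize (H z (fun P HP => HP)).
    apply gder_of_eps; [apply nearC_filter|now intros y ->|].
    intros e He. exact (H (mkposreal _ He)).
  - intros H. split.
    + apply (is_linear_scal_l (K := C_AbsRing) (V := C_NormedModule) d).
    + intros y Hy.
      assert (y = z) as -> by (symmetry; apply is_filter_lim_locally_unique with (1 := Hy)).
      intros e. exact (gder_eps _ _ _ _ _ e H (cond_pos e)).
Qed.

Definition holo (f : C -> C) : Prop := forall z, disc z -> exists d, cder f z d.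

Lemma holo_analytic (f : C -> C) : holo f <-> analytic_in_disc f.
Proof.
  split; intros H z Hz; destruct (H z Hz) as [d Hd]; exists d.
  - now apply is_derive_cder.
  - now apply is_derive_cder.
Qed.

Lemma disc_0 : disc 0%C.
Proof. unfold disc. rewrite Cmod_0. lra. Qed.

Lemma nearC_disc (z : C) : disc z -> nearC z disc.
Proof.
  intros Hz. apply (nearC_intro _ _ (1 - Cmod z)).
  - unfold disc in Hz. lra.
  - intros w Hw. unfold disc. generalize (Cmod_le_sub w z). lra.
Qed.

(** * Goursat's lemma *)

Section RectangleBisection.
Variable P : R -> R -> R -> R -> Prop.
Variables a0 b0 c0 d0 : R.
Hypothesis split4 : forall a b c d, a <= b -> c <= d ->
  P a ((a + b) / 2) c ((c + d) / 2) -> P ((a + b) / 2) b c ((c + d) / 2) ->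
  P a ((a + b) / 2) ((c + d) / 2) d -> P ((a + b) / 2) b ((c + d) / 2) d ->
  P a b c d.
Hypothesis local_ok : forall x y, a0 <= x <= b0 -> c0 <= y <= d0 ->
  exists r, 0 < r /\ forall a b c d,
    a0 <= a <= x -> x <= b <= b0 -> c0 <= c <= y -> y <= d <= d0 ->
    b - a < r -> d - c < r -> P a b c d.

Let rect : Type := ((R * R) * (R * R))%type.
Let PR (r : rect) : Prop := P (fst (fst r)) (snd (fst r)) (fst (snd r)) (snd (snd r)).
Let wf (r : rect) : Prop := fst (fst r) <= snd (fst r) /\ fst (snd r) <= snd (snd r).
Let half_of (u v : R * R) : Prop :=
  (fst v = fst u /\ snd v = (fst u + snd u) / 2) \/
  (fst v = (fst u + snd u) / 2 /\ snd v = snd u).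

(** The existential stands outside the hypotheses so that [choice] gives a total map on rectangles;
    on rectangles that are not bad any value will do. *)
Lemma bad_quarter (r : rect) : exists r', wf r -> ~ PR r ->
  ~ PR r' /\ half_of (fst r) (fst r') /\ half_of (snd r) (snd r').
Proof.
  destruct r as [[a b] [c d]]. unfold PR, wf, half_of; cbn.
  destruct (classic ((a <= b /\ c <= d) /\ ~ P a b c d)) as [[[Hab Hcd] N]|N];
    [|exists ((a, b), (c, d)); tauto].
  destruct (classic (P a ((a + b) / 2) c ((c + d) / 2))) as [P1|N1];
    [|exists ((a, (a + b) / 2), (c, (c + d) / 2)); cbn; tauto].
  destruct (classic (P ((a + b) / 2) b c ((c + d) / 2))) as [P2|N2];
    [|exists (((a + b) / 2, b), (c, (c + d) / 2)); cbn; tauto].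
  destruct (classic (P a ((a + b) / 2) ((c + d) / 2) d)) as [P3|N3];
    [|exists ((a, (a + b) / 2), ((c + d) / 2, d)); cbn; tauto].
  destruct (classic (P ((a + b) / 2) b ((c + d) / 2) d)) as [P4|N4];
    [|exists (((a + b) / 2, b), ((c + d) / 2, d)); cbn; tauto].
  exfalso. apply N. now apply split4.
Qed.

Lemma nested_point (u : nat -> R * R) :
  fst (u 0%nat) <= snd (u 0%nat) -> (forall n, half_of (u n) (u (S n))) ->
  (exists x, forall n, fst (u 0%nat) <= fst (u n) <= x /\ x <= snd (u n) <= snd (u 0%nat)) /\
  (forall r, 0 < r -> exists n, forall m, (n <= m)%nat -> snd (u m) - fst (u m) < r).
Proof.
  intros H0 Hh. set (l := snd (u 0%nat) - fst (u 0%nat)).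
  assert (Hlen : forall n, snd (u n) - fst (u n) = l * (/ 2) ^ n).
  { induction n as [|n IH]; [unfold l; simpl; ring|].
    change ((/ 2) ^ S n) with (/ 2 * (/ 2) ^ n).
    destruct (Hh n) as [[-> ->]|[-> ->]]; lra. }
  assert (Hp : forall n, 0 < (/ 2) ^ n) by (intros n; apply pow_lt; lra).
  assert (Hl : 0 <= l) by (unfold l; lra).
  assert (Hle : forall n, fst (u n) <= snd (u n)).
  { intros n. generalize (Hlen n) (Rmult_le_pos _ _ Hl (Rlt_le _ _ (Hp n))). lra. }
  assert (Hmono : forall n, fst (u n) <= fst (u (S n)) /\ snd (u (S n)) <= snd (u n)).
  { intros n. generalize (Hle n). destruct (Hh n) as [[-> ->]|[-> ->]]; lra. }
  assert (Hmono2 : forall n m, (n <= m)%nat -> fst (u n) <= fst (u m) /\ snd (u m) <= snd (u n)).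
  { intros n m. induction 1 as [|m _ IH]; [lra|]. generalize (Hmono m). lra. }
  split.
  - destruct (completeness (fun x => exists n, x = fst (u n))) as [x [Hub Hlub]].
    + exists (snd (u 0%nat)). intros y [n ->]. generalize (proj2 (Hmono2 0%nat n (Nat.le_0_l n))) (Hle n). lra.
    + now exists (fst (u 0%nat)), 0%nat.
    + exists x. intros n. generalize (Hmono2 0%nat n (Nat.le_0_l n)). intros [A B].
      repeat split; auto.
      * apply Hub. now exists n.
      * apply Hlub. intros y [m ->].
        destruct (Nat.le_ge_cases n m) as [L|L].
        -- generalize (Hmono2 _ _ L) (Hle m). lra.
        -- generalize (Hmono2 _ _ L) (Hle n). lra.
  - intros r Hr.
    destruct (pow_lt_1_zero (/ 2) ltac:(rewrite Rabs_pos_eq; lra) (r / (l + 1))) as [n Hn].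
    + apply Rdiv_lt_0_compat; lra.
    + exists n. intros m Hm. rewrite Hlen. specialize (Hn m Hm).
      rewrite Rabs_pos_eq in Hn by (left; apply Hp).
      apply Rle_lt_trans with ((l + 1) * (/ 2) ^ m).
      * apply Rmult_le_compat_r; [left; apply Hp|lra].
      * apply Rmult_lt_reg_r with (/ (l + 1)); [apply Rinv_0_lt_compat; lra|].
        replace ((l + 1) * (/ 2) ^ m * / (l + 1)) with ((/ 2) ^ m) by (field; lra). exact Hn.
Qed.

(** Goursat's subdivision freed from integrals: if [P] failed, repeated quartering would give nested
    bad rectangles shrinking to a point, and [local_ok] at that point contradicts all the small
    ones. *)
Lemma rectangle_bisection : a0 <= b0 -> c0 <= d0 -> P a0 b0 c0 d0.
Proof.
  intros Hab Hcd. apply NNPP. intros N.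
  destruct (choice _ bad_quarter) as [f Hf].
  set (u := nat_rect (fun _ => rect) ((a0, b0), (c0, d0)) (fun _ => f)).
  assert (Hu : forall n, wf (u n) /\ ~ PR (u n)).
  { induction n as [|n [IH1 IH2]]; [now split|].
    change (u (S n)) with (f (u n)). destruct (Hf _ IH1 IH2) as [A [B K]].
    split; [|exact A]. destruct IH1 as [L1 L2]. unfold wf, half_of in *.
    destruct B as [[-> ->]|[-> ->]], K as [[-> ->]|[-> ->]]; lra. }
  assert (Hh : forall n, half_of (fst (u n)) (fst (u (S n))) /\ half_of (snd (u n)) (snd (u (S n)))).
  { intros n. destruct (Hu n) as [A B]. apply (Hf _ A B). }
  destruct (nested_point (fun n => fst (u n)) Hab (fun n => proj1 (Hh n))) as [[x Hx] Lx].
  destruct (nested_point (fun n => snd (u n)) Hcd (fun n => proj2 (Hh n))) as [[y Hy] Ly].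
  cbn in Hx, Hy.
  assert (Hx0 := Hx 0%nat). assert (Hy0 := Hy 0%nat). cbn in Hx0, Hy0.
  destruct (local_ok x y) as [r [Hr K]]; [lra|lra|].
  destruct (Lx r Hr) as [n1 H1], (Ly r Hr) as [n2 H2].
  apply (proj2 (Hu (n1 + n2)%nat)).
  apply K; try apply Hx; try apply Hy; [apply H1|apply H2]; lia.
Qed.
End RectangleBisection.

Lemma is_RInt_primitive (F f : R -> R) (a b v : R) :
  (forall t, is_derive F t (f t)) -> (forall t, ex_derive f t) -> v = F b - F a ->
  is_RInt f a b v.
Proof.
  intros HF Hf ->. apply (is_RInt_derive (V := R_CompleteNormedModule) F f).
  - intros t _. apply HF.
  - intros t _. apply (ex_derive_continuous f), Hf.
Qed.

Lemma is_RInt_inj (f : R -> R) (a b u v : R) : is_RInt f a b u -> is_RInt f a b v -> u = v.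
Proof.
  intros Hu Hv. rewrite <- (is_RInt_unique (V := R_CompleteNormedModule) _ _ _ _ Hu).
  now apply (is_RInt_unique (V := R_CompleteNormedModule)).
Qed.

(* Closed one-forms [p dx + q dy] that are merely differentiable (no
   continuity of the partial derivatives), as in Goursat's lemma. *)
Section Green.
Variables (p q : R -> R -> R) (a0 b0 c0 d0 : R).
Hypothesis p_cont_x : forall x y, a0 <= x <= b0 -> c0 <= y <= d0 -> continuous (fun t => p t y) x.
Hypothesis q_cont_y : forall x y, a0 <= x <= b0 -> c0 <= y <= d0 -> continuous (fun t => q x t) y.
Hypothesis diff : forall x y, a0 <= x <= b0 -> c0 <= y <= d0 ->
  exists p1 p2 q2, forall eps, 0 < eps -> exists r, 0 < r /\ forall s t,
    Rabs (s - x) < r -> Rabs (t - y) < r ->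
    Rabs (p s t - p x y - p1 * (s - x) - p2 * (t - y)) <= eps * (Rabs (s - x) + Rabs (t - y)) /\
    Rabs (q s t - q x y - p2 * (s - x) - q2 * (t - y)) <= eps * (Rabs (s - x) + Rabs (t - y)).

(** The circulation along the boundary, as a relation: it carries the integrability of the four
    sides together with the value. *)
Let circ (a b c d v : R) : Prop := exists i1 i2 i3 i4,
  is_RInt (fun x => p x c) a b i1 /\ is_RInt (fun y => q b y) c d i2 /\
  is_RInt (fun x => p x d) a b i3 /\ is_RInt (fun y => q a y) c d i4 /\
  v = i1 + i2 - i3 - i4.

Lemma is_RInt_linear (a b k l m : R) :
  is_RInt (fun x => k + l * (x - m)) a b (k * (b - a) + l * ((b - m) ^ 2 - (a - m) ^ 2) / 2).
Proof.
  apply (is_RInt_primitive (fun x => k * x + l * (x - m) ^ 2 / 2)).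
  - intros x. auto_derive; [exact I|field].
  - intros x. auto_derive. exact I.
  - field.
Qed.

Lemma is_RInt_near_linear (f : R -> R) (a b k l m e i : R) : a <= b ->
  is_RInt f a b i -> (forall x, a <= x <= b -> Rabs (f x - (k + l * (x - m))) <= e) ->
  Rabs (i - (k * (b - a) + l * ((b - m) ^ 2 - (a - m) ^ 2) / 2)) <= (b - a) * e.
Proof.
  intros Hab Hf He.
  exact (norm_RInt_le_const (V := R_NormedModule) _ a b _ e Hab He
    (is_RInt_minus (V := R_NormedModule) f (fun x => k + l * (x - m)) a b _ _
      Hf (is_RInt_linear a b k l m))).
Qed.

(** Affine forms have zero circulation: the [p1] and [q2] terms cancel between opposite sides, and
    the [p2] terms cancel because the same number is the [y]-slope of [p] and the [x]-slope of [q].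
    Only the errors remain. *)
Lemma green_local (eps : R) : 0 < eps -> forall x y, a0 <= x <= b0 -> c0 <= y <= d0 ->
  exists r, 0 < r /\ forall a b c d,
    a0 <= a <= x -> x <= b <= b0 -> c0 <= c <= y -> y <= d <= d0 ->
    b - a < r -> d - c < r ->
    forall v, circ a b c d v -> Rabs v <= eps * ((b - a) + (d - c)) ^ 2.
Proof.
  intros He x y Hx Hy. destruct (diff x y Hx Hy) as [p1 [p2 [q2 H]]].
  assert (He2 : 0 < eps / 2) by lra.
  destruct (H _ He2) as [r [Hr K]]. exists r. split; [exact Hr|].
  intros a b c d Ha Hb Hc Hd Lx Ly v [i1 [i2 [i3 [i4 [I1 [I2 [I3 [I4 ->]]]]]]]].
  (* Each side contributes its length times [e], and the lengths add up to twice
     [(b - a) + (d - c)]; this is why [eps] is halved. *)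
  set (e := eps / 2 * ((b - a) + (d - c))).
  assert (B : forall s t, a <= s <= b -> c <= t <= d ->
     Rabs (p s t - p x y - p1 * (s - x) - p2 * (t - y)) <= e /\
     Rabs (q s t - q x y - p2 * (s - x) - q2 * (t - y)) <= e).
  { intros s t Hs Ht.
    assert (As : Rabs (s - x) <= b - a) by (apply Rabs_le; lra).
    assert (At : Rabs (t - y) <= d - c) by (apply Rabs_le; lra).
    destruct (K s t ltac:(lra) ltac:(lra)) as [A1 A2].
    assert (eps / 2 * (Rabs (s - x) + Rabs (t - y)) <= e).
    { unfold e. apply Rmult_le_compat_l; lra. }
    lra. }
  assert (J1 := is_RInt_near_linear _ a b (p x y + p2 * (c - y)) p1 x e i1 ltac:(lra) I1).
  assert (J3 := is_RInt_near_linear _ a b (p x y + p2 * (d - y)) p1 x e i3 ltac:(lra) I3).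
  assert (J2 := is_RInt_near_linear _ c d (q x y + p2 * (b - x)) q2 y e i2 ltac:(lra) I2).
  assert (J4 := is_RInt_near_linear _ c d (q x y + p2 * (a - x)) q2 y e i4 ltac:(lra) I4).
  assert (K1 := J1 ltac:(intros s Hs; destruct (B s c Hs ltac:(lra)) as [B1 _]; eapply Rle_trans; [|exact B1]; right; f_equal; ring)).
  assert (K3 := J3 ltac:(intros s Hs; destruct (B s d Hs ltac:(lra)) as [B1 _]; eapply Rle_trans; [|exact B1]; right; f_equal; ring)).
  assert (K2 := J2 ltac:(intros s Hs; destruct (B b s ltac:(lra) Hs) as [_ B1]; eapply Rle_trans; [|exact B1]; right; f_equal; ring)).
  assert (K4 := J4 ltac:(intros s Hs; destruct (B a s ltac:(lra) Hs) as [_ B1]; eapply Rle_trans; [|exact B1]; right; f_equal; ring)).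
  clear J1 J2 J3 J4.
  apply Rabs_le_between in K1, K2, K3, K4.
  replace (eps * ((b - a) + (d - c)) ^ 2) with (2 * (b - a) * e + 2 * (d - c) * e) by (unfold e; field).
  apply Rabs_le. clearbody e. lra.
Qed.

Lemma ex_circ (a b c d : R) : a0 <= a -> a <= b -> b <= b0 -> c0 <= c -> c <= d -> d <= d0 ->
  exists v, circ a b c d v.
Proof.
  intros.
  assert (X : forall y, c0 <= y <= d0 -> ex_RInt (fun x => p x y) a b).
  { intros y Hy. apply (ex_RInt_continuous (V := R_CompleteNormedModule)).
    rewrite Rmin_left, Rmax_right by lra. intros z Hz. apply p_cont_x; lra. }
  assert (Y : forall x, a0 <= x <= b0 -> ex_RInt (fun y => q x y) c d).
  { intros x Hx. apply (ex_RInt_continuous (V := R_CompleteNormedModule)).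
    rewrite Rmin_left, Rmax_right by lra. intros z Hz. apply q_cont_y; lra. }
  destruct (X c ltac:(lra)) as [i1 I1], (X d ltac:(lra)) as [i3 I3],
    (Y b ltac:(lra)) as [i2 I2], (Y a ltac:(lra)) as [i4 I4].
  exists (i1 + i2 - i3 - i4), i1, i2, i3, i4. auto.
Qed.

Lemma circ_unique (a b c d v w : R) : circ a b c d v -> circ a b c d w -> v = w.
Proof.
  intros [i1 [i2 [i3 [i4 [I1 [I2 [I3 [I4 ->]]]]]]]] [j1 [j2 [j3 [j4 [J1 [J2 [J3 [J4 ->]]]]]]]].
  rewrite (is_RInt_inj _ _ _ _ _ I1 J1), (is_RInt_inj _ _ _ _ _ I2 J2), (is_RInt_inj _ _ _ _ _ I3 J3), (is_RInt_inj _ _ _ _ _ I4 J4).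
  reflexivity.
Qed.

(** A bound by the squared half-perimeter is stable under quartering: each quarter has a fourth of
    it, and the circulations add up because the inner edges cancel. The bound therefore spreads from
    small rectangles to the whole one, with an arbitrary factor. *)
Theorem green_zero : a0 <= b0 -> c0 <= d0 -> circ a0 b0 c0 d0 0.
Proof.
  intros Hab Hcd. destruct (ex_circ a0 b0 c0 d0) as [v Hv]; try lra.
  assert (Hz : v = 0).
  { apply cond_eq. rewrite Rminus_0_r. intros eps He.
    (* The [+ 1] keeps the divisor positive when the rectangle is a point. *)
    set (L := ((b0 - a0) + (d0 - c0)) ^ 2 + 1).
    assert (HL : 0 < L) by (unfold L; generalize (pow2_ge_0 ((b0 - a0) + (d0 - c0))); lra).
    assert (He2 : 0 < eps / L) by (apply Rdiv_lt_0_compat; lra).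
    assert (B : Rabs v <= eps / L * ((b0 - a0) + (d0 - c0)) ^ 2).
    2:{ apply Rle_lt_trans with (1 := B). apply Rlt_le_trans with (eps / L * L).
        - apply Rmult_lt_compat_l; [exact He2|unfold L; lra].
        - right. field. lra. }
    set (e := eps / L) in *. clearbody e. clear L HL.
    cut (a0 <= a0 -> b0 <= b0 -> c0 <= c0 -> d0 <= d0 ->
      forall v, circ a0 b0 c0 d0 v -> Rabs v <= e * ((b0 - a0) + (d0 - c0)) ^ 2).
    { intros H. apply H; auto; lra. }
    apply (rectangle_bisection (fun a b c d => a0 <= a -> b <= b0 -> c0 <= c -> d <= d0 ->
      forall v, circ a b c d v -> Rabs v <= e * ((b - a) + (d - c)) ^ 2) a0 b0 c0 d0); auto.
    - clear v Hv. intros a b c d Lab Lcd Q1 Q2 Q3 Q4 H1 H2 H3 H4 v Hv.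
      destruct (ex_circ a ((a + b) / 2) c ((c + d) / 2)) as [v1 V1]; try lra.
      destruct (ex_circ ((a + b) / 2) b c ((c + d) / 2)) as [v2 V2]; try lra.
      destruct (ex_circ a ((a + b) / 2) ((c + d) / 2) d) as [v3 V3]; try lra.
      destruct (ex_circ ((a + b) / 2) b ((c + d) / 2) d) as [v4 V4]; try lra.
      assert (E : v = v1 + v2 + v3 + v4).
      { apply circ_unique with (1 := Hv).
        destruct V1 as [i1 [i2 [i3 [i4 [I1 [I2 [I3 [I4 ->]]]]]]]],
          V2 as [j1 [j2 [j3 [j4 [J1 [J2 [J3 [J4 ->]]]]]]]],
          V3 as [k1 [k2 [k3 [k4 [K1 [K2 [K3 [K4 ->]]]]]]]],
          V4 as [l1 [l2 [l3 [l4 [L1 [L2 [L3 [L4 ->]]]]]]]].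
        exists (i1 + j1), (j2 + l2), (k3 + l3), (i4 + k4).
        split; [exact (is_RInt_Chasles _ _ _ _ _ _ I1 J1)|].
        split; [exact (is_RInt_Chasles _ _ _ _ _ _ J2 L2)|].
        split; [exact (is_RInt_Chasles _ _ _ _ _ _ K3 L3)|].
        split; [exact (is_RInt_Chasles _ _ _ _ _ _ I4 K4)|].
        rewrite (is_RInt_inj _ _ _ _ _ I2 J4), (is_RInt_inj _ _ _ _ _ K2 L4), (is_RInt_inj _ _ _ _ _ I3 K1), (is_RInt_inj _ _ _ _ _ J3 L1).
        ring. }
      assert (W1 := Q1 ltac:(lra) ltac:(lra) ltac:(lra) ltac:(lra) _ V1).
      assert (W2 := Q2 ltac:(lra) ltac:(lra) ltac:(lra) ltac:(lra) _ V2).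
      assert (W3 := Q3 ltac:(lra) ltac:(lra) ltac:(lra) ltac:(lra) _ V3).
      assert (W4 := Q4 ltac:(lra) ltac:(lra) ltac:(lra) ltac:(lra) _ V4).
      clear - E W1 W2 W3 W4.
      apply Rabs_le_between in W1, W2, W3, W4. apply Rabs_le. rewrite E. nra.
    - intros x y Hx Hy. destruct (green_local e He2 x y Hx Hy) as [r [Hr K]].
      exists r. split; [exact Hr|]. intros a b c d A1 A2 A3 A4 A5 A6 _ _ _ _. now apply K. }
  now rewrite Hz in Hv.
Qed.

Corollary green_periodic (i j : R) : a0 <= b0 -> c0 <= d0 ->
  (forall x, p x c0 = p x d0) ->
  is_RInt (fun y => q a0 y) c0 d0 i -> is_RInt (fun y => q b0 y) c0 d0 j -> i = j.
Proof.
  intros Hab Hcd Hp Hi Hj.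
  destruct (green_zero Hab Hcd) as [i1 [i2 [i3 [i4 [I1 [I2 [I3 [I4 E]]]]]]]].
  assert (E1 : i1 = i3).
  { apply (is_RInt_inj _ _ _ _ _ I1). revert I3. apply is_RInt_ext. intros x _. now rewrite Hp. }
  rewrite (is_RInt_inj _ _ _ _ _ Hi I4), (is_RInt_inj _ _ _ _ _ Hj I2). lra.
Qed.
End Green.

(** * Means over circles and Bessel's inequality *)

Lemma Cmod_le_abs (x : C) : Cmod x <= Rabs (fst x) + Rabs (snd x).
Proof.
  assert (E : x = (RtoC (fst x) + RtoC (snd x) * Ci)%C).
  { destruct x. unfold RtoC, Ci, Cplus, Cmult; simpl. f_equal; ring. }
  rewrite E at 1. eapply Rle_trans; [apply Cmod_triangle|].
  rewrite Cmod_mult, Cmod_Ci, !Cmod_R. lra.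
Qed.

Lemma abs_fst_le (x : C) : Rabs (fst x) <= Cmod x.
Proof. eapply Rle_trans; [apply Rmax_l|apply Rmax_Cmod]. Qed.

Lemma abs_snd_le (x : C) : Rabs (snd x) <= Cmod x.
Proof. eapply Rle_trans; [apply Rmax_r|apply Rmax_Cmod]. Qed.

Lemma Clim_fst (f : R -> C) (t : R) :
  Clim (locally t) f (f t) -> continuous (fun s => fst (f s)) t.
Proof.
  intros H. apply filterlim_locally. intros e.
  generalize (H e (cond_pos e)). apply filter_imp. intros s Hs.
  apply Rle_lt_trans with (2 := Hs). exact (abs_fst_le (f s - f t)).
Qed.

Lemma Clim_snd (f : R -> C) (t : R) :
  Clim (locally t) f (f t) -> continuous (fun s => snd (f s)) t.
Proof.
  intros H. apply filterlim_locally. intros e.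
  generalize (H e (cond_pos e)). apply filter_imp. intros s Hs.
  apply Rle_lt_trans with (2 := Hs). exact (abs_snd_le (f s - f t)).
Qed.

Definition is_mean (f : R -> C) (v : C) : Prop :=
  is_RInt (fun t => fst (f t)) 0 (2 * PI) (2 * PI * fst v) /\
  is_RInt (fun t => snd (f t)) 0 (2 * PI) (2 * PI * snd v).

Lemma is_mean_ext (f g : R -> C) (v : C) :
  (forall t, f t = g t) -> is_mean f v -> is_mean g v.
Proof. intros H. replace g with f; [auto|]. now apply functional_extensionality. Qed.

Lemma is_mean_eq (f : R -> C) (v w : C) : v = w -> is_mean f v -> is_mean f w.
Proof. now intros ->. Qed.

Lemma is_RInt_val (f : R -> R) (a b u v : R) : u = v -> is_RInt f a b u -> is_RInt f a b v.
Proof. now intros ->. Qed.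

Lemma is_mean_plus (f g : R -> C) (u v : C) :
  is_mean f u -> is_mean g v -> is_mean (fun t => f t + g t)%C (u + v)%C.
Proof.
  intros [A B] [A' B']. split.
  - apply is_RInt_val with (2 * PI * fst u + 2 * PI * fst v); [simpl; ring|].
    exact (is_RInt_plus (V := R_NormedModule) _ _ _ _ _ _ A A').
  - apply is_RInt_val with (2 * PI * snd u + 2 * PI * snd v); [simpl; ring|].
    exact (is_RInt_plus (V := R_NormedModule) _ _ _ _ _ _ B B').
Qed.

Lemma is_mean_scal (c : C) (f : R -> C) (u : C) :
  is_mean f u -> is_mean (fun t => c * f t)%C (c * u)%C.
Proof.
  intros [A B]. destruct c as [x y]. split.
  - apply is_RInt_val with (x * (2 * PI * fst u) - y * (2 * PI * snd u)); [simpl; ring|].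
    apply (is_RInt_minus (V := R_NormedModule)); now apply (is_RInt_scal (V := R_NormedModule)).
  - apply is_RInt_val with (x * (2 * PI * snd u) + y * (2 * PI * fst u)); [simpl; ring|].
    apply (is_RInt_plus (V := R_NormedModule)); now apply (is_RInt_scal (V := R_NormedModule)).
Qed.

Lemma is_mean_minus (f g : R -> C) (u v : C) :
  is_mean f u -> is_mean g v -> is_mean (fun t => f t - g t)%C (u - v)%C.
Proof.
  intros A B. apply is_mean_eq with (u + (- (1)) * v)%C; [ring|].
  apply is_mean_ext with (fun t => f t + (- (1)) * g t)%C; [intros t; ring|].
  apply is_mean_plus; [exact A|now apply is_mean_scal].
Qed.

Lemma is_mean_conj (f : R -> C) (u : C) :
  is_mean f u -> is_mean (fun t => Cconj (f t)) (Cconj u).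
Proof.
  intros [A B]. split; [exact A|].
  apply is_RInt_val with (- (2 * PI * snd u)); [simpl; ring|].
  exact (is_RInt_opp (V := R_NormedModule) _ _ _ _ B).
Qed.

Lemma is_mean_const (c : C) : is_mean (fun _ => c) c.
Proof.
  split; (eapply is_RInt_val; [|apply (is_RInt_const (V := R_NormedModule))]);
  unfold scal; simpl; unfold mult; simpl; ring.
Qed.

Lemma is_mean_unique (f : R -> C) (u v : C) : is_mean f u -> is_mean f v -> u = v.
Proof.
  intros [A B] [A' B'].
  assert (P := PI_RGT_0).
  assert (E := is_RInt_inj _ _ _ _ _ A A'). assert (F := is_RInt_inj _ _ _ _ _ B B').
  destruct u, v; simpl in *. f_equal; apply Rmult_eq_reg_l with (2 * PI); lra.
Qed.

Lemma is_mean_le (f g : R -> C) (u v : C) :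
  is_mean f u -> is_mean g v -> (forall t, fst (f t) <= fst (g t)) -> fst u <= fst v.
Proof.
  intros [A _] [B _] H. assert (P := PI_RGT_0).
  apply Rmult_le_reg_l with (2 * PI); [lra|].
  apply (is_RInt_le _ _ 0 (2 * PI) _ _ ltac:(lra) A B). auto.
Qed.

(** Pairing with [Cconj u] turns the mean into the real number [|u|^2], so comparing real parts is
    enough. *)
Lemma is_mean_bound (f : R -> C) (u : C) (M : R) :
  is_mean f u -> (forall t, Cmod (f t) <= M) -> Cmod u <= M.
Proof.
  intros H HM.
  assert (L := is_mean_le _ _ _ _ (is_mean_scal (Cconj u) _ _ H) (is_mean_const (RtoC (Cmod u * M)))).
  assert (HL : fst (Cconj u * u)%C <= Cmod u * M).
  { apply L. intros t. apply Rle_trans with (1 := Rle_abs _).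
    apply Rle_trans with (1 := abs_fst_le _). rewrite Cmod_mult, Cmod_conj.
    apply Rmult_le_compat_l; [apply Cmod_ge_0|apply HM]. }
  rewrite Cmult_comm, <- Cmod_sq_conj in HL. simpl in HL.
  assert (M0 : 0 <= M) by (apply Rle_trans with (2 := HM 0); apply Cmod_ge_0).
  destruct (Cmod_ge_0 u) as [P|P]; [|lra].
  apply Rmult_le_reg_l with (1 := P). lra.
Qed.

Lemma ex_mean (f : R -> C) : (forall t, Clim (locally t) f (f t)) -> exists v, is_mean f v.
Proof.
  intros H. assert (P := PI_RGT_0).
  destruct (ex_RInt_continuous (V := R_CompleteNormedModule) (fun t => fst (f t)) 0 (2 * PI)) as [a A].
  { intros t _. apply Clim_fst, H. }
  destruct (ex_RInt_continuous (V := R_CompleteNormedModule) (fun t => snd (f t)) 0 (2 * PI)) as [b B].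
  { intros t _. apply Clim_snd, H. }
  assert (E : forall x : R, x = 2 * PI * (x / (2 * PI))) by (intros x; field; lra).
  exists (a / (2 * PI), b / (2 * PI)). split; simpl.
  - apply is_RInt_val with (1 := E a), A.
  - apply is_RInt_val with (1 := E b), B.
Qed.

(** * Characters of the circle and their orthogonality *)

Definition cis (t : R) : C := (cos t, sin t).

Lemma Cmod_cis (t : R) : Cmod (cis t) = 1.
Proof.
  unfold Cmod, cis; simpl. rewrite !Rmult_1_r. rewrite Rplus_comm.
  replace (sin t * sin t + cos t * cos t) with 1; [apply sqrt_1|].
  symmetry. apply sin2_cos2.
Qed.

Lemma cis_conj (t : R) : (cis t * Cconj (cis t))%C = 1%C.
Proof. rewrite <- Cmod_sq_conj, Cmod_cis. now rewrite pow1. Qed.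

Lemma cis_plus (s t : R) : cis (s + t) = (cis s * cis t)%C.
Proof. unfold cis, Cmult; simpl. rewrite cos_plus, sin_plus. f_equal; ring. Qed.

Lemma cis_pow (n : nat) (t : R) : (cis t ^ n)%C = cis (INR n * t).
Proof.
  induction n as [|n IH].
  - simpl. rewrite Rmult_0_l. unfold cis. now rewrite cos_0, sin_0.
  - rewrite Cpow_S, IH, S_INR, <- cis_plus. f_equal. ring.
Qed.

Lemma sin_2PI_mult (n : nat) : sin (INR n * (2 * PI)) = 0.
Proof.
  replace (INR n * (2 * PI)) with (0 + 2 * INR n * PI) by ring.
  now rewrite sin_period, sin_0.
Qed.

Lemma cos_2PI_mult (n : nat) : cos (INR n * (2 * PI)) = 1.
Proof.
  replace (INR n * (2 * PI)) with (0 + 2 * INR n * PI) by ring.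
  now rewrite cos_period, cos_0.
Qed.

Lemma is_mean_cis_pow (n : nat) : (0 < n)%nat -> is_mean (fun t => cis t ^ n)%C 0%C.
Proof.
  intros Hn. assert (Hn' : INR n <> 0) by (apply not_0_INR; lia).
  apply is_mean_ext with (fun t => cis (INR n * t)); [intros t; now rewrite cis_pow|].
  split; simpl.
  - apply (is_RInt_primitive (fun t => sin (INR n * t) / INR n)).
    + intros t. auto_derive; [exact I|]. field. exact Hn'.
    + intros t. auto_derive. exact I.
    + rewrite sin_2PI_mult, !Rmult_0_r, sin_0. field. exact Hn'.
  - apply (is_RInt_primitive (fun t => - cos (INR n * t) / INR n)).
    + intros t. auto_derive; [exact I|]. field. exact Hn'.
    + intros t. auto_derive. exact I.
    + rewrite cos_2PI_mult, !Rmult_0_r, cos_0. field. exact Hn'.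
Qed.

Lemma cis_pow_conj (k n : nat) (t : R) : (n <= k)%nat ->
  (cis t ^ k * Cconj (cis t) ^ n)%C = (cis t ^ (k - n))%C.
Proof.
  intros H. replace k with (k - n + n)%nat at 1 by lia.
  rewrite Cpow_add_r, <- Cmult_assoc, <- Cpow_mult_l, cis_conj, Cpow_1_l. ring.
Qed.

Lemma is_mean_orth (k n : nat) :
  is_mean (fun t => cis t ^ k * Cconj (cis t) ^ n)%C (if Nat.eq_dec k n then 1 else 0)%C.
Proof.
  assert (G : forall k n, (n < k)%nat -> is_mean (fun t => cis t ^ k * Cconj (cis t) ^ n)%C 0%C).
  { clear. intros k n H. apply is_mean_ext with (fun t => cis t ^ (k - n))%C.
    - intros t. now rewrite cis_pow_conj by lia.
    - apply is_mean_cis_pow. lia. }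
  destruct (Nat.eq_dec k n) as [->|N].
  - apply is_mean_ext with (fun _ => RtoC 1); [|apply is_mean_const].
    intros t. rewrite cis_pow_conj by lia. now rewrite Nat.sub_diag.
  - destruct (Nat.lt_ge_cases n k) as [L|L]; [now apply G|].
    apply is_mean_eq with (Cconj 0)%C; [unfold Cconj; simpl; now rewrite Ropp_0|].
    apply is_mean_ext with (fun t => Cconj (cis t ^ n * Cconj (cis t) ^ k))%C.
    + intros t. rewrite Cmult_conj, !Cpow_conj, Cconj_conj. ring.
    + apply is_mean_conj, G. lia.
Qed.

Fixpoint rsum (f : nat -> R) (n : nat) : R :=
  match n with O => 0 | S m => rsum f m + f m end.

Lemma rsum_S (f : nat -> R) (n : nat) : rsum f (S n) = rsum f n + f n.
Proof. reflexivity. Qed.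

Lemma rsum_ext (f g : nat -> R) (n : nat) :
  (forall k, (k < n)%nat -> f k = g k) -> rsum f n = rsum g n.
Proof.
  induction n as [|n IH]; intros H; [reflexivity|]. simpl.
  rewrite IH, H; auto.
Qed.

Lemma rsum_le (f g : nat -> R) (n : nat) :
  (forall k, (k < n)%nat -> f k <= g k) -> rsum f n <= rsum g n.
Proof.
  induction n as [|n IH]; intros H; [simpl; lra|]. simpl.
  apply Rplus_le_compat; auto.
Qed.

Lemma mean_sq_nonneg (g : R -> C) (A : C) :
  is_mean (fun t => g t * Cconj (g t))%C A -> 0 <= fst A.
Proof.
  intros H. apply (is_mean_le (fun _ => RtoC 0) _ (RtoC 0) A (is_mean_const 0) H).
  intros t. rewrite <- Cmod_sq_conj. simpl fst at 2. apply pow2_ge_0.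
Qed.

(** The projections are removed one frequency at a time: subtracting [c n * cis t ^ n] lowers the
    mean square by exactly [|c n|^2] and leaves the later coefficients unchanged. The residue [g]
    still has a nonnegative mean square. *)
Lemma bessel (f : R -> C) (A : C) (c : nat -> C) (n : nat) :
  is_mean (fun t => f t * Cconj (f t))%C A ->
  (forall k, is_mean (fun t => f t * Cconj (cis t) ^ k)%C (c k)) ->
  rsum (fun k => Cmod (c k) ^ 2) n <= fst A.
Proof.
  intros HA Hc.
  assert (G : exists g : R -> C,
    is_mean (fun t => g t * Cconj (g t))%C (A - RtoC (rsum (fun k => Cmod (c k) ^ 2)%R n))%C /\
    forall k, (n <= k)%nat -> is_mean (fun t => g t * Cconj (cis t) ^ k)%C (c k)).
  { induction n as [|n [g [G1 G2]]].
    - exists f. split; [|auto]. apply is_mean_eq with A; [simpl; ring|exact HA].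
    - exists (fun t => g t - c n * cis t ^ n)%C. split.
      + assert (M := G2 n (Nat.le_refl n)).
        apply is_mean_eq with (A - RtoC (rsum (fun k => Cmod (c k) ^ 2)%R n)
          - (Cconj (c n) * c n + c n * Cconj (c n)) + c n * Cconj (c n))%C.
        { rewrite rsum_S, RtoC_plus, Cmod_sq_conj. ring. }
        apply is_mean_ext with (fun t => g t * Cconj (g t)
          - (Cconj (c n) * (g t * Cconj (cis t) ^ n)
             + c n * Cconj (g t * Cconj (cis t) ^ n)) + c n * Cconj (c n))%C.
        { intros t. rewrite Cminus_conj, !Cmult_conj, !Cpow_conj, Cconj_conj.
          replace (c n * Cconj (c n))%C with (c n * Cconj (c n) * (cis t ^ n * Cconj (cis t) ^ n))%C.
          - ring.
          - rewrite <- Cpow_mult_l, cis_conj, Cpow_1_l. ring. }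
        apply is_mean_plus; [|apply is_mean_const].
        apply is_mean_minus; [exact G1|].
        apply is_mean_plus; apply is_mean_scal; [exact M|now apply is_mean_conj].
      + intros k Hk. apply is_mean_eq with (c k - c n * 0)%C; [ring|].
        apply is_mean_ext with (fun t => g t * Cconj (cis t) ^ k
          - c n * (cis t ^ n * Cconj (cis t) ^ k))%C; [intros t; ring|].
        apply is_mean_minus; [apply G2; lia|]. apply is_mean_scal.
        generalize (is_mean_orth n k). destruct (Nat.eq_dec n k); [lia|auto]. }
  destruct G as [g [G _]]. apply mean_sq_nonneg in G.
  change (0 <= fst A + - rsum (fun k => Cmod (c k) ^ 2) n) in G. lra.
Qed.

(** The Riemann-Lebesgue lemma for continuous functions: by Bessel the squared coefficients are
    summable. *)
Lemma bessel_tends_0 (f : R -> C) (c : nat -> C) :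
  (forall t, Clim (locally t) f (f t)) ->
  (forall k, is_mean (fun t => f t * Cconj (cis t) ^ k)%C (c k)) ->
  Clim eventually c 0%C.
Proof.
  intros Hf Hc.
  destruct (ex_mean (fun t => f t * Cconj (f t))%C) as [A HA].
  { intros t. apply Clim_mult; [apply locally_filter|apply Hf|].
    apply Clim_conj; [apply locally_filter|apply Hf]. }
  assert (S : ex_series (fun k => Cmod (c k) ^ 2)).
  { destruct (ex_finite_lim_seq_incr (fun n => sum_n (fun k => Cmod (c k) ^ 2) n) (fst A)) as [l Hl].
    - intros n. rewrite sum_Sn. unfold plus; simpl. generalize (pow2_ge_0 (Cmod (c (S n)))). simpl. lra.
    - intros n. apply Rle_trans with (2 := bessel f A c (S n) HA Hc). right.
      induction n as [|n IH]; [rewrite sum_O; simpl; ring|].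
      rewrite sum_Sn, IH. reflexivity.
    - exists l. exact Hl. }
  intros e He. assert (L := ex_series_lim_0 _ S).
  apply is_lim_seq_spec in L. assert (He2 : 0 < e ^ 2) by (apply pow_lt; exact He).
  destruct (L (mkposreal _ He2)) as [N HN]. exists N. intros n Hn.
  specialize (HN n Hn). cbn [pos] in HN. rewrite Rminus_0_r in HN.
  rewrite Rabs_pos_eq in HN by apply pow2_ge_0.
  replace (c n - 0)%C with (c n) by ring.
  apply Rnot_le_lt. intros K. apply (Rlt_not_le _ _ HN). apply pow_incr. lra.
Qed.

(** * Taylor expansion *)

Lemma is_derive_eps (f : R -> R) (t l eps : R) : is_derive f t l -> 0 < eps ->
  locally t (fun y => Rabs (f y - f t - (y - t) * l) <= eps * Rabs (y - t)).
Proof.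
  intros [_ H] He. exact (H t (fun P HP => HP) (mkposreal _ He)).
Qed.

Lemma rder_of_is_derive (f : R -> C) (t a b : R) :
  is_derive (fun s => fst (f s)) t a -> is_derive (fun s => snd (f s)) t b -> rder f t (a, b).
Proof.
  intros A B. apply gder_of_eps; [apply locally_filter| |].
  - intros y E. now rewrite (RtoC_inj _ _ E).
  - intros e He. assert (He2 : 0 < e / 2) by lra.
    generalize (filter_and _ _ (is_derive_eps _ _ _ _ A He2) (is_derive_eps _ _ _ _ B He2)).
    apply filter_imp. intros y [K L].
    rewrite <- RtoC_minus, Cmod_R.
    apply Rle_trans with (1 := Cmod_le_abs _).
    replace (fst (f y - f t - RtoC (y - t) * (a, b))%C) with (fst (f y) - fst (f t) - (y - t) * a)
      by (simpl; ring).
    replace (snd (f y - f t - RtoC (y - t) * (a, b))%C) with (snd (f y) - snd (f t) - (y - t) * b)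
      by (simpl; ring).
    lra.
Qed.

Lemma rder_cis (t : R) : rder cis t (Ci * cis t).
Proof.
  replace (Ci * cis t)%C with (- sin t, cos t) by (unfold Ci, cis, Cmult; simpl; f_equal; ring).
  apply rder_of_is_derive; unfold cis; simpl; auto_derive; auto; ring.
Qed.

Lemma cis_0 : cis 0 = 1%C.
Proof. unfold cis. now rewrite cos_0, sin_0. Qed.

(** * The complex exponential *)

Definition cexp (w : C) : C := (RtoC (exp (fst w)) * cis (snd w))%C.

Lemma cexp_plus (z w : C) : cexp (z + w) = (cexp z * cexp w)%C.
Proof.
  unfold cexp. simpl. rewrite exp_plus, cis_plus, RtoC_mult. ring.
Qed.

Lemma Cmod_cexp (w : C) : Cmod (cexp w) = exp (fst w).
Proof.
  unfold cexp. rewrite Cmod_mult, Cmod_cis, Cmod_R, Rabs_pos_eq; [ring|].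
  left. apply exp_pos.
Qed.

Lemma cexp_near_0 (eps : R) : 0 < eps -> exists r, 0 < r /\ forall k : C, Cmod k < r ->
  Cmod (cexp k - 1 - k) <= eps * Cmod k.
Proof.
  (* The three error terms below cost [e * c], [2 * (e * c)] and [e * c], hence [eps / 4]. With
     [Cmod k < e / 2], the bound [e <= 1] gives [|exp x - 1| <= e] and [exp x <= 2]. *)
  intros He. set (e := Rmin (eps / 4) 1).
  assert (He' : 0 < e) by (apply Rmin_pos; lra).
  assert (L1 : e <= eps / 4) by apply Rmin_l. assert (L2 : e <= 1) by apply Rmin_r.
  assert (D1 : is_derive exp 0 1) by (auto_derive; auto; rewrite exp_0; ring).
  destruct (is_derive_eps exp 0 1 e D1 He') as [[r1 H1] K1].
  destruct (gder_eps _ _ _ _ _ e (rder_cis 0) He') as [[r2 H2] K2].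
  exists (Rmin (Rmin r1 r2) (e / 2)). split.
  { apply Rmin_pos; [now apply Rmin_pos|lra]. }
  intros k Hk.
  assert (B1 : Cmod k < r1).
  { apply Rlt_le_trans with (1 := Hk). eapply Rle_trans; [apply Rmin_l|apply Rmin_l]. }
  assert (B2 : Cmod k < r2).
  { apply Rlt_le_trans with (1 := Hk). eapply Rle_trans; [apply Rmin_l|apply Rmin_r]. }
  assert (B3 : Cmod k < e / 2) by (apply Rlt_le_trans with (1 := Hk); apply Rmin_r).
  destruct k as [x y].
  assert (X : Rabs x <= Cmod (x, y)) by exact (abs_fst_le (x, y)).
  assert (Y : Rabs y <= Cmod (x, y)) by exact (abs_snd_le (x, y)).
  assert (X0 : Rabs (x - 0) < r1) by (rewrite Rminus_0_r; lra).
  assert (Y0 : Rabs (y - 0) < r2) by (rewrite Rminus_0_r; lra).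
  specialize (K1 x X0). specialize (K2 y Y0). cbv beta in K1, K2.
  rewrite exp_0, !Rminus_0_r, Rmult_1_r in K1.
  rewrite cis_0, <- RtoC_minus, Cmod_R, !Rminus_0_r in K2.
  set (c := Cmod (x, y)) in *.
  assert (E1 : Rabs (exp x - 1) <= 2 * c).
  { replace (exp x - 1) with ((exp x - 1 - x) + x) by ring.
    eapply Rle_trans; [apply Rabs_triang|]. generalize (Rabs_pos x). nra. }
  assert (E2 : exp x <= 2) by (generalize (Rle_abs (exp x - 1)); lra).
  replace (cexp (x, y) - 1 - (x, y))%C
    with (RtoC (exp x - 1 - x) + RtoC (exp x) * (cis y - 1 - RtoC y * (Ci * 1))
          + RtoC (exp x - 1) * (RtoC y * Ci))%C.
  2:{ unfold cexp. cbn [fst snd].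
      replace (x, y) with (RtoC x + RtoC y * Ci)%C
        by (unfold RtoC, Ci, Cplus, Cmult; simpl; f_equal; ring).
      rewrite !RtoC_minus. ring. }
  eapply Rle_trans; [apply Cmod_triangle|].
  eapply Rle_trans; [apply Rplus_le_compat_r, Cmod_triangle|].
  rewrite !Cmod_mult, Cmod_Ci, !Cmod_R, Rmult_1_r.
  rewrite (Rabs_pos_eq (exp x)) by (left; apply exp_pos).
  assert (P := exp_pos x).
  assert (exp x * Cmod (cis y - 1 - y * (Ci * 1)) <= 2 * (e * c)).
  { apply Rmult_le_compat; [lra|apply Cmod_ge_0|lra|].
    apply Rle_trans with (1 := K2). apply Rmult_le_compat_l; lra. }
  assert (Rabs (exp x - 1) * Rabs y <= e * c).
  { apply Rmult_le_compat; [apply Rabs_pos|apply Rabs_pos|lra|lra]. }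
  assert (e * Rabs x <= e * c) by (apply Rmult_le_compat_l; lra).
  assert (0 <= c) by apply Cmod_ge_0.
  assert (4 * e * c <= eps * c) by (apply Rmult_le_compat_r; lra).
  lra.
Qed.

Lemma cder_cexp (w : C) : cder cexp w (cexp w).
Proof.
  apply gder_of_eps; [apply nearC_filter|now intros y ->|]. intros e He.
  assert (P := exp_pos (fst w)).
  destruct (cexp_near_0 (e / exp (fst w))) as [r [Hr K]]; [now apply Rdiv_lt_0_compat|].
  apply (nearC_intro _ _ r Hr). intros y Hy. specialize (K _ Hy).
  replace (cexp y - cexp w - (y - w) * cexp w)%C with (cexp w * (cexp (y - w) - 1 - (y - w)))%C.
  - rewrite Cmod_mult, Cmod_cexp.
    apply Rle_trans with (exp (fst w) * (e / exp (fst w) * Cmod (y - w))).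
    + apply Rmult_le_compat_l; lra.
    + right. field. lra.
  - replace (cexp y) with (cexp w * cexp (y - w))%C; [ring|].
    rewrite <- cexp_plus. f_equal. ring.
Qed.

(** * Means over concentric circles *)

Lemma circle_disc (r t : R) : 0 <= r < 1 -> disc (RtoC r * cis t)%C.
Proof.
  intros H. unfold disc. rewrite Cmod_mult, Cmod_cis, Cmod_R, Rabs_pos_eq; lra.
Qed.

Lemma Cmod_circle (r t : R) : 0 <= r -> Cmod (RtoC r * cis t)%C = r.
Proof. intros H. rewrite Cmod_mult, Cmod_cis, Cmod_R, Rabs_pos_eq; lra. Qed.

Lemma cis_cont (t : R) : Clim (locally t) cis (cis t).
Proof. exact (gder_cont _ RtoC t (Clim_RtoC t) cis _ (rder_cis t)). Qed.

Lemma circle_cont (F : C -> C) (r t : R) :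
  Clim (nearC (RtoC r * cis t)%C) F (F (RtoC r * cis t)%C) ->
  Clim (locally t) (fun s => F (RtoC r * cis s)%C) (F (RtoC r * cis t)%C).
Proof.
  intros H. apply (Clim_comp _ F) with (RtoC r * cis t)%C; [exact H|].
  apply Clim_mult; [apply locally_filter|apply Clim_const; apply locally_filter|apply cis_cont].
Qed.

Lemma cder_cont (F : C -> C) (z d : C) : cder F z d -> Clim (nearC z) F (F z).
Proof. apply gder_cont; [apply nearC_filter|apply Clim_id]. Qed.

Lemma holo_circle_cont (F : C -> C) (r t : R) : holo F -> 0 <= r < 1 ->
  Clim (locally t) (fun s => F (RtoC r * cis s)%C) (F (RtoC r * cis t)%C).
Proof.
  intros H Hr. destruct (H _ (circle_disc r t Hr)) as [d Hd].
  apply circle_cont, cder_cont with (1 := Hd).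
Qed.

(* In the coordinate [w = x + iy], [z = exp w], a circle becomes a vertical
   segment of length [2 PI], and the horizontal sides of the rectangle between
   two such segments carry equal values. *)
Lemma circle_mean_fst (K : C -> C) (r1 r2 i j : R) :
  (forall z, 0 < Cmod z < 1 -> exists d, cder K z d) -> 0 < r1 -> r1 <= r2 -> r2 < 1 ->
  is_RInt (fun t => fst (K (RtoC r1 * cis t)%C)) 0 (2 * PI) i ->
  is_RInt (fun t => fst (K (RtoC r2 * cis t)%C)) 0 (2 * PI) j -> i = j.
Proof.
  intros HK H1 H12 H2 Hi Hj.
  assert (P := PI_RGT_0).
  set (G := fun w => K (cexp w)).
  assert (Hl : ln r1 <= ln r2) by (destruct H12 as [L| ->]; [left; now apply ln_increasing|lra]).
  assert (Hl2 : ln r2 < 0) by (rewrite <- ln_1; apply ln_increasing; lra).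
  assert (HG : forall x y, ln r1 <= x <= ln r2 -> exists d, cder G (x, y) d).
  { intros x y Hx. destruct (HK (cexp (x, y))) as [d Hd].
    - rewrite Cmod_cexp. cbn [fst]. split; [apply exp_pos|]. rewrite <- exp_0.
      apply exp_increasing. lra.
    - exists (d * cexp (x, y))%C.
      exact (gder_comp (nearC (x, y)) (fun w => w) (x, y) (Clim_id _) K cexp _ _ Hd (cder_cexp _)). }
  assert (D : forall x y, ln r1 <= x <= ln r2 -> exists d : C, forall eps, 0 < eps ->
    exists r, 0 < r /\ forall s t, Rabs (s - x) < r -> Rabs (t - y) < r ->
    Rabs (fst (G (s, t)) - fst (G (x, y)) - (fst d * (s - x) - snd d * (t - y)))
      <= eps * (Rabs (s - x) + Rabs (t - y)) /\
    Rabs (snd (G (s, t)) - snd (G (x, y)) - (snd d * (s - x) + fst d * (t - y)))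
      <= eps * (Rabs (s - x) + Rabs (t - y))).
  { intros x y Hx. destruct (HG x y Hx) as [d Hd]. exists d. intros e He.
    destruct (nearC_elim _ _ (gder_eps _ _ _ _ _ e Hd He)) as [r [Hr B]].
    exists (r / 2). split; [lra|]. intros s t Hs Ht.
    assert (N : Cmod ((s, t) - (x, y))%C <= Rabs (s - x) + Rabs (t - y)) by apply Cmod_le_abs.
    assert (Q := B (s, t) ltac:(lra)).
    assert (Q' : Cmod (G (s, t) - G (x, y) - ((s, t) - (x, y)) * d)%C
      <= e * (Rabs (s - x) + Rabs (t - y))).
    { apply Rle_trans with (1 := Q). apply Rmult_le_compat_l; lra. }
    split.
    - apply Rle_trans with (2 := Q'). eapply Rle_trans; [|apply abs_fst_le].
      right. f_equal. simpl. ring.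
    - apply Rle_trans with (2 := Q'). eapply Rle_trans; [|apply abs_snd_le].
      right. f_equal. simpl. ring. }
  assert (Ct : forall x y, ln r1 <= x <= ln r2 ->
    continuous (fun t => snd (G (t, y))) x /\ continuous (fun t => fst (G (x, t))) y).
  { intros x y Hx. destruct (HG x y Hx) as [d Hd]. apply cder_cont in Hd. split.
    - apply (Clim_snd (fun t => G (t, y))). apply (Clim_comp _ G) with (x, y); [exact Hd|].
      intros e He. exists (mkposreal e He). intros s Hs.
      apply Rle_lt_trans with (1 := Cmod_le_abs _). simpl.
      replace (y + - y) with 0 by ring. rewrite Rabs_R0, Rplus_0_r. exact Hs.
    - apply (Clim_fst (fun t => G (x, t))). apply (Clim_comp _ G) with (x, y); [exact Hd|].
      intros e He. exists (mkposreal e He). intros s Hs.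
      apply Rle_lt_trans with (1 := Cmod_le_abs _). simpl.
      replace (x + - x) with 0 by ring. rewrite Rabs_R0, Rplus_0_l. exact Hs. }
  (* The form [Im G dx + Re G dy] is the imaginary part of [G dw], closed by the Cauchy-Riemann
     equations; on vertical sides it integrates [Re G]. *)
  apply (green_periodic (fun x y => snd (G (x, y))) (fun x y => fst (G (x, y)))
    (ln r1) (ln r2) 0 (2 * PI)).
  - intros x y Hx _. exact (proj1 (Ct x y Hx)).
  - intros x y Hx _. exact (proj2 (Ct x y Hx)).
  - intros x y Hx _. destruct (D x y Hx) as [d Hd].
    exists (snd d), (fst d), (- snd d). intros e He. destruct (Hd e He) as [r [Hr B]].
    exists r. split; [exact Hr|]. intros s t Hs Ht. destruct (B s t Hs Ht) as [B1 B2]. split.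
    + apply Rle_trans with (2 := B2). right. f_equal. ring.
    + apply Rle_trans with (2 := B1). right. f_equal. ring.
  - exact Hl.
  - lra.
  - intros x. unfold G, cexp. cbn [fst snd]. do 3 f_equal. unfold cis.
    now rewrite cos_2PI, sin_2PI, cos_0, sin_0.
  - revert Hi. apply is_RInt_ext. intros t _. unfold G, cexp. cbn [fst snd].
    now rewrite exp_ln.
  - revert Hj. apply is_RInt_ext. intros t _. unfold G, cexp. cbn [fst snd].
    rewrite exp_ln; [reflexivity|lra].
Qed.

(** [K] may be singular at 0: this is what allows quotients by [z ^ n]. *)
Lemma circle_mean_const (K : C -> C) (r1 r2 : R) (u v : C) :
  (forall z, 0 < Cmod z < 1 -> exists d, cder K z d) -> 0 < r1 < 1 -> 0 < r2 < 1 ->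
  is_mean (fun t => K (RtoC r1 * cis t)%C) u -> is_mean (fun t => K (RtoC r2 * cis t)%C) v ->
  u = v.
Proof.
  intros HK.
  assert (W : forall r1 r2 u v, 0 < r1 < 1 -> 0 < r2 < 1 -> r1 <= r2 ->
    is_mean (fun t => K (RtoC r1 * cis t)%C) u -> is_mean (fun t => K (RtoC r2 * cis t)%C) v ->
    u = v).
  { clear r1 r2 u v. intros r1 r2 u v H1 H2 H12 Hu Hv.
    assert (P := PI_RGT_0).
    assert (E1 := circle_mean_fst K r1 r2 _ _ HK ltac:(lra) H12 ltac:(lra) (proj1 Hu) (proj1 Hv)).
    (* The real part of [- i K] is the imaginary part of [K]. *)
    assert (HK2 : forall z, 0 < Cmod z < 1 -> exists d, cder (fun w => - Ci * K w)%C z d).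
    { intros z Hz. destruct (HK z Hz) as [d Hd]. exists (- Ci * d)%C.
      apply gder_scal; [apply nearC_filter|apply Clim_id|exact Hd]. }
    assert (E2 := circle_mean_fst _ r1 r2 _ _ HK2 ltac:(lra) H12 ltac:(lra)
      (proj1 (is_mean_scal (- Ci) _ _ Hu)) (proj1 (is_mean_scal (- Ci) _ _ Hv))).
    destruct u, v. simpl in E1, E2. f_equal; apply Rmult_eq_reg_l with (2 * PI); lra. }
  intros H1 H2 Hu Hv. destruct (Rle_or_lt r1 r2) as [L|L].
  - now apply (W r1 r2).
  - symmetry. apply (W r2 r1); auto. lra.
Qed.

Lemma mean_value (K : C -> C) (r : R) : holo K -> 0 < r < 1 ->
  is_mean (fun t => K (RtoC r * cis t)%C) (K 0%C).
Proof.
  intros HK Hr.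
  assert (Hex : forall s, 0 < s < 1 -> exists v, is_mean (fun t => K (RtoC s * cis t)%C) v).
  { intros s Hs. apply ex_mean. intros t. apply holo_circle_cont; [exact HK|lra]. }
  destruct (Hex r Hr) as [v Hv].
  replace (K 0%C) with v; [exact Hv|].
  apply NNPP. intros N.
  assert (e0 : 0 < Cmod (v - K 0%C)) by (apply Cmod_gt_0; now apply Cminus_eq_contra).
  assert (e1 : 0 < Cmod (v - K 0%C) / 2) by lra.
  destruct (HK _ disc_0) as [d Hd]. apply cder_cont in Hd.
  destruct (nearC_elim _ _ (Hd _ e1)) as [s [Hs B]].
  (* On a circle this small [K] is uniformly close to [K 0], while its mean is still [v]. *)
  set (s' := Rmin (s / 2) (1 / 2)).
  assert (Hs' : 0 < s') by (apply Rmin_pos; lra).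
  assert (Hs2 : s' <= s / 2) by apply Rmin_l. assert (Hs3 : s' <= 1 / 2) by apply Rmin_r.
  destruct (Hex s' ltac:(lra)) as [w Hw].
  assert (w = v) as ->.
  { apply (circle_mean_const K s' r w v); auto; [|lra].
    intros z Hz. apply HK. unfold disc. lra. }
  apply (Rlt_not_le (Cmod (v - K 0%C)) (Cmod (v - K 0%C) / 2)); [lra|].
  apply is_mean_bound with (fun t => K (RtoC s' * cis t) - K 0)%C.
  - apply is_mean_minus; [exact Hw|apply is_mean_const].
  - intros t. left. apply B. replace (s' * cis t - 0)%C with (s' * cis t)%C by ring.
    rewrite Cmod_circle; lra.
Qed.

Lemma cder_pow (n : nat) (z : C) : exists d, cder (fun w => w ^ n)%C z d.
Proof.
  induction n as [|n [d Hd]].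
  - exists 0%C. exact (gder_const (nearC z) (fun w => w) z 1%C).
  - eexists. exact (gder_mult (nearC z) (fun w => w) z (Clim_id z) (fun w => w) (fun w => w ^ n)%C _ _
      (gder_iota _ _ _) Hd).
Qed.

Lemma holo_mult (F G : C -> C) : holo F -> holo G -> holo (fun z => F z * G z)%C.
Proof.
  intros HF HG z Hz. destruct (HF z Hz) as [a A], (HG z Hz) as [b B].
  eexists. exact (gder_mult (nearC z) (fun w => w) z (Clim_id z) F G _ _ A B).
Qed.

Lemma holo_const (c : C) : holo (fun _ => c).
Proof. intros z _. exists 0%C. apply gder_const, nearC_filter. Qed.

Lemma holo_id : holo (fun z => z).
Proof. intros z _. exists 1%C. apply gder_iota, nearC_filter. Qed.

Lemma holo_div (F G : C -> C) : holo F -> holo G -> (forall z, disc z -> G z <> 0%C) ->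
  holo (fun z => F z / G z)%C.
Proof.
  intros HF HG H z Hz. destruct (HF z Hz) as [a A], (HG z Hz) as [b B].
  exact (gder_div (nearC z) (fun w => w) z (Clim_id z) F G _ _ (H z Hz) A B).
Qed.

Lemma holo_pow (F : C -> C) (n : nat) : holo F -> holo (fun z => F z ^ n)%C.
Proof.
  intros H. induction n as [|n IH]; [exact (holo_const 1%C)|].
  exact (holo_mult F (fun z => F z ^ n)%C H IH).
Qed.

(** * Taylor coefficients as Fourier coefficients *)

Definition taylor_coeffs (F : C -> C) (a : nat -> C) : Prop :=
  forall (r : R) (n : nat), 0 < r < 1 ->
    is_mean (fun t => F (RtoC r * cis t) * Cconj (cis t) ^ n)%C (a n * RtoC r ^ n)%C.

(** The mean of [F z / z ^ n] does not depend on the circle, so the value read at radius 1/2 serves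
    for all radii. *)
Lemma ex_taylor_coeffs (F : C -> C) : holo F -> exists a, taylor_coeffs F a.
Proof.
  intros HF.
  set (K := fun n (z : C) => (F z * / z ^ n)%C).
  assert (HK : forall n z, 0 < Cmod z < 1 -> exists d, cder (K n) z d).
  { intros n z Hz. destruct (HF z) as [d Hd]; [unfold disc; lra|].
    destruct (cder_pow n z) as [p Hp].
    refine (gder_div (nearC z) (fun w => w) z (Clim_id z) F (fun w => w ^ n)%C _ _ _ Hd Hp).
    apply Cpow_nz, Cmod_gt_0. lra. }
  assert (Hex : forall r n, 0 < r < 1 -> exists v, is_mean (fun t => K n (RtoC r * cis t)%C) v).
  { intros r n Hr. apply ex_mean. intros t. apply circle_cont.
    destruct (HK n (RtoC r * cis t)%C) as [d Hd]; [rewrite Cmod_circle; lra|].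
    apply cder_cont with (1 := Hd). }
  destruct (choice _ (fun n => Hex (1 / 2) n ltac:(lra))) as [a Ha].
  exists a. intros r n Hr. destruct (Hex r n Hr) as [v Hv].
  assert (v = a n) as ->.
  { apply (circle_mean_const (K n) r (1 / 2)); auto; lra. }
  rewrite Cmult_comm.
  apply is_mean_ext with (fun t => RtoC r ^ n * K n (RtoC r * cis t))%C; [|now apply is_mean_scal].
  intros t. unfold K. rewrite Cpow_mult_l.
  assert (N1 : RtoC r <> 0%C) by (apply Cmod_gt_0; rewrite Cmod_R, Rabs_pos_eq; lra).
  assert (N2 : cis t <> 0%C) by (apply Cmod_gt_0; rewrite Cmod_cis; lra).
  assert (E : (Cconj (cis t) ^ n = / cis t ^ n)%C).
  { rewrite <- Cpow_inv by exact N2. f_equal.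
    replace (Cconj (cis t)) with (cis t * Cconj (cis t) * / cis t)%C by (field; exact N2).
    rewrite cis_conj. ring. }
  rewrite E. field. split; apply Cpow_nz; assumption.
Qed.

(** The coefficients of negative index vanish, since [F z * z ^ n] is differentiable in the whole
    disc and zero at 0. *)
Lemma mean_positive_freq (F : C -> C) (r : R) (n : nat) : holo F -> 0 < r < 1 -> (0 < n)%nat ->
  is_mean (fun t => F (RtoC r * cis t) * cis t ^ n)%C 0%C.
Proof.
  intros HF Hr Hn.
  assert (M := mean_value (fun z => F z * z ^ n)%C r (holo_mult _ _ HF (holo_pow _ n holo_id)) Hr).
  assert (N1 : (RtoC r ^ n)%C <> 0%C).
  { apply Cpow_nz, Cmod_gt_0. rewrite Cmod_R, Rabs_pos_eq; lra. }
  apply is_mean_eq with (/ RtoC r ^ n * (F 0 * 0 ^ n))%C.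
  { destruct n as [|n]; [lia|]. rewrite (Cpow_S 0). ring. }
  apply is_mean_ext with (fun t => / RtoC r ^ n * (F (RtoC r * cis t) * (RtoC r * cis t) ^ n))%C.
  - intros t. rewrite Cpow_mult_l. field. exact N1.
  - now apply is_mean_scal.
Qed.

Fixpoint csum (f : nat -> C) (n : nat) : C :=
  match n with O => 0%C | S m => (csum f m + f m)%C end.

Lemma csum_S (f : nat -> C) (n : nat) : csum f (S n) = (csum f n + f n)%C.
Proof. reflexivity. Qed.

Lemma pow_n_C (z : C) (n : nat) : pow_n (K := C_Ring) z n = (z ^ n)%C.
Proof. induction n as [|n IH]; [reflexivity|]. simpl. now rewrite IH. Qed.

Lemma sum_n_csum (f : nat -> C) (n : nat) : sum_n (G := C_AbelianMonoid) f n = csum f (S n).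
Proof.
  induction n as [|n IH]; [rewrite sum_O; simpl; ring|]. rewrite sum_Sn, IH. reflexivity.
Qed.

Lemma Clim_filterlim {T} (D : (T -> Prop) -> Prop) {FD : Filter D} (f : T -> C) (l : C) :
  Clim D f l <-> filterlim f D (@locally C_UniformSpace l).
Proof.
  rewrite (filterlim_locally_ball_norm (K := C_AbsRing) (U := C_NormedModule) f l). split.
  - intros H e. exact (H e (cond_pos e)).
  - intros H e He. exact (H (mkposreal e He)).
Qed.

Lemma is_pseries_Clim (a : nat -> C) (z l : C) :
  is_pseries (K := C_AbsRing) (V := C_NormedModule) a z l <->
  Clim eventually (fun n => csum (fun k => a k * z ^ k)%C (S n)) l.
Proof.
  unfold is_pseries, is_series.
  rewrite (Clim_filterlim eventually).
  replace (fun n => csum (fun k => a k * z ^ k)%C (S n))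
    with (sum_n (G := C_AbelianMonoid) (fun k => scal (V := C_NormedModule) (pow_n (K := C_Ring) z k) (a k))).
  - reflexivity.
  - apply functional_extensionality. intros n. rewrite <- sum_n_csum.
    apply sum_n_ext. intros k. rewrite pow_n_C, Cmult_comm. reflexivity.
Qed.

Section Taylor.
Variables (F : C -> C) (a : nat -> C) (u d : C).
Hypotheses (HF : holo F) (Ha : taylor_coeffs F a) (Hu : 0 < Cmod u < 1) (Hd : cder F u d).

Let rho := Cmod u.
Let Q (w : C) : C := if Ceq_dec w u then d else ((F w - F u) / (w - u))%C.

Lemma slope_eq (w : C) : ((w - u) * Q w)%C = (F w - F u)%C.
Proof.
  unfold Q. destruct (Ceq_dec w u) as [->|N]; [ring|]. field. now apply Cminus_eq_contra.
Qed.

Lemma slope_cont (w : C) : disc w -> Clim (nearC w) Q (Q w).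
Proof.
  intros Hw. destruct (Ceq_dec w u) as [->|N].
  - destruct Hd as [q [Hq Hq2]].
    assert (E : Q u = d) by (unfold Q; destruct (Ceq_dec u u); congruence). rewrite E.
    apply Clim_ext with q; [apply nearC_filter| |exact Hq].
    revert Hq2. apply filter_imp. intros y Hy.
    unfold Q. destruct (Ceq_dec y u) as [->|N].
    + now apply (Clim_point q).
    + rewrite Hy. field. now apply Cminus_eq_contra.
  - assert (N' := Cminus_eq_contra _ _ N).
    destruct (HF w Hw) as [b Hb]. apply cder_cont in Hb.
    assert (E : Q w = ((F w - F u) / (w - u))%C) by (unfold Q; destruct (Ceq_dec w u); congruence).
    rewrite E.
    apply Clim_ext with (fun w => (F w - F u) / (w - u))%C; [apply nearC_filter| |].
    + apply (nearC_intro _ _ (Cmod (w - u))); [now apply Cmod_gt_0|]. intros y Hy.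
      unfold Q. destruct (Ceq_dec y u) as [->|_]; [|reflexivity].
      rewrite Cmod_sub_sym in Hy. lra.
    + apply Clim_mult; [apply nearC_filter| |].
      * apply Clim_minus; [apply nearC_filter|exact Hb|apply Clim_const, nearC_filter].
      * apply Clim_inv; [apply nearC_filter|exact N'|].
        apply Clim_minus; [apply nearC_filter|apply Clim_id|apply Clim_const, nearC_filter].
Qed.

Let qc (t : R) : C := Q (RtoC rho * cis t)%C.

Lemma qc_cont (t : R) : Clim (locally t) qc (qc t).
Proof. apply (circle_cont Q), slope_cont, circle_disc. unfold rho; lra. Qed.

Lemma cis_pow_cont (n : nat) (t : R) : Clim (locally t) (fun s => cis s ^ n)%C (cis t ^ n)%C.
Proof.
  induction n as [|n IH]; [exact (Clim_const (locally t) 1%C)|].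
  apply Clim_mult; [apply locally_filter|apply cis_cont|exact IH].
Qed.

Lemma ex_mean_qc : exists q p : nat -> C,
  (forall n, is_mean (fun t => qc t * Cconj (cis t) ^ n)%C (q n)) /\
  (forall n, is_mean (fun t => qc t * cis t ^ n)%C (p n)).
Proof.
  destruct (choice (fun n v => is_mean (fun t => qc t * Cconj (cis t) ^ n)%C v)) as [q Hq].
  { intros n. apply ex_mean. intros t. apply Clim_mult; [apply locally_filter|apply qc_cont|].
    rewrite <- Cpow_conj. apply Clim_ext with (fun s => Cconj (cis s ^ n)); [apply locally_filter| |].
    - apply filter_forall. intros s. apply Cpow_conj.
    - apply Clim_conj; [apply locally_filter|apply cis_pow_cont]. }
  destruct (choice (fun n v => is_mean (fun t => qc t * cis t ^ n)%C v)) as [p Hp].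
  { intros n. apply ex_mean. intros t.
    apply Clim_mult; [apply locally_filter|apply qc_cont|apply cis_pow_cont]. }
  now exists q, p.
Qed.

(* Chernoff's trick: the Fourier coefficients of [F = F u + (z - u) Q] on the
   circle through [u] telescope, and those of the continuous slope [Q] tend to 0. *)
Lemma taylor_at : is_pseries (K := C_AbsRing) (V := C_NormedModule) a u (F u).
Proof.
  assert (Hr : 0 < rho < 1) by exact Hu.
  destruct ex_mean_qc as [q [p [Hq Hp]]].
  assert (Eq : forall t, (F (RtoC rho * cis t) = F u + (RtoC rho * cis t - u) * qc t)%C).
  { intros t. unfold qc. rewrite slope_eq. ring. }
  assert (R1 : forall n, (a (S n) * RtoC rho ^ S n
      = RtoC rho * q n - u * q (S n))%C).
  { intros n. apply (is_mean_unique _ _ _ (Ha rho (S n) Hr)).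
    apply is_mean_eq with (F u * 0 + (RtoC rho * q n - u * q (S n)))%C; [ring|].
    apply is_mean_ext with (fun t => F u * (cis t ^ 0 * Cconj (cis t) ^ S n)
      + (RtoC rho * (qc t * Cconj (cis t) ^ n) - u * (qc t * Cconj (cis t) ^ S n)))%C.
    - intros t. rewrite Eq.
      replace (qc t * Cconj (cis t) ^ n)%C with (qc t * (cis t * Cconj (cis t)) * Cconj (cis t) ^ n)%C
        by (rewrite cis_conj; ring).
      rewrite !Cpow_S. simpl. ring.
    - apply is_mean_plus; [apply is_mean_scal, (is_mean_orth 0 (S n))|].
      apply is_mean_minus; apply is_mean_scal; apply Hq. }
  assert (R0 : (a 0%nat = F u + (RtoC rho * p 1%nat - u * q 0%nat))%C).
  { apply (is_mean_unique (fun t => F (RtoC rho * cis t) * Cconj (cis t) ^ 0)%C).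
    - apply is_mean_eq with (2 := Ha rho 0%nat Hr). simpl. ring.
    - apply is_mean_ext with (fun t => F u
        + (RtoC rho * (qc t * cis t ^ 1) - u * (qc t * Cconj (cis t) ^ 0)))%C.
      + intros t. rewrite Eq. simpl. ring.
      + apply is_mean_plus; [apply is_mean_const|].
        apply is_mean_minus; apply is_mean_scal; [apply Hp|apply Hq]. }
  assert (Rn : forall n, (RtoC 0 = RtoC rho * p (S (S n)) - u * p (S n))%C).
  { intros n. apply (is_mean_unique _ _ _ (mean_positive_freq F rho (S n) HF Hr ltac:(lia))).
    apply is_mean_eq with (F u * 0 + (RtoC rho * p (S (S n)) - u * p (S n)))%C; [ring|].
    apply is_mean_ext with (fun t => F u * cis t ^ S n
      + (RtoC rho * (qc t * cis t ^ S (S n)) - u * (qc t * cis t ^ S n)))%C.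
    - intros t. rewrite Eq, !Cpow_S. ring.
    - apply is_mean_plus; [apply is_mean_scal, is_mean_cis_pow; lia|].
      apply is_mean_minus; apply is_mean_scal; apply Hp. }
  assert (Nr : RtoC rho <> 0%C) by (apply Cmod_gt_0; rewrite Cmod_R, Rabs_pos_eq; lra).
  (* The negative frequencies of the slope satisfy [rho * p (n + 1) = u * p n] for [n >= 1]. As
     [|u| = rho] they all have the same modulus, and they tend to 0. *)
  assert (P0 : p 1%nat = 0%C).
  { assert (Pn : forall n, Cmod (p (S n)) = Cmod (p 1%nat)).
    { induction n as [|n IH]; [reflexivity|]. rewrite <- IH.
      apply Rmult_eq_reg_l with rho; [|lra].
      rewrite <- (Rabs_pos_eq rho) at 1 by lra. rewrite <- Cmod_R, <- Cmod_mult.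
      replace (RtoC rho * p (S (S n)))%C with (u * p (S n))%C.
      - now rewrite Cmod_mult.
      - replace (RtoC rho * p (S (S n)))%C
          with ((RtoC rho * p (S (S n)) - u * p (S n)) + u * p (S n))%C by ring.
        rewrite <- Rn. ring. }
    assert (L : Clim eventually (fun n => Cconj (p n)) 0%C).
    { apply (bessel_tends_0 (fun t => Cconj (qc t))).
      - intros t. apply Clim_conj; [apply locally_filter|apply qc_cont].
      - intros k. apply is_mean_ext with (fun t => Cconj (qc t * cis t ^ k)).
        + intros t. now rewrite Cmult_conj, Cpow_conj.
        + apply is_mean_conj, Hp. }
    apply Cmod_eq_0. apply Rle_antisym; [|apply Cmod_ge_0]. apply Rnot_lt_le. intros Hlt.
    destruct (L _ Hlt) as [N HN]. specialize (HN (S N) ltac:(lia)).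
    replace (Cconj (p (S N)) - 0)%C with (Cconj (p (S N))) in HN by ring.
    rewrite Cmod_conj, Pn in HN. lra. }
  (* Since [w] has modulus 1, the telescoped remainder [rho * w ^ (n + 1) * q n] tends to 0 along
     with [q n]. *)
  set (w := (u / RtoC rho)%C).
  assert (Ew : u = (RtoC rho * w)%C) by (unfold w; field; exact Nr).
  assert (Mw : Cmod w = 1).
  { unfold w. rewrite Cmod_div, Cmod_R, Rabs_pos_eq by (auto; lra). fold rho. field. lra. }
  assert (Sum : forall n, csum (fun k => a k * u ^ k)%C (S n)
      = (F u - RtoC rho * (w ^ S n * q n))%C).
  { induction n as [|n IH].
    - simpl csum. rewrite R0, P0, Ew. simpl. ring.
    - rewrite csum_S, IH.
      replace (a (S n) * u ^ S n)%C with (a (S n) * RtoC rho ^ S n * w ^ S n)%C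
        by (rewrite Ew, Cpow_mult_l; ring).
      rewrite R1. replace (u * q (S n))%C with (RtoC rho * w * q (S n))%C by now rewrite <- Ew.
      rewrite (Cpow_S w (S n)). ring. }
  apply is_pseries_Clim.
  apply Clim_ext with (fun n => F u - RtoC rho * (w ^ S n * q n))%C.
  - apply eventually_filter.
  - apply filter_forall. intros n. now rewrite Sum.
  - apply Clim_eq with (F u - RtoC rho * 0)%C; [ring|].
    apply Clim_minus; [apply eventually_filter|apply Clim_const, eventually_filter|].
    apply Clim_mult; [apply eventually_filter|apply Clim_const, eventually_filter|].
    assert (L := bessel_tends_0 qc q qc_cont Hq).
    intros e He. generalize (L e He). apply filter_imp. intros n Hn.
    replace (w ^ S n * q n - 0)%C with (w ^ S n * (q n - 0))%C by ring.
    rewrite Cmod_mult, Cmod_pow, Mw, pow1. lra.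
Qed.
End Taylor.

Theorem taylor (F : C -> C) (a : nat -> C) : holo F -> taylor_coeffs F a ->
  power_series_in_disc a F.
Proof.
  intros HF Ha z Hz. destruct (Ceq_dec z 0) as [->|N].
  - replace (F 0%C) with (a 0%nat); [apply (is_pseries_0 (K := C_AbsRing) (V := C_NormedModule))|].
    assert (H : 0 < 1 / 2 < 1) by lra.
    apply (is_mean_unique (fun t => F (RtoC (1 / 2) * cis t) * Cconj (cis t) ^ 0)%C).
    + apply is_mean_eq with (2 := Ha (1 / 2) 0%nat H). simpl. ring.
    + apply is_mean_ext with (fun t => F (RtoC (1 / 2) * cis t)%C); [intros t; simpl; ring|].
      now apply mean_value.
  - destruct (HF z Hz) as [d Hd]. apply taylor_at with d; auto.
    split; [now apply Cmod_gt_0|exact Hz].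
Qed.

(** * Power series and asymptotic expansions *)

Lemma eventually_bounded (u : nat -> R) (M : R) (N : nat) :
  (forall n, (N <= n)%nat -> u n <= M) -> exists M', 0 < M' /\ forall n, u n <= M'.
Proof.
  revert M. induction N as [|N IH]; intros M H.
  - exists (Rmax M 1). split; [apply Rlt_le_trans with (1 := Rlt_0_1); apply Rmax_r|].
    intros n. apply Rle_trans with M; [apply H; lia|apply Rmax_l].
  - apply (IH (Rmax M (u N))). intros n Hn. destruct (Nat.eq_dec n N) as [->|E].
    + apply Rmax_r.
    + apply Rle_trans with M; [apply H; lia|apply Rmax_l].
Qed.

Lemma pseries_coeff_bound (a : nat -> C) (F : C -> C) (r : R) : power_series_in_disc a F ->
  0 < r < 1 -> exists M, 0 < M /\ forall n, Cmod (a n) * r ^ n <= M.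
Proof.
  intros H Hr.
  assert (Hz : disc (RtoC r)) by (unfold disc; rewrite Cmod_R, Rabs_pos_eq; lra).
  assert (L := proj1 (is_pseries_Clim _ _ _) (H _ Hz)).
  destruct (Clim_bounded _ _ _ L) as [N HN]. set (l := Cmod (F r) + 1) in *.
  apply (eventually_bounded _ (l + l) (S N)). intros n Hn.
  destruct n as [|n]; [lia|].
  assert (A := HN (S n) ltac:(lia)). assert (B := HN n ltac:(lia)). cbv beta in A, B.
  rewrite csum_S in A. set (s := csum _ (S n)) in *. set (t := (a (S n) * RtoC r ^ S n)%C) in *.
  replace (Cmod (a (S n)) * r ^ S n) with (Cmod t).
  - replace t with (s + t - s)%C by ring. generalize (Cmod_triangle (s + t) (- s)).
    rewrite Cmod_opp. unfold Cminus. lra.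
  - unfold t. rewrite Cmod_mult, Cmod_pow, Cmod_R, Rabs_pos_eq; lra.
Qed.

Lemma Clim_subseq_S (u : nat -> C) (l : C) :
  Clim eventually u l -> Clim eventually (fun n => u (S n)) l.
Proof.
  intros H e He. destruct (H e He) as [N HN]. exists N. intros n Hn. apply HN. lia.
Qed.

Definition dcoef (a : nat -> C) (n : nat) : C := (RtoC (INR (S n)) * a (S n))%C.

(** The second-order Taylor remainder of a power, by the recursion
    [D' = y D + (m + 1) z^m (y - z)^2]. The factor [r] on the left replaces the exponent [m - 1] on
    the right, which would be wrong at [m = 0]. *)
Lemma pow_second_order (y z : C) (r : R) (m : nat) : 0 < r -> Cmod y <= r -> Cmod z <= r ->
  Cmod (y ^ S m - z ^ S m - RtoC (INR (S m)) * z ^ m * (y - z)) * r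
    <= INR (S m) ^ 2 * r ^ m * Cmod (y - z) ^ 2.
Proof.
  intros Hr Hy Hz. set (k := Cmod (y - z)). assert (Hk : 0 <= k ^ 2) by apply pow2_ge_0.
  induction m as [|m IH].
  - replace (y ^ 1 - z ^ 1 - RtoC (INR 1) * z ^ 0 * (y - z))%C with (RtoC 0) by (simpl; ring).
    rewrite Cmod_0. simpl INR. simpl (r ^ 0). lra.
  - set (D := (y ^ S m - z ^ S m - RtoC (INR (S m)) * z ^ m * (y - z))%C) in *.
    replace (y ^ S (S m) - z ^ S (S m) - RtoC (INR (S (S m))) * z ^ S m * (y - z))%C
      with (y * D + RtoC (INR (S m)) * z ^ m * ((y - z) * (y - z)))%C.
    2:{ unfold D. rewrite (S_INR (S m)), RtoC_plus, !Cpow_S. ring. }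
    assert (P : 0 <= r ^ m) by (apply pow_le; lra).
    assert (I : 1 <= INR (S m)) by (rewrite S_INR; generalize (pos_INR m); lra).
    apply Rle_trans with ((r * Cmod D + INR (S m) * r ^ m * k ^ 2) * r).
    + apply Rmult_le_compat_r; [lra|].
      eapply Rle_trans; [apply Cmod_triangle|]. rewrite !Cmod_mult, Cmod_pow, Cmod_R.
      rewrite Rabs_pos_eq by lra. fold k. apply Rplus_le_compat.
      * apply Rmult_le_compat_r; [apply Cmod_ge_0|exact Hy].
      * replace (k * k) with (k ^ 2) by ring. apply Rmult_le_compat_r; [exact Hk|].
        apply Rmult_le_compat_l; [lra|]. apply pow_incr. split; [apply Cmod_ge_0|exact Hz].
    + rewrite (S_INR (S m)). set (I1 := INR (S m)) in *. change (r ^ S m) with (r * r ^ m).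
      assert (r * (Cmod D * r) <= r * (I1 ^ 2 * r ^ m * k ^ 2)) by (apply Rmult_le_compat_l; lra).
      assert (0 <= r * r ^ m * k ^ 2 * (I1 + 1)).
      { apply Rmult_le_pos; [|lra]. apply Rmult_le_pos; [|exact Hk].
        apply Rmult_le_pos; lra. }
      nra.
Qed.

(** [x ^ n] is at most each of the [n] terms of [1 + x + ... + x^(n-1)], whose sum is
    [(1 - x^n) / (1 - x)]. *)
Lemma nat_mult_pow_le (x : R) (n : nat) : 0 < x < 1 -> (1 - x) * (INR n * x ^ n) <= 1 - x ^ n.
Proof.
  intros Hx. induction n as [|n IH]; [simpl; lra|].
  rewrite S_INR. change (x ^ S n) with (x * x ^ n).
  assert (P : 0 <= x ^ n) by (apply pow_le; lra).
  assert (Q : x ^ n <= 1) by (rewrite <- (pow1 n); apply pow_incr; lra).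
  assert (x * ((1 - x) * (INR n * x ^ n)) <= x * (1 - x ^ n)) by (apply Rmult_le_compat_l; lra).
  assert (0 <= (1 - x) * (1 - x * x ^ n)) by (apply Rmult_le_pos; nra).
  nra.
Qed.

Lemma rsum_geom_le (c x : R) (n : nat) : 0 <= c -> 0 < x < 1 ->
  rsum (fun k => c * x ^ k) n <= c / (1 - x).
Proof.
  intros Hc Hx. apply Rle_trans with (c / (1 - x) * (1 - x ^ n)).
  - right. induction n as [|n IH]; [simpl; ring|]. rewrite rsum_S, IH.
    change (x ^ S n) with (x * x ^ n). field. lra.
  - rewrite <- (Rmult_1_r (c / (1 - x))) at 2. apply Rmult_le_compat_l.
    + apply Rmult_le_pos; [exact Hc|]. left. apply Rinv_0_lt_compat. lra.
    + assert (0 <= x ^ n) by (apply pow_le; lra). lra.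
Qed.

Lemma csum_le (f : nat -> C) (g : nat -> R) (n : nat) :
  (forall k, (k < n)%nat -> Cmod (f k) <= g k) -> Cmod (csum f n) <= rsum g n.
Proof.
  induction n as [|n IH]; intros H; [simpl; rewrite Cmod_0; lra|].
  rewrite csum_S, rsum_S. eapply Rle_trans; [apply Cmod_triangle|].
  apply Rplus_le_compat; auto.
Qed.

(** The four factors [x] are spent in the term-by-term differentiation: one bounds the coefficient,
    two absorb the square of the index, and the last one leaves a geometric series. The witness
    works because [(1 - t)^4 > 1 - 8 t = |z|] for [t = (1 - |z|) / 8]. *)
Lemma radius_choice (z : C) : disc z -> exists x, 0 < x < 1 /\ Cmod z < x ^ 4.
Proof.
  intros Hz. unfold disc in Hz. assert (H0 := Cmod_ge_0 z).
  exists (1 - (1 - Cmod z) / 8). split; [lra|].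
  set (t := (1 - Cmod z) / 8). assert (Ht : 0 < t <= 1 / 8) by (unfold t; lra).
  replace (Cmod z) with (1 - 8 * t) by (unfold t; field).
  assert (0 < t * (4 + 6 * t - 4 * t ^ 2 + t ^ 3)).
  { apply Rmult_lt_0_compat; [lra|]. assert (0 < t ^ 3) by (apply pow_lt; lra). nra. }
  replace ((1 - t) ^ 4) with (1 - 8 * t + t * (4 + 6 * t - 4 * t ^ 2 + t ^ 3)) by ring. lra.
Qed.

(** The second-order remainders of the monomials are summed against a geometric majorant, so [F]
    differs from its affine part by at most [K |y - z|^2]. No uniform convergence is invoked. *)
Lemma pseries_cder (a : nat -> C) (F : C -> C) (z : C) : power_series_in_disc a F -> disc z ->
  exists d, cder F z d /\ is_pseries (K := C_AbsRing) (V := C_NormedModule) (dcoef a) z d.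
Proof.
  intros HF Hz. destruct (radius_choice z Hz) as [x [Hx Hzx]].
  destruct (pseries_coeff_bound a F x HF Hx) as [M [HM Ha]].
  set (r := x ^ 4) in *. assert (Hr : 0 < r) by (apply pow_lt; lra).
  set (B := / (1 - x)). assert (HB : 0 < B) by (apply Rinv_0_lt_compat; lra).
  set (c := M * B ^ 2 / x ^ 3).
  assert (Hx3 : 0 < x ^ 3) by (apply pow_lt; lra).
  assert (Hc : 0 <= c).
  { unfold c. apply Rmult_le_pos; [|left; now apply Rinv_0_lt_compat].
    apply Rmult_le_pos; [lra|apply pow2_ge_0]. }
  assert (Bd : forall m, Cmod (a (S m)) * (INR (S m) ^ 2 * r ^ m) <= c * x ^ m).
  { intros m. assert (Px : 0 < x ^ m) by (apply pow_lt; lra).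
    assert (Pxn : 0 < x ^ S m) by (apply pow_lt; lra).
    assert (N1 : INR (S m) * x ^ S m <= B).
    { apply Rmult_le_reg_l with (1 - x); [lra|]. unfold B. rewrite Rinv_r by lra.
      generalize (nat_mult_pow_le x (S m) Hx). lra. }
    assert (N2 : (INR (S m) * x ^ S m) ^ 2 <= B ^ 2).
    { apply pow_incr. split; [|exact N1]. apply Rmult_le_pos; [apply pos_INR|lra]. }
    replace (Cmod (a (S m)) * (INR (S m) ^ 2 * r ^ m))
      with ((Cmod (a (S m)) * x ^ S m) * (INR (S m) * x ^ S m) ^ 2 * (x ^ m / x ^ 3)).
    - unfold c. replace (M * B ^ 2 / x ^ 3 * x ^ m) with (M * B ^ 2 * (x ^ m / x ^ 3)) by (field; lra).
      apply Rmult_le_compat_r; [left; now apply Rdiv_lt_0_compat|].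
      apply Rmult_le_compat; [|apply pow2_ge_0|apply Ha|exact N2].
      apply Rmult_le_pos; [apply Cmod_ge_0|lra].
    - unfold r. rewrite <- pow_mult, Nat.mul_comm, pow_mult.
      change (x ^ S m) with (x * x ^ m). field. lra. }
  assert (Ex : exists d, is_pseries (K := C_AbsRing) (V := C_NormedModule) (dcoef a) z d).
  { apply (ex_series_le (K := C_AbsRing) (V := C_CompleteNormedModule) _ (fun m => c * x ^ m)).
    - intros m. change (Cmod (pow_n (K := C_Ring) z m * dcoef a m) <= c * x ^ m).
      apply Rle_trans with (2 := Bd m). rewrite pow_n_C. unfold dcoef.
      rewrite !Cmod_mult, Cmod_pow, Cmod_R, Rabs_pos_eq by apply pos_INR.
      assert (I : 1 <= INR (S m)) by (rewrite S_INR; generalize (pos_INR m); lra).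
      assert (Q : Cmod z ^ m <= r ^ m) by (apply pow_incr; split; [apply Cmod_ge_0|lra]).
      assert (Q0 : 0 <= Cmod z ^ m) by (apply pow_le, Cmod_ge_0).
      replace (Cmod z ^ m * (INR (S m) * Cmod (a (S m))))
        with (Cmod (a (S m)) * (INR (S m) * Cmod z ^ m)) by ring.
      apply Rmult_le_compat_l; [apply Cmod_ge_0|]. apply Rmult_le_compat; nra.
    - apply (ex_series_scal c (fun m => x ^ m)), ex_series_geom. rewrite Rabs_pos_eq; lra. }
  destruct Ex as [d Hd]. exists d. split; [|exact Hd].
  set (K := c / (1 - x) / r).
  assert (HK : 0 <= K).
  { unfold K. apply Rmult_le_pos; [|left; now apply Rinv_0_lt_compat]. now apply Rmult_le_pos; [|left]. }
  assert (Main : forall y, Cmod y <= r -> Cmod (F y - F z - (y - z) * d) <= K * Cmod (y - z) ^ 2).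
  { intros y Hy.
    assert (Hyd : disc y).
    { unfold disc. apply Rle_lt_trans with (1 := Hy). unfold r.
      rewrite <- (pow1 4). assert (0 <= x <= 1) by lra.
      apply Rlt_le_trans with (x ^ 1); [|simpl; lra].
      replace (x ^ 4) with (x * x ^ 3) by ring. simpl (x ^ 1).
      apply Rmult_lt_compat_l; [lra|]. rewrite <- (pow1 3).
      replace (x ^ 3) with (x * (x * x)) by ring. nra. }
    (* The sums of [F] take one more term than the derived one: the constant terms cancel and index
       [m + 1] faces index [m]. *)
    apply (Clim_Cmod_le eventually (fun n => csum (fun k => a k * y ^ k) (S (S n))
        - csum (fun k => a k * z ^ k) (S (S n)) - (y - z) * csum (fun k => dcoef a k * z ^ k) (S n))%C).
    - apply Clim_minus; [apply eventually_filter| |].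
      + apply Clim_minus; [apply eventually_filter| |].
        * apply (Clim_subseq_S (fun n => csum (fun k => a k * y ^ k)%C (S n))).
          now apply is_pseries_Clim, HF.
        * apply (Clim_subseq_S (fun n => csum (fun k => a k * z ^ k)%C (S n))).
          now apply is_pseries_Clim, HF.
      + apply Clim_mult; [apply eventually_filter|apply Clim_const, eventually_filter|].
        now apply is_pseries_Clim.
    - apply filter_forall. intros n. generalize (S n). clear n. intros n.
      replace (csum (fun k => a k * y ^ k) (S n) - csum (fun k => a k * z ^ k) (S n)
          - (y - z) * csum (fun k => dcoef a k * z ^ k) n)%C
        with (csum (fun m => a (S m) * (y ^ S m - z ^ S m - RtoC (INR (S m)) * z ^ m * (y - z))) n)%C.
      2:{ induction n as [|n IH]; [simpl; ring|].
          rewrite csum_S, IH, !csum_S. unfold dcoef. ring. }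
      assert (Hk : 0 <= Cmod (y - z) ^ 2) by apply pow2_ge_0.
      apply Rle_trans with (rsum (fun m => (c / r * Cmod (y - z) ^ 2) * x ^ m) n).
      + apply csum_le. intros m _. rewrite Cmod_mult.
        apply Rmult_le_reg_r with (1 := Hr).
        assert (P := pow_second_order y z r m Hr Hy (Rlt_le _ _ Hzx)).
        rewrite Rmult_assoc.
        apply Rle_trans with (1 := Rmult_le_compat_l _ _ _ (Cmod_ge_0 (a (S m))) P).
        replace (c / r * Cmod (y - z) ^ 2 * x ^ m * r) with (c * x ^ m * Cmod (y - z) ^ 2)
          by (field; lra).
        rewrite <- Rmult_assoc. apply Rmult_le_compat_r; [exact Hk|apply Bd].
      + eapply Rle_trans; [apply rsum_geom_le; [|exact Hx]|].
        * apply Rmult_le_pos; [|exact Hk]. apply Rmult_le_pos; [exact Hc|].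
          left; now apply Rinv_0_lt_compat.
        * right. unfold K. field. lra. }
  apply gder_of_eps; [apply nearC_filter|now intros y ->|]. intros e He.
  apply (nearC_intro _ _ (Rmin (r - Cmod z) (e / (K + 1)))).
  { apply Rmin_pos; [lra|]. apply Rdiv_lt_0_compat; lra. }
  intros y Hy.
  assert (Y1 : Cmod (y - z) < r - Cmod z) by (apply Rlt_le_trans with (1 := Hy), Rmin_l).
  assert (Y2 : Cmod (y - z) < e / (K + 1)) by (apply Rlt_le_trans with (1 := Hy), Rmin_r).
  apply Rle_trans with (1 := Main y ltac:(generalize (Cmod_le_sub y z); lra)).
  replace (K * Cmod (y - z) ^ 2) with (K * Cmod (y - z) * Cmod (y - z)) by ring.
  apply Rmult_le_compat_r; [apply Cmod_ge_0|].
  assert (Cmod (y - z) * (K + 1) <= e).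
  { replace e with (e / (K + 1) * (K + 1)) by (field; lra). apply Rmult_le_compat_r; lra. }
  generalize (Cmod_ge_0 (y - z)). nra.
Qed.

Lemma pseries_holo (a : nat -> C) (F : C -> C) : power_series_in_disc a F -> holo F.
Proof.
  intros H z Hz. destruct (pseries_cder a F z H Hz) as [d [Hd _]]. now exists d.
Qed.

Lemma pseries_deriv (a : nat -> C) (F : C -> C) : power_series_in_disc a F ->
  power_series_in_disc (dcoef a) (C_derive F) /\
  forall z, disc z -> cder F z (C_derive F z).
Proof.
  intros H. assert (G : forall z, disc z -> cder F z (C_derive F z) /\
    is_pseries (K := C_AbsRing) (V := C_NormedModule) (dcoef a) z (C_derive F z)).
  { intros z Hz. destruct (pseries_cder a F z H Hz) as [d [Hd Hs]].
    rewrite (is_C_derive_unique F z d); [now split|]. now apply is_derive_cder. }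
  split; intros z Hz; now apply G.
Qed.

Lemma pseries_at_0 (a : nat -> C) (F : C -> C) : power_series_in_disc a F -> F 0%C = a 0%nat.
Proof.
  intros H. apply (Clim_unique eventually (fun n => csum (fun k => a k * 0 ^ k)%C (S n))).
  - apply is_pseries_Clim, H, disc_0.
  - apply Clim_ext with (fun _ => a 0%nat); [apply eventually_filter| |apply Clim_const, eventually_filter].
    apply filter_forall. intros n. induction n as [|n IH]; [simpl; ring|].
    rewrite csum_S, <- IH, Cpow_S. ring.
Qed.

(** * Shifts, Cauchy products and expansions at 0 *)

Definition shift (a : nat -> C) (n : nat) : C := a (S n).

Lemma pseries_shift (a : nat -> C) (F : C -> C) : power_series_in_disc a F ->
  exists F1, power_series_in_disc (shift a) F1 /\
    forall z, disc z -> F z = (a 0%nat + z * F1 z)%C.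
Proof.
  intros H.
  exists (fun z => if Ceq_dec z 0 then a 1%nat else ((F z - a 0%nat) / z)%C). split.
  - intros z Hz. destruct (Ceq_dec z 0) as [->|N].
    + apply (is_pseries_0 (K := C_AbsRing) (V := C_NormedModule) (shift a)).
    + apply is_pseries_Clim.
      apply Clim_ext with (fun n => (csum (fun k => a k * z ^ k) (S (S n)) - a 0%nat) / z)%C.
      * apply eventually_filter.
      * apply filter_forall. intros n.
        replace (csum (fun k => a k * z ^ k) (S (S n)))%C
          with (a 0%nat + z * csum (fun k => shift a k * z ^ k) (S n))%C; [field; exact N|].
        generalize (S n). clear n. intros n. induction n as [|n IH]; [simpl; ring|].
        rewrite csum_S, (csum_S _ (S n)), <- IH, Cpow_S. unfold shift. ring.
      * apply Clim_mult; [apply eventually_filter| |apply Clim_const, eventually_filter].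
        apply Clim_minus; [apply eventually_filter| |apply Clim_const, eventually_filter].
        apply (Clim_subseq_S (fun n => csum (fun k => a k * z ^ k)%C (S n))).
        now apply is_pseries_Clim, H.
  - intros z Hz. destruct (Ceq_dec z 0) as [->|N].
    + rewrite (pseries_at_0 a F H). ring.
    + field. exact N.
Qed.

(** The Cauchy product, peeled at the head of [a]: it follows the factorization [F = a_0 + z F_1]
    used by the expansions below. *)
Fixpoint conv (a b : nat -> C) (n : nat) : C :=
  match n with
  | O => (a 0%nat * b 0%nat)%C
  | S m => (a 0%nat * b (S m) + conv (shift a) b m)%C
  end.

Lemma conv_S (a b : nat -> C) (n : nat) :
  conv a b (S n) = (a 0%nat * b (S n) + conv (shift a) b n)%C.
Proof. reflexivity. Qed.

Lemma conv_ext (a a' b b' : nat -> C) (n : nat) :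
  (forall k, (k <= n)%nat -> a k = a' k) -> (forall k, (k <= n)%nat -> b k = b' k) ->
  conv a b n = conv a' b' n.
Proof.
  revert a a'. induction n as [|n IH]; intros a a' Ha Hb.
  - simpl. now rewrite Ha, Hb.
  - rewrite !conv_S, Ha, Hb by lia. f_equal. apply IH.
    + intros k Hk. apply Ha. lia.
    + intros k Hk. apply Hb. lia.
Qed.

Lemma conv_S_r (a b : nat -> C) (n : nat) :
  conv a b (S n) = (conv a (shift b) n + a (S n) * b 0%nat)%C.
Proof.
  revert a. induction n as [|n IH]; intros a; [reflexivity|].
  rewrite conv_S, IH, (conv_S a). unfold shift. ring.
Qed.

Lemma conv_comm (a b : nat -> C) (n : nat) : conv a b n = conv b a n.
Proof.
  revert a b. induction n as [|n IH]; intros a b; [simpl; ring|].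
  rewrite conv_S, conv_S_r, IH. ring.
Qed.

Lemma conv_plus_l (a b c : nat -> C) (n : nat) :
  conv (fun k => a k + b k)%C c n = (conv a c n + conv b c n)%C.
Proof.
  revert a b. induction n as [|n IH]; intros a b; [simpl; ring|].
  rewrite !conv_S. change (shift (fun k => a k + b k)%C) with (fun k => shift a k + shift b k)%C.
  rewrite IH. ring.
Qed.

Lemma conv_scal_l (s : C) (a c : nat -> C) (n : nat) :
  conv (fun k => s * a k)%C c n = (s * conv a c n)%C.
Proof.
  revert a. induction n as [|n IH]; intros a; [simpl; ring|].
  rewrite !conv_S. change (shift (fun k => s * a k)%C) with (fun k => s * shift a k)%C.
  rewrite IH. ring.
Qed.

Lemma conv_assoc (a b c : nat -> C) (n : nat) : conv (conv a b) c n = conv a (conv b c) n.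
Proof.
  revert a b. induction n as [|n IH]; intros a b; [simpl; ring|].
  rewrite (conv_S a), <- IH, (conv_S (conv a b)), (conv_S b).
  replace (shift (conv a b)) with (fun k => a 0%nat * shift b k + conv (shift a) b k)%C
    by (apply functional_extensionality; intros k; reflexivity).
  rewrite conv_plus_l, conv_scal_l. simpl conv at 1. ring.
Qed.

(* [expands n a F]: near 0, off 0 itself, [F] has the asymptotic expansion
   [a_0 + a_1 z + ... + a_(n-1) z^(n-1) + O(z^n)], written as nested factorizations. *)
Definition near0 : (C -> Prop) -> Prop := within (fun z : C => z <> 0%C) (nearC 0%C).

Global Instance near0_proper : ProperFilter near0.
Proof.
  split; [|apply within_filter, nearC_filter].
  intros P HP. destruct (nearC_elim _ _ HP) as [d [Hd K]].
  exists (RtoC (d / 2)). apply K.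
  - replace (RtoC (d / 2)%R - 0)%C with (RtoC (d / 2)) by ring. rewrite Cmod_R, Rabs_pos_eq; lra.
  - apply Cmod_gt_0. rewrite Cmod_R, Rabs_pos_eq; lra.
Qed.

Lemma near0_of_nearC (P : C -> Prop) : nearC 0%C P -> near0 P.
Proof. unfold near0, within. apply filter_imp. auto. Qed.

Lemma near0_nonzero : near0 (fun z => z <> 0%C).
Proof. unfold near0, within. apply filter_forall. auto. Qed.

Fixpoint expands (n : nat) (a : nat -> C) (F : C -> C) : Prop :=
  match n with
  | O => exists M, near0 (fun z => Cmod (F z) <= M)
  | S m => exists F1, near0 (fun z => F z = (a 0%nat + z * F1 z)%C) /\ expands m (shift a) F1
  end.

Lemma expands_ext (n : nat) (a : nat -> C) (F G : C -> C) :
  near0 (fun z => F z = G z) -> expands n a F -> expands n a G.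
Proof.
  intros E. destruct n as [|n].
  - intros [M H]. exists M. generalize (filter_and _ _ E H). apply filter_imp. intros z [<- K]. exact K.
  - intros [F1 [H K]]. exists F1. split; [|exact K].
    generalize (filter_and _ _ E H). apply filter_imp. now intros z [<- L].
Qed.

Lemma Clim_near0_id : Clim near0 (fun z => z) 0%C.
Proof. intros e He. apply near0_of_nearC. now apply Clim_id. Qed.

Lemma expands_bounded (n : nat) (a : nat -> C) (F : C -> C) :
  expands n a F -> exists M, near0 (fun z => Cmod (F z) <= M).
Proof.
  revert a F. induction n as [|n IH]; intros a F; [auto|].
  intros [F1 [H K]]. destruct (IH _ _ K) as [M HM].
  exists (Cmod (a 0%nat) + 1 * Rmax M 0).
  generalize (filter_and _ _ (filter_and _ _ H HM) (Clim_near0_id 1 Rlt_0_1)).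
  apply filter_imp. intros z [[-> L] Q]. eapply Rle_trans; [apply Cmod_triangle|].
  apply Rplus_le_compat_l. rewrite Cmod_mult. replace (z - 0)%C with z in Q by ring.
  apply Rmult_le_compat; try apply Cmod_ge_0; [lra|]. apply Rle_trans with (1 := L), Rmax_l.
Qed.

Lemma expands_weaken (n : nat) (a : nat -> C) (F : C -> C) : expands (S n) a F -> expands n a F.
Proof.
  revert a F. induction n as [|n IH]; intros a F H; [exact (expands_bounded _ _ _ H)|].
  destruct H as [F1 [H K]]. exists F1. split; [exact H|]. now apply IH.
Qed.

Lemma expands_plus (n : nat) (a b : nat -> C) (F G : C -> C) :
  expands n a F -> expands n b G -> expands n (fun k => a k + b k)%C (fun z => F z + G z)%C.
Proof.
  revert a b F G. induction n as [|n IH]; intros a b F G.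
  - intros [M H] [N K]. exists (M + N). generalize (filter_and _ _ H K). apply filter_imp.
    intros z [A B]. eapply Rle_trans; [apply Cmod_triangle|]. lra.
  - intros [F1 [H HF]] [G1 [K KG]]. exists (fun z => F1 z + G1 z)%C. split; [|now apply IH].
    generalize (filter_and _ _ H K). apply filter_imp. intros z [-> ->]. ring.
Qed.

Lemma expands_scal (n : nat) (c : C) (a : nat -> C) (F : C -> C) :
  expands n a F -> expands n (fun k => c * a k)%C (fun z => c * F z)%C.
Proof.
  revert a F. induction n as [|n IH]; intros a F.
  - intros [M H]. exists (Cmod c * M). revert H. apply filter_imp. intros z A.
    rewrite Cmod_mult. apply Rmult_le_compat_l; [apply Cmod_ge_0|exact A].
  - intros [F1 [H HF]]. exists (fun z => c * F1 z)%C. split; [|now apply IH].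
    revert H. apply filter_imp. intros z ->. ring.
Qed.

Lemma expands_mult (n : nat) (a b : nat -> C) (F G : C -> C) :
  expands n a F -> expands n b G -> expands n (conv a b) (fun z => F z * G z)%C.
Proof.
  revert a b F G. induction n as [|n IH]; intros a b F G.
  - intros [M H] [N K]. exists (M * N). generalize (filter_and _ _ H K). apply filter_imp.
    intros z [A B]. rewrite Cmod_mult. apply Rmult_le_compat; auto; apply Cmod_ge_0.
  - intros HF HG. assert (WG := expands_weaken _ _ _ HG).
    destruct HF as [F1 [H HF]], HG as [G1 [K HG]].
    exists (fun z => a 0%nat * G1 z + F1 z * G z)%C. split.
    + generalize (filter_and _ _ H K). apply filter_imp. intros z [-> E]. rewrite E. simpl. ring.
    + exact (expands_plus n _ _ _ _ (expands_scal n (a 0%nat) _ _ HG) (IH _ _ _ _ HF WG)).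
Qed.

(** The constant term is the limit at 0; once the constant terms agree, dividing by [z] off 0 passes
    to the next ones. *)
Lemma expands_unique (n : nat) (a b : nat -> C) (F : C -> C) :
  expands n a F -> expands n b F -> forall k, (k < n)%nat -> a k = b k.
Proof.
  revert a b F. induction n as [|n IH]; intros a b F HF HG k Hk; [lia|].
  assert (L : forall c G, expands (S n) c G -> Clim near0 G (c 0%nat)).
  { clear. intros c G [G1 [H HG]]. destruct (expands_bounded _ _ _ HG) as [M HM].
    intros e He. assert (He2 : 0 < e / (Rmax M 0 + 1)).
    { apply Rdiv_lt_0_compat; [exact He|]. generalize (Rmax_r M 0). lra. }
    generalize (filter_and _ _ (filter_and _ _ H HM) (Clim_near0_id _ He2)).
    apply filter_imp. intros z [[-> B] Q]. replace (z - 0)%C with z in Q by ring.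
    replace (c 0%nat + z * G1 z - c 0%nat)%C with (z * G1 z)%C by ring. rewrite Cmod_mult.
    assert (R0 := Rmax_r M 0). assert (B' := Rle_trans _ _ _ B (Rmax_l M 0)).
    apply Rle_lt_trans with (Cmod z * (Rmax M 0)).
    - apply Rmult_le_compat_l; [apply Cmod_ge_0|exact B'].
    - apply Rle_lt_trans with (Cmod z * (Rmax M 0 + 1)).
      + apply Rmult_le_compat_l; [apply Cmod_ge_0|lra].
      + apply Rlt_le_trans with (e / (Rmax M 0 + 1) * (Rmax M 0 + 1)).
        * apply Rmult_lt_compat_r; [lra|exact Q].
        * right. field. lra. }
  assert (E0 : a 0%nat = b 0%nat) by (apply (Clim_unique near0 F); now apply L).
  destruct HF as [F1 [H HF]], HG as [G1 [K HG]].
  destruct k as [|k]; [exact E0|].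
  apply (IH (shift a) (shift b) F1); [exact HF| |lia].
  apply expands_ext with (2 := HG).
  generalize (filter_and _ _ (filter_and _ _ H K) near0_nonzero). apply filter_imp.
  intros z [[E1 E2] N]. rewrite E1, E0 in E2.
  replace (G1 z) with ((b 0%nat + z * G1 z - b 0%nat) / z)%C by (field; exact N).
  rewrite <- E2. field. exact N.
Qed.

Lemma pseries_expands (n : nat) (a : nat -> C) (F : C -> C) :
  power_series_in_disc a F -> expands n a F.
Proof.
  revert a F. induction n as [|n IH]; intros a F H.
  -    destruct (pseries_holo a F H _ disc_0) as [d Hd]. apply cder_cont in Hd.
    exists (Cmod (F 0%C) + 1). apply near0_of_nearC.
    apply (Clim_bounded _ _ _ Hd).
  - destruct (pseries_shift a F H) as [F1 [H1 E]]. exists F1. split; [|now apply IH].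
    apply near0_of_nearC. generalize (nearC_disc 0%C disc_0).
    apply filter_imp. exact E.
Qed.

(** Both sequences are asymptotic expansions of [H] at 0, so uniqueness identifies them without
    rearranging any series. *)
Lemma pseries_mult (a b c : nat -> C) (F G H : C -> C) :
  power_series_in_disc a F -> power_series_in_disc b G -> power_series_in_disc c H ->
  (forall z, disc z -> H z = (F z * G z)%C) -> forall k, c k = conv a b k.
Proof.
  intros HF HG HH E k. apply (expands_unique (S k) c (conv a b) H); [now apply pseries_expands| |lia].
  apply expands_ext with (fun z => F z * G z)%C.
  - apply near0_of_nearC. generalize (nearC_disc 0%C disc_0).
    apply filter_imp. intros z Hz. symmetry. now apply E.
  - now apply expands_mult; apply pseries_expands.
Qed.

Lemma holo_pseries (F : C -> C) : holo F -> exists a, power_series_in_disc a F /\ taylor_coeffs F a.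
Proof.
  intros H. destruct (ex_taylor_coeffs F H) as [a Ha]. exists a. split; [now apply taylor|exact Ha].
Qed.

(** * Bounded functions *)

Lemma polynomial_pseries (B : nat -> C) (m : nat) :
  power_series_in_disc (fun k => if Nat.ltb k m then B k else 0%C)
    (fun z => csum (fun k => B k * z ^ k)%C m).
Proof.
  intros z _. apply is_pseries_Clim. intros e He. exists m. intros n Hn.
  replace (csum (fun k => (if Nat.ltb k m then B k else 0) * z ^ k) (S n))%C
    with (csum (fun k => B k * z ^ k)%C m).
  - replace (_ - _)%C with (RtoC 0) by ring. now rewrite Cmod_0.
  - assert (E : forall j, (j <= m)%nat -> csum (fun k => B k * z ^ k)%C j
      = csum (fun k => (if Nat.ltb k m then B k else 0) * z ^ k)%C j).
    { induction j as [|j IH]; intros Hj; [reflexivity|]. rewrite !csum_S, IH by lia.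
      now rewrite (proj2 (Nat.ltb_lt j m) ltac:(lia)). }
    rewrite E by lia. assert (Hn' : (m <= S n)%nat) by lia. clear E Hn.
    induction Hn' as [|j Hj IH]; [reflexivity|]. rewrite csum_S, <- IH.
    rewrite (proj2 (Nat.ltb_ge j m) Hj). ring.
Qed.

(** Parseval for polynomials: each new monomial is orthogonal on the circle to those of lower
    degree. *)
Lemma is_mean_polynomial_sq (B : nat -> C) (r : R) (m : nat) :
  let P t := csum (fun k => B k * (RtoC r * cis t) ^ k)%C m in
  is_mean (fun t => P t * Cconj (P t))%C (RtoC (rsum (fun k => Cmod (B k * RtoC r ^ k)%C ^ 2)%R m)).
Proof.
  cbv zeta.
  assert (O : forall m j, (m <= j)%nat ->
    is_mean (fun t => csum (fun k => B k * (RtoC r * cis t) ^ k) m * Cconj (cis t) ^ j)%C 0%C).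
  { clear m. induction m as [|m IH]; intros j Hj.
    - apply is_mean_ext with (fun _ => RtoC 0); [intros t; simpl; ring|apply is_mean_const].
    - apply is_mean_eq with (0 + B m * RtoC r ^ m * 0)%C; [ring|].
      apply is_mean_ext with (fun t => csum (fun k => B k * (RtoC r * cis t) ^ k) m * Cconj (cis t) ^ j
        + B m * RtoC r ^ m * (cis t ^ m * Cconj (cis t) ^ j))%C.
      + intros t. rewrite csum_S, Cpow_mult_l. ring.
      + apply is_mean_plus; [apply IH; lia|]. apply is_mean_scal.
        generalize (is_mean_orth m j). destruct (Nat.eq_dec m j); [lia|auto]. }
  induction m as [|m IH].
  - apply is_mean_ext with (fun _ => RtoC 0); [intros t; simpl; ring|apply is_mean_const].
  - set (b := (B m * RtoC r ^ m)%C).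
    apply is_mean_eq with (RtoC (rsum (fun k => Cmod (B k * RtoC r ^ k)%C ^ 2)%R m)
      + (Cconj b * 0 + b * Cconj 0) + b * Cconj b)%C.
    { rewrite rsum_S, RtoC_plus. fold b. rewrite (Cmod_sq_conj b).
      replace (Cconj 0) with (RtoC 0) by (unfold Cconj, RtoC; simpl; now rewrite Ropp_0). ring. }
    apply is_mean_ext with (fun t =>
      csum (fun k => B k * (RtoC r * cis t) ^ k) m * Cconj (csum (fun k => B k * (RtoC r * cis t) ^ k) m)
      + (Cconj b * (csum (fun k => B k * (RtoC r * cis t) ^ k) m * Cconj (cis t) ^ m)
         + b * Cconj (csum (fun k => B k * (RtoC r * cis t) ^ k) m * Cconj (cis t) ^ m))
      + b * Cconj b)%C.
    + intros t. rewrite csum_S.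
      replace (B m * (RtoC r * cis t) ^ m)%C with (b * cis t ^ m)%C by (unfold b; rewrite Cpow_mult_l; ring).
      rewrite Cplus_conj, !Cmult_conj, !Cpow_conj, Cconj_conj.
      replace (b * Cconj b)%C with (b * Cconj b * (cis t ^ m * Cconj (cis t) ^ m))%C
        by (rewrite cis_pow_conj, Nat.sub_diag by lia; simpl; ring).
      ring.
    + apply is_mean_plus; [|apply is_mean_const]. apply is_mean_plus; [exact IH|].
      apply is_mean_plus; apply is_mean_scal; [|apply is_mean_conj]; now apply O.
Qed.

Lemma rsum_scal (c : R) (f : nat -> R) (n : nat) : rsum (fun k => c * f k) n = c * rsum f n.
Proof. induction n as [|n IH]; [simpl; ring|]. rewrite !rsum_S, IH. ring. Qed.

Lemma bernoulli (t : R) (n : nat) : 0 <= t <= 1 -> 1 - INR n * t <= (1 - t) ^ n.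
Proof.
  intros Ht. induction n as [|n IH]; [simpl; lra|].
  rewrite S_INR. change ((1 - t) ^ S n) with ((1 - t) * (1 - t) ^ n).
  generalize (pos_INR n). nra.
Qed.

Lemma le_of_radii (S0 C0 : R) (n : nat) : 0 <= S0 ->
  (forall r, 0 < r < 1 -> r ^ n * S0 <= C0) -> S0 <= C0.
Proof.
  intros H0 H. apply Rnot_lt_le. intros L.
  set (c := INR n + 1). assert (Hc : 1 <= c) by (unfold c; generalize (pos_INR n); lra).
  (* By Bernoulli's inequality, radius [1 - t] gives [(1 - n t) S0 <= C0]; this [t] makes [n t S0]
     at most half the gap [S0 - C0]. The summands 1 keep the denominator positive. *)
  set (t := Rmin (1 / 2) ((S0 - C0) / (2 * (S0 + 1) * c))).
  assert (Ht : 0 < t).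
  { apply Rmin_pos; [lra|]. apply Rdiv_lt_0_compat; [lra|]. apply Rmult_lt_0_compat; lra. }
  assert (Ht1 : t <= 1 / 2) by apply Rmin_l.
  assert (Ht2 : t <= (S0 - C0) / (2 * (S0 + 1) * c)) by apply Rmin_r.
  assert (B := bernoulli t n ltac:(lra)). assert (K := H (1 - t) ltac:(lra)).
  assert (E : t * c * (S0 + 1) <= (S0 - C0) / 2).
  { replace ((S0 - C0) / 2) with ((S0 - C0) / (2 * (S0 + 1) * c) * (c * (S0 + 1))) by (field; lra).
    rewrite Rmult_assoc. apply Rmult_le_compat_r; [|exact Ht2]. apply Rmult_le_pos; lra. }
  assert (F : (1 - INR n * t) * S0 <= (1 - t) ^ n * S0) by (apply Rmult_le_compat_r; lra).
  assert (G : INR n * t * S0 <= t * c * (S0 + 1)).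
  { replace (t * c * (S0 + 1)) with (INR n * t * S0 + t * S0 + t * c) by (unfold c; ring).
    assert (0 <= t * S0) by (apply Rmult_le_pos; lra).
    assert (0 <= t * c) by (apply Rmult_le_pos; lra). lra. }
  lra.
Qed.

(* Multiplication by a function bounded by 1 is a contraction of [L^2] of a
   circle, and the truncation of the factor [B] does not affect the first [m]
   coefficients of the product. *)
Theorem finite_section (phi : C -> C) (c B : nat -> C) (m : nat) :
  power_series_in_disc c phi -> (forall z, disc z -> Cmod (phi z) <= 1) ->
  rsum (fun k => Cmod (conv c B k) ^ 2) m <= rsum (fun k => Cmod (B k) ^ 2) m.
Proof.
  intros Hc Hphi.
  set (B' := fun k => if Nat.ltb k m then B k else 0%C).
  set (P := fun z => csum (fun k => B k * z ^ k)%C m).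
  assert (HP : power_series_in_disc B' P) by apply polynomial_pseries.
  set (F := fun z => (phi z * P z)%C).
  assert (HF : holo F) by (apply holo_mult; eapply pseries_holo; eassumption).
  destruct (holo_pseries F HF) as [d [Hd Td]].
  assert (Ed : forall k, d k = conv c B' k).
  { apply (pseries_mult c B' d phi P F Hc HP Hd). reflexivity. }
  assert (Ed' : forall k, (k < m)%nat -> conv c B k = d k).
  { intros k Hk. rewrite Ed. apply conv_ext; [reflexivity|]. intros j Hj. unfold B'.
    now rewrite (proj2 (Nat.ltb_lt j m) ltac:(lia)). }
  rewrite (rsum_ext _ (fun k => Cmod (d k) ^ 2)) by (intros k Hk; now rewrite Ed').
  assert (Nn : forall (f : nat -> C) n, 0 <= rsum (fun k => Cmod (f k) ^ 2) n).
  { intros f n. induction n as [|n IH]; [simpl; lra|]. rewrite rsum_S.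
    generalize (pow2_ge_0 (Cmod (f n))). lra. }
  (* On the circle of radius [r] the coefficient of index [k < m] is weighted by [r^(2k) >= r^(2m)].
     The chain is Bessel for [F], then [|F| <= |P|] pointwise, then Parseval for [P]. *)
  apply (le_of_radii _ _ (2 * m)); [apply Nn|]. intros r Hr.
  assert (Hpow : forall k, Cmod (RtoC r ^ k)%C = r ^ k).
  { intros k. rewrite Cmod_pow, Cmod_R, Rabs_pos_eq; lra. }
  assert (P0 : forall k, 0 < r ^ k) by (intros k; apply pow_lt; lra).
  assert (P1 : forall k, r ^ k <= 1) by (intros k; rewrite <- (pow1 k); apply pow_incr; lra).
  apply Rle_trans with (rsum (fun k => Cmod (d k * RtoC r ^ k)%C ^ 2) m).
  { rewrite <- rsum_scal. apply rsum_le. intros k Hk. rewrite Cmod_mult, Hpow.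
    rewrite Rpow_mult_distr, <- pow_mult, Rmult_comm.
    apply Rmult_le_compat_l; [apply pow2_ge_0|].
    replace (2 * m)%nat with (k * 2 + (2 * m - k * 2))%nat by lia. rewrite pow_add.
    rewrite <- (Rmult_1_r (r ^ (k * 2))) at 2. apply Rmult_le_compat_l; [left; apply P0|apply P1]. }
  destruct (ex_mean (fun t => F (RtoC r * cis t) * Cconj (F (RtoC r * cis t)))%C) as [A HA].
  { intros t. apply Clim_mult; [apply locally_filter| |apply Clim_conj; [apply locally_filter|]];
      apply holo_circle_cont; auto; lra. }
  apply Rle_trans with (1 := bessel _ A _ m HA (fun k => Td r k Hr)).
  apply Rle_trans with (rsum (fun k => Cmod (B k * RtoC r ^ k)%C ^ 2) m).
  { apply (is_mean_le _ _ _ _ HA (is_mean_polynomial_sq B r m)). intros t.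
    fold (P (RtoC r * cis t)%C). rewrite <- !Cmod_sq_conj. cbn [fst RtoC].
    apply pow_incr. split; [apply Cmod_ge_0|]. unfold F. rewrite Cmod_mult.
    rewrite <- (Rmult_1_l (Cmod (P _))) at 2. apply Rmult_le_compat_r; [apply Cmod_ge_0|].
    apply Hphi, circle_disc. lra. }
  apply rsum_le. intros k _. apply pow_incr. split; [apply Cmod_ge_0|].
  rewrite Cmod_mult, Hpow. rewrite <- (Rmult_1_r (Cmod (B k))) at 2.
  apply Rmult_le_compat_l; [apply Cmod_ge_0|apply P1].
Qed.

Lemma conv_delta (c : nat -> C) (n : nat) :
  conv c (fun k => match k with O => RtoC 1 | _ => RtoC 0 end) n = c n.
Proof.
  revert c. induction n as [|n IH]; intros c; [simpl; ring|].
  rewrite conv_S, IH. unfold shift. ring.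
Qed.

(** The contraction tested on the constant series 1. *)
Lemma bounded_coeff_le (phi : C -> C) (c : nat -> C) (n : nat) :
  power_series_in_disc c phi -> (forall z, disc z -> Cmod (phi z) <= 1) -> Cmod (c n) <= 1.
Proof.
  intros Hc Hphi.
  assert (H := finite_section phi c (fun k => match k with O => RtoC 1 | _ => RtoC 0 end) (S n) Hc Hphi).
  assert (E : forall j, rsum (fun k => Cmod (match k with O => RtoC 1 | _ => RtoC 0 end) ^ 2) (S j) = 1).
  { induction j as [|j IH]; [simpl; rewrite Cmod_1; ring|]. rewrite rsum_S, IH, Cmod_0. ring. }
  rewrite E, rsum_S, conv_delta in H.
  assert (0 <= rsum (fun k => Cmod (conv c (fun k => match k with O => RtoC 1 | _ => RtoC 0 end) k) ^ 2) n).
  { clear. induction n as [|n IH]; [simpl; lra|]. rewrite rsum_S.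
    generalize (pow2_ge_0 (Cmod (conv c (fun k => match k with O => RtoC 1 | _ => RtoC 0 end) n))). lra. }
  apply Rnot_lt_le. intros L. generalize (Cmod_ge_0 (c n)). nra.
Qed.

Lemma expands_zero (n : nat) (u : C -> C) (M : R) : near0 (fun z => Cmod (u z) <= M) ->
  expands n (fun _ => 0%C) (fun z => z ^ n * u z)%C.
Proof.
  intros H. induction n as [|n IH].
  - exists M. revert H. apply filter_imp. intros z. simpl. now rewrite Cmult_1_l.
  - exists (fun z => z ^ n * u z)%C. split; [|exact IH].
    apply filter_forall. intros z. rewrite Cpow_S. ring.
Qed.

(* Cauchy estimates for the powers [w ^ n], which vanish to order [n] at 0,
   give [|w z| ^ n (1 - |z|) <= |z| ^ n]; let [n] tend to infinity. *)
Theorem schwarz (w : C -> C) (z : C) : holo w -> w 0%C = 0%C ->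
  (forall y, disc y -> Cmod (w y) <= 1) -> disc z -> Cmod (w z) <= Cmod z.
Proof.
  intros Hw Hw0 Hw1 Hz.
  destruct (holo_pseries w Hw) as [a [Ha _]].
  destruct (pseries_shift a w Ha) as [v [Hv Ev]].
  assert (E0 : a 0%nat = 0%C) by (rewrite <- (pseries_at_0 a w Ha); exact Hw0).
  destruct (expands_bounded 0 _ v (pseries_expands 0 _ v Hv)) as [M HM].
  set (x := Cmod z). assert (Hx0 : 0 <= x) by apply Cmod_ge_0.
  assert (Hx1 : x < 1) by exact Hz.
  assert (Main : forall n, Cmod (w z) ^ n * (1 - x) <= x ^ n).
  { intros n. destruct (holo_pseries _ (holo_pow w n Hw)) as [d [Hd _]].
    assert (Hd1 : forall k, Cmod (d k) <= 1).
    { intros k. apply (bounded_coeff_le (fun y => w y ^ n)%C d k Hd). intros y Hy.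
      rewrite Cmod_pow, <- (pow1 n). apply pow_incr. split; [apply Cmod_ge_0|now apply Hw1]. }
    assert (Hdn : forall k, (k < n)%nat -> d k = 0%C).
    { apply (expands_unique n d (fun _ => 0%C) (fun y => w y ^ n)%C); [now apply pseries_expands|].
      apply expands_ext with (fun y => y ^ n * v y ^ n)%C.
      - apply near0_of_nearC. generalize (nearC_disc 0%C disc_0).
        apply filter_imp. intros y Hy. rewrite (Ev y Hy), E0, <- Cpow_mult_l. f_equal. ring.
      - apply (expands_zero n _ (M ^ n)). revert HM. unfold near0, within. apply filter_imp.
        intros y K N. rewrite Cmod_pow. apply pow_incr. split; [apply Cmod_ge_0|now apply K]. }
    rewrite <- Cmod_pow.
    assert (L := proj1 (is_pseries_Clim _ _ _) (Hd z Hz)).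
    replace (x ^ n) with (x ^ n / (1 - x) * (1 - x)) by (field; lra).
    apply Rmult_le_compat_r; [lra|].
    apply (Clim_Cmod_le _ _ _ _ L). apply filter_forall. intros k. generalize (S k). clear k L. intros k.
    (* The terms below index [n] vanish; from there on, [|d k z^k| <= x^k] sums geometrically. *)
    assert (B : (1 - x) * Cmod (csum (fun k => d k * z ^ k)%C k) <= Rmax (x ^ n - x ^ k) 0).
    { induction k as [|k IH]; [simpl csum; rewrite Cmod_0, Rmult_0_r; apply Rmax_r|].
      rewrite csum_S. assert (Pk : 0 <= x ^ k) by now apply pow_le.
      destruct (Nat.lt_ge_cases k n) as [L|L].
      - rewrite Hdn by exact L. replace (csum (fun k => d k * z ^ k) k + 0 * z ^ k)%C
          with (csum (fun k => d k * z ^ k) k)%C by ring.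
        apply Rle_trans with (1 := IH). apply Rle_max_compat_r.
        simpl. nra.
      - assert (Q : x ^ k <= x ^ n).
        { replace k with (n + (k - n))%nat by lia. rewrite pow_add.
          rewrite <- (Rmult_1_r (x ^ n)) at 2. apply Rmult_le_compat_l; [now apply pow_le|].
          rewrite <- (pow1 (k - n)). apply pow_incr. lra. }
        rewrite Rmax_left in IH by lra.
        apply Rle_trans with (2 := Rmax_l _ _).
        apply Rle_trans with ((1 - x) * (Cmod (csum (fun k => d k * z ^ k)%C k) + x ^ k)).
        + apply Rmult_le_compat_l; [lra|]. eapply Rle_trans; [apply Cmod_triangle|].
          apply Rplus_le_compat_l. rewrite Cmod_mult, Cmod_pow. fold x.
          rewrite <- (Rmult_1_l (x ^ k)) at 2. apply Rmult_le_compat_r; [exact Pk|apply Hd1].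
        + simpl. lra. }
    apply Rmult_le_reg_l with (1 - x); [lra|].
    replace ((1 - x) * (x ^ n / (1 - x))) with (x ^ n) by (field; lra).
    apply Rle_trans with (1 := B). apply Rmax_lub; [|now apply pow_le].
    assert (0 <= x ^ k) by now apply pow_le. lra. }
  destruct (Ceq_dec z 0) as [->|N].
  { rewrite Hw0, Cmod_0. unfold x. apply Cmod_ge_0. }
  assert (Hx : 0 < x) by now apply Cmod_gt_0.
  apply Rnot_lt_le. intros L.
  (* [|w z| = x (1 + t)], so the estimate reads [(1 + t)^n (1 - x) <= 1] for every [n], against the
     linear growth of [1 + n t]. *)
  set (t := Cmod (w z) / x - 1).
  assert (Ht : 0 < t).
  { unfold t. apply Rmult_lt_reg_r with x; [exact Hx|].
    replace ((Cmod (w z) / x - 1) * x) with (Cmod (w z) - x) by (field; lra). fold x in L. lra. }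
  destruct (INR_unbounded (/ ((1 - x) * t))) as [n Hn].
  assert (A := Main n). assert (Bn := poly n t Ht).
  assert (E : Cmod (w z) ^ n = x ^ n * (1 + t) ^ n).
  { rewrite <- Rpow_mult_distr. f_equal. unfold t. field. lra. }
  rewrite E in A.
  assert (Px : 0 < x ^ n) by now apply pow_lt.
  assert (A2 : (1 + t) ^ n * (1 - x) <= 1).
  { apply Rmult_le_reg_l with (1 := Px). lra. }
  assert (A3 : INR n * ((1 - x) * t) > 1).
  { assert (Q : 0 < (1 - x) * t) by (apply Rmult_lt_0_compat; lra).
    apply Rmult_lt_compat_r with (r := (1 - x) * t) in Hn; [|exact Q].
    rewrite Rinv_l in Hn by lra. lra. }
  assert (A4 : (1 + INR n * t) * (1 - x) <= (1 + t) ^ n * (1 - x)) by (apply Rmult_le_compat_r; lra).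
  nra.
Qed.

(** * Starlike functions *)

Lemma rder_is_derive_fst (f : R -> C) (t : R) (v : C) :
  rder f t v -> is_derive (fun s => fst (f s)) t (fst v).
Proof.
  intros H. split; [apply (is_linear_scal_l (K := R_AbsRing) (V := R_NormedModule) (fst v))|].
  intros y Hy. assert (y = t) as -> by (symmetry; apply is_filter_lim_locally_unique with (1 := Hy)).
  intros e. generalize (gder_eps _ _ _ _ _ e H (cond_pos e)). apply filter_imp. intros s Hs.
  change (Rabs (fst (f s) - fst (f t) - (s - t) * fst v) <= e * Rabs (s - t)).
  rewrite <- RtoC_minus, Cmod_R in Hs. apply Rle_trans with (2 := Hs).
  eapply Rle_trans; [|apply abs_fst_le]. right. f_equal. simpl. ring.
Qed.

(** The real mean value theorem, applied to the projection of the curve on its own chord. *)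
Lemma mean_value_inequality (u : R -> C) (M : R) :
  (forall t, 0 <= t <= 1 -> exists v, rder u t v /\ Cmod v <= M) -> Cmod (u 1 - u 0)%C <= M.
Proof.
  intros H. set (c := Cconj (u 1 - u 0)%C). set (p := fun t => fst (c * u t)%C).
  assert (D : forall t, 0 <= t <= 1 -> exists v, is_derive p t (fst (c * v)%C) /\ Cmod v <= M).
  { intros t Ht. destruct (H t Ht) as [v [Hv Hm]]. exists v. split; [|exact Hm].
    apply (rder_is_derive_fst (fun s => c * u s)%C).
    exact (gder_scal (locally t) RtoC t (Clim_RtoC t) u c v Hv). }
  destruct (MVT_gen p 0 1 (Derive p)) as [x [Hx E]].
  - rewrite Rmin_left, Rmax_right by lra. intros x Hx.
    destruct (D x ltac:(lra)) as [v [Hv _]]. apply Derive_correct. now exists (fst (c * v)%C).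
  - rewrite Rmin_left, Rmax_right by lra. intros x Hx.
    destruct (D x ltac:(lra)) as [v [Hv _]]. apply continuity_pt_filterlim.
    apply (ex_derive_continuous p). now exists (fst (c * v)%C).
  - rewrite Rmin_left, Rmax_right in Hx by lra.
    destruct (D x Hx) as [v [Hv Hm]]. rewrite (is_derive_unique _ _ _ Hv) in E.
    assert (E2 : Cmod (u 1 - u 0) ^ 2 = p 1 - p 0).
    { apply RtoC_inj. rewrite Cmod_sq_conj. fold c. unfold p. rewrite <- (re_RtoC (_ - _)).
      assert (R : (((u 1 - u 0) * c) = RtoC (fst ((u 1 - u 0) * c)))%C).
      { unfold c. rewrite <- Cmod_sq_conj. reflexivity. }
      rewrite R. f_equal. simpl. ring. }
    assert (B : fst (c * v)%C <= Cmod (u 1 - u 0)%C * M).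
    { apply Rle_trans with (1 := Rle_abs _). apply Rle_trans with (1 := abs_fst_le _).
      rewrite Cmod_mult. unfold c. rewrite Cmod_conj.
      apply Rmult_le_compat_l; [apply Cmod_ge_0|exact Hm]. }
    assert (M0 : 0 <= M) by (apply Rle_trans with (2 := Hm), Cmod_ge_0).
    destruct (Cmod_ge_0 (u 1 - u 0)%C) as [P|P]; [|lra].
    apply Rmult_le_reg_l with (1 := P). nra.
Qed.

Lemma rder_affine (z w : C) (t : R) : rder (fun s => z + RtoC s * w)%C t w.
Proof.
  exists (fun _ => w). split; [apply Clim_const, locally_filter|].
  apply filter_forall. intros s. ring.
Qed.

Lemma segment_lipschitz (k : C -> C) (z0 z1 z2 : C) (r M : R) :
  (forall z, Cmod (z - z0) <= r -> exists d, cder k z d /\ Cmod d <= M) ->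
  Cmod (z1 - z0) <= r -> Cmod (z2 - z0) <= r -> Cmod (k z1 - k z2) <= M * Cmod (z1 - z2).
Proof.
  intros H H1 H2.
  replace (k z1) with (k (z2 + RtoC 1 * (z1 - z2))%C) by (f_equal; ring).
  replace (k z2) with (k (z2 + RtoC 0 * (z1 - z2))%C) by (f_equal; ring).
  apply (mean_value_inequality (fun t => k (z2 + RtoC t * (z1 - z2))%C)).
  intros t Ht. destruct (H (z2 + RtoC t * (z1 - z2))%C) as [d [Hd Hm]].
  - replace (z2 + RtoC t * (z1 - z2) - z0)%C
      with (RtoC (1 - t) * (z2 - z0) + RtoC t * (z1 - z0))%C by (rewrite RtoC_minus; ring).
    eapply Rle_trans; [apply Cmod_triangle|]. rewrite !Cmod_mult, !Cmod_R, !Rabs_pos_eq by lra.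
    assert ((1 - t) * Cmod (z2 - z0) <= (1 - t) * r) by (apply Rmult_le_compat_l; lra).
    assert (t * Cmod (z1 - z0) <= t * r) by (apply Rmult_le_compat_l; lra). lra.
  - exists (d * (z1 - z2))%C. split.
    + exact (gder_comp (locally t) RtoC t (Clim_RtoC t) k (fun s => z2 + RtoC s * (z1 - z2))%C
        _ _ Hd (rder_affine z2 (z1 - z2) t)).
    + rewrite Cmod_mult. apply Rmult_le_compat_r; [apply Cmod_ge_0|exact Hm].
Qed.

Lemma contraction_fixpoint (T : C -> C) (z0 : C) (r : R) : 0 < r ->
  (forall z1 z2, Cmod (z1 - z0) <= r -> Cmod (z2 - z0) <= r ->
    Cmod (T z1 - T z2) <= / 2 * Cmod (z1 - z2)) ->
  (forall z, Cmod (z - z0) <= r -> Clim (nearC z) T (T z)) ->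
  Cmod (T z0 - z0) <= r / 2 -> exists z, Cmod (z - z0) <= r /\ T z = z.
Proof.
  intros Hr Hc Hcont H0.
  set (z := fun n => Nat.iter n T z0).
  assert (Hz0 : Cmod (z0 - z0) <= r).
  { replace (z0 - z0)%C with (RtoC 0) by ring. rewrite Cmod_0. lra. }
  assert (Hb : forall n, Cmod (z n - z0) <= r).
  { induction n as [|n IH]; [exact Hz0|]. change (z (S n)) with (T (z n)).
    replace (T (z n) - z0)%C with ((T (z n) - T z0) + (T z0 - z0))%C by ring.
    eapply Rle_trans; [apply Cmod_triangle|]. generalize (Hc _ _ IH Hz0). lra. }
  assert (Hd : forall n, Cmod (z (S n) - z n) <= r / 2 * (/ 2) ^ n).
  { induction n as [|n IH].
    { change (Cmod (T z0 - z0) <= r / 2 * 1). lra. }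
    change (z (S (S n))) with (T (z (S n))).
    change (z (S n)) with (T (z n)) at 2. eapply Rle_trans; [apply Hc; apply Hb|].
    change ((/ 2) ^ S n) with (/ 2 * (/ 2) ^ n). lra. }
  destruct (ex_series_le (K := C_AbsRing) (V := C_CompleteNormedModule)
    (fun n => z (S n) - z n)%C (fun n => r / 2 * (/ 2) ^ n) Hd) as [l Hl].
  { apply (ex_series_scal (r / 2) (fun m => (/ 2) ^ m)), ex_series_geom. rewrite Rabs_pos_eq; lra. }
  assert (L : Clim eventually (fun n => z (S n)) (z0 + l)%C).
  { apply Clim_ext with (fun n => z0 + csum (fun n => z (S n) - z n)%C (S n))%C; [apply eventually_filter| |].
    - apply filter_forall. intros n. generalize (S n). clear n. intros n.
      induction n as [|n IH]; [simpl; unfold z; simpl; ring|].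
      rewrite csum_S, Cplus_assoc, IH. ring.
    - apply Clim_plus; [apply eventually_filter|apply Clim_const, eventually_filter|].
      apply (Clim_filterlim eventually).
      apply filterlim_ext with (2 := Hl). intros n. apply sum_n_csum. }
  exists (z0 + l)%C.
  assert (B : Cmod (z0 + l - z0) <= r).
  { apply (Clim_Cmod_le eventually (fun n => z (S n) - z0)%C).
    - apply Clim_minus; [apply eventually_filter|exact L|apply Clim_const, eventually_filter].
    - apply filter_forall. intros n. apply Hb. }
  split; [exact B|].
  apply (Clim_unique eventually (fun n => T (z (S n)))).
  - apply (Clim_comp eventually T) with (1 := Hcont _ B). exact L.
  - exact (Clim_subseq_S (fun n => z (S n)) _ L).
Qed.

(** A simplified Newton iteration, with the slope frozen at [d = h' z0], solves [h z = w]. It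
    contracts by 1/2 as long as [|h' z - d| < |d| / 2], which continuity of [h'] ensures near
    [z0]. *)
Lemma locally_onto (h : C -> C) (z0 : C) (eps : R) :
  (forall z, disc z -> cder h z (C_derive h z)) -> holo (C_derive h) ->
  disc z0 -> C_derive h z0 <> 0%C -> 0 < eps ->
  nearC (h z0) (fun w => exists z, disc z /\ Cmod (z - z0) < eps /\ h z = w).
Proof.
  intros Hh Hh' Hz N He. set (d := C_derive h z0) in *.
  assert (Pd : 0 < Cmod d) by now apply Cmod_gt_0.
  destruct (Hh' z0 Hz) as [dd Hdd]. apply cder_cont in Hdd. fold d in Hdd.
  assert (Pd2 : 0 < Cmod d / 2) by lra.
  destruct (nearC_elim _ _ (filter_and _ _ (Hdd _ Pd2) (nearC_disc z0 Hz))) as [s [Hs B]].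
  set (r := Rmin (s / 2) (eps / 2)).
  assert (Hr : 0 < r) by (apply Rmin_pos; lra).
  assert (Hr1 : r <= s / 2) by apply Rmin_l. assert (Hr2 : r <= eps / 2) by apply Rmin_r.
  (* The first step has length [|w - h z0| / |d|] and must be at most [r / 2] for the iterates to
     stay in the ball. *)
  apply (nearC_intro _ _ (Cmod d * (r / 2))).
  { apply Rmult_lt_0_compat; lra. }
  intros w Hw. set (T := fun z => (z - (h z - w) * / d)%C).
  assert (HT : forall z, Cmod (z - z0) <= r -> cder T z (1 - C_derive h z * / d)%C).
  { intros z Hzr. destruct (B z ltac:(lra)) as [_ Dz]. unfold T.
    apply (gder_minus (nearC z) (fun w => w) z (Clim_id z) (fun z => z) (fun z => (h z - w) * / d)%C);
      [apply gder_iota, nearC_filter|].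
    replace (C_derive h z * / d)%C with (/ d * (C_derive h z - 0))%C by ring.
    apply gder_ext with (f := fun y => (/ d * (h y - w))%C); [apply nearC_filter| |ring|].
    - apply filter_forall. intros y. ring.
    - apply (gder_scal (nearC z) (fun w => w) z (Clim_id z) (fun y => (h y - w)%C)).
      apply (gder_minus (nearC z) (fun w => w) z (Clim_id z) h (fun _ => w)); [now apply Hh|].
      apply gder_const, nearC_filter. }
  destruct (contraction_fixpoint T z0 r Hr) as [z [Hz1 Hz2]].
  - intros z1 z2 Z1 Z2. apply (segment_lipschitz T z0 z1 z2 r); auto.
    intros z Zr. exists (1 - C_derive h z * / d)%C. split; [now apply HT|].
    replace (1 - C_derive h z * / d)%C with ((d - C_derive h z) / d)%C by (field; exact N).
    rewrite Cmod_div, Cmod_sub_sym by exact N.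
    destruct (B z ltac:(lra)) as [Bz _]. apply Rmult_le_reg_r with (1 := Pd).
    unfold Rdiv. rewrite Rmult_assoc, Rinv_l by lra. lra.
  - intros z Zr. apply cder_cont with (1 := HT z Zr).
  - unfold T. replace (z0 - (h z0 - w) * / d - z0)%C with ((w - h z0) / d)%C by (field; exact N).
    rewrite Cmod_div by exact N. apply Rmult_le_reg_r with (1 := Pd).
    unfold Rdiv. rewrite Rmult_assoc, Rinv_l by lra. lra.
  - exists z. destruct (B z ltac:(lra)) as [_ Dz]. split; [exact Dz|]. split; [lra|].
    unfold T in Hz2.
    replace (h z) with (w + (z - (z - (h z - w) * / d)) * d)%C by (field; exact N).
    rewrite Hz2. ring.
Qed.

Section Starlike.
Variables (h : C -> C) (a : nat -> C).
Hypotheses (ha : power_series_in_disc a h) (h_inj : one_to_one_in_disc h) (h0 : h 0%C = 0%C)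
  (h_star : starlike_set (image_of_disc h)) (h'_neq : forall z, disc z -> C_derive h z <> 0%C).

Let h_der : forall z, disc z -> cder h z (C_derive h z).
Proof. apply (pseries_deriv a h ha). Qed.

Let h'_holo : holo (C_derive h).
Proof. apply (pseries_holo (dcoef a)), (pseries_deriv a h ha). Qed.

Lemma ex_inverse : exists k : C -> C,
  (forall w, image_of_disc h w -> disc (k w) /\ h (k w) = w) /\
  (forall z, disc z -> k (h z) = z).
Proof.
  destruct (choice (fun w z => image_of_disc h w -> disc z /\ h z = w)) as [k Hk].
  - intros w. destruct (classic (image_of_disc h w)) as [[z Hz]|N]; [now exists z|now exists 0%C].
  - exists k. split; [exact Hk|]. intros z Hz.
    destruct (Hk (h z)) as [A B]; [now exists z|]. now apply h_inj.
Qed.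

(** Local surjectivity shows both that the image is a neighbourhood of [h z] and that [k] is
    continuous there: by injectivity, the preimage found near [z] is the value of [k]. The slope of
    [k] is then the reciprocal of that of [h]. *)
Lemma inverse_cder (k : C -> C) :
  (forall w, image_of_disc h w -> disc (k w) /\ h (k w) = w) ->
  (forall z, disc z -> k (h z) = z) ->
  forall z, disc z -> cder k (h z) (/ C_derive h z).
Proof.
  intros K1 K2 z Hz.
  assert (Ck : Clim (nearC (h z)) k z).
  { intros e He. generalize (locally_onto h z e h_der h'_holo Hz (h'_neq z Hz) He).
    apply filter_imp. intros w [y [Dy [Hy <-]]]. now rewrite K2. }
  assert (Im : nearC (h z) (image_of_disc h)).
  { generalize (locally_onto h z 1 h_der h'_holo Hz (h'_neq z Hz) Rlt_0_1).
    apply filter_imp. intros w [y [Dy [_ E]]]. now exists y. }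
  destruct (h_der z Hz) as [q [Hq1 Hq2]].
  assert (Cq : Clim (nearC (h z)) (fun w => q (k w)) (C_derive h z)).
  { exact (Clim_comp (nearC (h z)) q k z _ Hq1 Ck). }
  exists (fun w => / q (k w))%C. split.
  - apply Clim_inv; [apply nearC_filter|now apply h'_neq|exact Cq].
  - destruct (nearC_elim _ _ Hq2) as [e [He Q]].
    generalize (filter_and _ _ (filter_and _ _ Im (Ck e He)) (Clim_neq_0 _ _ _ (h'_neq z Hz) Cq)).
    apply filter_imp. intros w [[Iw Kw] Nw].
    assert (N : q (k w) <> 0%C).
    { apply Cmod_gt_0. generalize (Cmod_ge_0 (C_derive h z)). lra. }
    rewrite K2 by exact Hz. specialize (Q _ Kw). rewrite (proj2 (K1 w Iw)) in Q.
    assert (E : (w - h z = (k w - z) * q (k w))%C).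
    { transitivity (h z + (k w - z) * q (k w) - h z)%C; [f_equal; exact Q|ring]. }
    rewrite E. field. exact N.
Qed.

(** The derivatives are two-sided even at the endpoints, because the image is a neighbourhood of
    each of its points; the velocity at [t = 1] carries the geometric information. *)
Lemma starlike_path (z : C) : disc z -> exists gam : R -> C,
  gam 0 = 0%C /\ gam 1 = z /\
  forall t, 0 <= t <= 1 -> disc (gam t) /\ Cmod (gam t) <= Cmod z /\
    rder gam t (h z / C_derive h (gam t)).
Proof.
  intros Hz. destruct ex_inverse as [k [K1 K2]].
  assert (Im : forall t y, 0 <= t <= 1 -> disc y -> image_of_disc h (RtoC t * h y)%C).
  { intros t y Ht Hy. apply h_star; [now exists y|exact Ht]. }
  assert (E0 : k 0%C = 0%C) by (rewrite <- h0 at 1; apply K2, disc_0).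
  exists (fun t => k (RtoC t * h z)%C). split; [|split].
  - now rewrite Cmult_0_l.
  - rewrite Cmult_1_l. now apply K2.
  - intros t Ht. destruct (K1 _ (Im t z Ht Hz)) as [D1 D2].
    split; [exact D1|]. split.
    + apply (schwarz (fun y => k (RtoC t * h y)%C)); [|now rewrite h0, Cmult_0_r| |exact Hz].
      * intros y Hy. destruct (K1 _ (Im t y Ht Hy)) as [Y1 Y2].
        exists (/ C_derive h (k (RtoC t * h y)) * (RtoC t * C_derive h y))%C.
        apply (gder_comp (nearC y) (fun w => w) y (Clim_id y) k (fun w => RtoC t * h w)%C).
        -- generalize (inverse_cder k K1 K2 _ Y1). now rewrite Y2.
        -- apply (gder_scal (nearC y) (fun w => w) y (Clim_id y) h). now apply h_der.
      * intros y Hy. left. apply (K1 _ (Im t y Ht Hy)).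
    + replace (h z / C_derive h (k (RtoC t * h z)))%C
        with (/ C_derive h (k (RtoC t * h z)) * h z)%C by (unfold Cdiv; ring).
      apply (gder_comp (locally t) RtoC t (Clim_RtoC t) k (fun s => RtoC s * h z)%C).
      * generalize (inverse_cder k K1 K2 _ D1). now rewrite D2.
      * apply gder_ext with (f := fun s => (0 + RtoC s * h z)%C); [apply locally_filter| |ring|].
        -- apply filter_forall. intros s. ring.
        -- apply rder_affine.
Qed.

(** Along the path, [g] moves with velocity [(g' / h') * h z], of modulus at most [|h z|], during
    unit time. *)
Lemma starlike_dominates (g : C -> C) (z : C) :
  (forall y, disc y -> cder g y (C_derive g y)) -> g 0%C = 0%C ->
  (forall y, disc y -> Cmod (C_derive g y) <= Cmod (C_derive h y)) ->
  disc z -> Cmod (g z) <= Cmod (h z).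
Proof.
  intros Hg g0 Hle Hz. destruct (starlike_path z Hz) as [gam [G0 [G1 G]]].
  replace (g z) with (g (gam 1) - g (gam 0))%C by (rewrite G0, G1, g0; ring).
  apply (mean_value_inequality (fun t => g (gam t))). intros t Ht.
  destruct (G t Ht) as [D [_ R]].
  exists (C_derive g (gam t) * (h z / C_derive h (gam t)))%C. split.
  - exact (gder_comp (locally t) RtoC t (Clim_RtoC t) g gam _ _ (Hg _ D) R).
  - assert (N := h'_neq _ D). assert (P : 0 < Cmod (C_derive h (gam t))) by now apply Cmod_gt_0.
    rewrite Cmod_mult, Cmod_div by exact N.
    apply Rmult_le_reg_r with (1 := P).
    replace (Cmod (C_derive g (gam t)) * (Cmod (h z) / Cmod (C_derive h (gam t))) * Cmod (C_derive h (gam t)))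
      with (Cmod (C_derive g (gam t)) * Cmod (h z)) by (field; lra).
    rewrite Rmult_comm. apply Rmult_le_compat_l; [apply Cmod_ge_0|now apply Hle].
Qed.

Lemma Cmod_sq (x : C) : Cmod x ^ 2 = fst x * fst x + snd x * snd x.
Proof. rewrite Cmod2_alt. unfold Re, Im. ring. Qed.

(* The curve [gam] ends at [z] inside the disc of radius [|z|], so its velocity
   [h z / h' z] there does not point inwards. *)
Lemma starlike_re_nonneg (z : C) : disc z ->
  0 <= fst (Cconj (z * C_derive h z) * h z)%C.
Proof.
  intros Hz. destruct (starlike_path z Hz) as [gam [_ [G1 G]]].
  set (v := (h z / C_derive h z)%C).
  assert (N := h'_neq z Hz).
  assert (V : 0 <= fst (Cconj z * v)%C).
  { destruct (G 1 ltac:(lra)) as [_ [_ [q [Hq1 Hq2]]]]. rewrite G1 in Hq1, Hq2. fold v in Hq1.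
    apply Rnot_lt_le. intros L.
    assert (Hq : Clim (locally 1) (fun t => Cconj z * q t)%C (Cconj z * v)%C).
    { apply Clim_mult; [apply locally_filter|apply Clim_const, locally_filter|exact Hq1]. }
    assert (L' : 0 < - fst (Cconj z * v)%C) by lra.
    destruct (filter_and _ _ Hq2 (Hq _ L')) as [e He].
    (* Stepping back by [s] gives [gam (1 - s) = z - s q], and [|z - s q|^2 = |z|^2 - 2 s Re (conj z
       * q) + s^2 |q|^2]. This exceeds [|z|^2] once [Re (conj z * q) < 0]. *)
    set (s := Rmin (e / 2) (1 / 2)). assert (Pe := cond_pos e).
    assert (Hs : 0 < s) by (apply Rmin_pos; lra).
    assert (Hs1 : s <= e / 2) by apply Rmin_l. assert (Hs2 : s <= 1 / 2) by apply Rmin_r.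
    destruct (He (1 - s)) as [E1 E2].
    { change (Rabs (1 - s - 1) < e). replace (1 - s - 1) with (- s) by ring.
      rewrite Rabs_Ropp, Rabs_pos_eq; lra. }
    assert (B := proj1 (proj2 (G (1 - s) ltac:(lra)))).
    assert (B2 : Cmod (gam (1 - s)) ^ 2 <= Cmod z ^ 2) by (apply pow_incr; split; [apply Cmod_ge_0|exact B]).
    rewrite E1, !Cmod_sq in B2.
    assert (E3 := Rle_lt_trans _ _ _ (abs_fst_le _) E2).
    apply Rabs_lt_between in E3.
    destruct z as [x y], (q (1 - s)) as [q1 q2], v as [v1 v2]. simpl in *.
    assert (0 <= s * s * (q1 * q1 + q2 * q2)) by nra.
    assert (s * (x * q1 + y * q2) >= 0) by nra.
    assert (x * q1 + y * q2 < 0) by nra. nra. }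
  replace (Cconj (z * C_derive h z) * h z)%C
    with (RtoC (Cmod (C_derive h z) ^ 2) * (Cconj z * v))%C.
  - replace (fst (RtoC (Cmod (C_derive h z) ^ 2) * (Cconj z * v))%C)
      with (Cmod (C_derive h z) ^ 2 * fst (Cconj z * v)%C) by (unfold RtoC; simpl; ring).
    apply Rmult_le_pos; [apply pow2_ge_0|exact V].
  - rewrite Cmod_sq_conj, Cmult_conj. unfold v. field. exact N.
Qed.

(** With [A = z h'] and [B = h], [|A - B| <= |A + B|] is equivalent to [Re (conj A * B) >= 0]. If
    [A + B] were 0, that real part would be [- |A|^2 < 0]. *)
Lemma starlike_cayley (z : C) : disc z -> z <> 0%C ->
  (z * C_derive h z + h z)%C <> 0%C /\
  Cmod (z * C_derive h z - h z) <= Cmod (z * C_derive h z + h z).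
Proof.
  intros Hz N. assert (P := starlike_re_nonneg z Hz).
  assert (NA := Cmult_neq_0 _ _ N (h'_neq z Hz)).
  set (A := (z * C_derive h z)%C) in *. set (B := h z) in *. split.
  - intros E. apply NA. apply Cmod_eq_0.
    assert (EB : B = (- A)%C) by (replace B with (A + B - A)%C by ring; rewrite E; ring).
    rewrite EB in P.
    replace (fst (Cconj A * - A)%C) with (- Cmod A ^ 2) in P by (rewrite Cmod_sq; simpl; ring).
    generalize (Cmod_ge_0 A). nra.
  - apply Rsqr_incr_0; try apply Cmod_ge_0. rewrite !Rsqr_pow2, !Cmod_sq.
    destruct A as [a1 a2], B as [b1 b2]. simpl in *. lra.
Qed.
End Starlike.

(** * Coefficient bounds *)

Lemma pseries_axpy (c : C) (a b : nat -> C) (F G : C -> C) :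
  power_series_in_disc a F -> power_series_in_disc b G ->
  power_series_in_disc (fun k => a k + c * b k)%C (fun z => F z + c * G z)%C.
Proof.
  intros HF HG z Hz. apply is_pseries_Clim.
  apply Clim_ext with (fun n => csum (fun k => a k * z ^ k) (S n) + c * csum (fun k => b k * z ^ k) (S n))%C;
    [apply eventually_filter| |].
  - apply filter_forall. intros n. generalize (S n). clear n. intros n.
    induction n as [|n IH]; [simpl; ring|]. rewrite !csum_S, <- IH. ring.
  - apply Clim_plus; [apply eventually_filter|now apply is_pseries_Clim, HF|].
    apply Clim_mult; [apply eventually_filter|apply Clim_const, eventually_filter|].
    now apply is_pseries_Clim, HG.
Qed.

(** * Formal square roots and the Euler operator *)

Lemma conv_square_middle (x : nat -> C) (n : nat) :
  conv x x (S (S n)) = (2 * (x 0%nat * x (S (S n))) + conv (shift x) (shift x) n)%C.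
Proof. rewrite conv_S, conv_S_r. unfold shift at 3. ring. Qed.

Section FormalSqrt.
Variable t : nat -> C.

(* [conv x x (S n) - 2 x_0 x_(n+1)], which only involves [x_1, ..., x_n]. *)
Let middle (x : nat -> C) (n : nat) : C :=
  match n with O => 0%C | S m => conv (shift x) (shift x) m end.

(** Course-of-values recursion: the entries up to [n] are final, those beyond are filler. With
    [x_0 = 1], the coefficient of index [m + 1] of the square is [2 x_(m+1)] plus [middle], whence
    the division by 2. *)
Fixpoint sqrt_prefix (n : nat) : nat -> C :=
  match n with
  | O => fun _ => 1%C
  | S m => fun k => if Nat.leb k m then sqrt_prefix m k
                    else ((t (S m) - middle (sqrt_prefix m) m) / 2)%C
  end.

Lemma ex_formal_sqrt : t 0%nat = 1%C -> exists s : nat -> C, s 0%nat = 1%C /\ forall n, conv s s n = t n.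
Proof.
  intros t0. set (s := fun k => sqrt_prefix k k).
  assert (E : forall n k, (k <= n)%nat -> sqrt_prefix n k = s k).
  { induction n as [|n IH]; intros k Hk.
    - now replace k with 0%nat by lia.
    - destruct (Nat.eq_dec k (S n)) as [->|N]; [reflexivity|].
      cbn [sqrt_prefix]. rewrite (proj2 (Nat.leb_le k n) ltac:(lia)). apply IH. lia. }
  assert (M : forall n, middle (sqrt_prefix n) n = middle s n).
  { intros [|n]; [reflexivity|]. unfold middle. apply conv_ext; intros k Hk; unfold shift; apply E; lia. }
  exists s. split; [reflexivity|]. intros n.
  assert (Sn : forall m, s (S m) = ((t (S m) - middle s m) / 2)%C).
  { intros m. unfold s at 1. cbn [sqrt_prefix]. rewrite (proj2 (Nat.leb_gt (S m) m) ltac:(lia)).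
    now rewrite M. }
  assert (s0 : s 0%nat = 1%C) by reflexivity. clearbody s.
  destruct n as [|[|n]].
  - simpl. rewrite t0, s0. ring.
  - rewrite conv_S. simpl conv. unfold shift. rewrite Sn, s0. unfold middle. field.
  - rewrite conv_square_middle, Sn, s0. unfold middle. field.
Qed.
End FormalSqrt.

(* The Euler operator [z d/dz] on coefficient sequences. *)
Definition euler (x : nat -> C) (n : nat) : C := (RtoC (INR n) * x n)%C.

Lemma euler_conv (x y : nat -> C) (n : nat) :
  euler (conv x y) n = (conv (euler x) y n + conv x (euler y) n)%C.
Proof.
  revert x. induction n as [|n IH]; intros x; [unfold euler; simpl; ring|].
  rewrite (conv_S (euler x)), (conv_S x).
  replace (shift (euler x)) with (fun k => euler (shift x) k + shift x k)%C.
  - rewrite conv_plus_l. unfold euler at 1. rewrite conv_S.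
    assert (I := IH (shift x)). unfold euler at 1 in I.
    replace (conv (euler (shift x)) y n) with (RtoC (INR n) * conv (shift x) y n - conv (shift x) (euler y) n)%C
      by (rewrite I; ring).
    unfold euler at 1 3. rewrite S_INR, RtoC_plus. simpl INR. ring.
  - apply functional_extensionality. intros k. unfold euler, shift. rewrite S_INR, RtoC_plus. ring.
Qed.

Lemma conv_cancel (s x : nat -> C) (n : nat) : s 0%nat = 1%C ->
  (forall m, conv s x m = 0%C) -> x n = 0%C.
Proof.
  intros s0. revert x. induction n as [|n IH]; intros x H.
  - generalize (H 0%nat). simpl. rewrite s0. intros <-. ring.
  - apply (IH (shift x)). intros m.
    assert (X0 : x 0%nat = 0%C) by (generalize (H 0%nat); simpl; rewrite s0; intros <-; ring).
    rewrite <- (H (S m)), conv_S_r, X0. ring.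
Qed.

Lemma conv_plus_r (x y z : nat -> C) (n : nat) :
  conv z (fun k => x k + y k)%C n = (conv z x n + conv z y n)%C.
Proof. rewrite conv_comm, conv_plus_l, !(conv_comm _ z). reflexivity. Qed.

Lemma conv_scal_r (c : C) (x z : nat -> C) (n : nat) :
  conv z (fun k => c * x k)%C n = (c * conv z x n)%C.
Proof. rewrite conv_comm, conv_scal_l, (conv_comm x z). reflexivity. Qed.

(* [phi (E t + 2 t) = E t] with [t = s * s] becomes [phi (E s + s) = E s]
   after division by [2 s], where [E] is the Euler operator. *)
Lemma sqrt_euler_relation (c t s : nat -> C) : s 0%nat = 1%C -> (forall n, conv s s n = t n) ->
  (forall n, euler t n = conv c (fun k => euler t k + 2 * t k)%C n) ->
  forall n, euler s n = conv c (fun k => euler s k + s k)%C n.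
Proof.
  intros s0 Hs H n.
  assert (Et : t = conv s s) by (apply functional_extensionality; intros k; now rewrite Hs).
  assert (E1 : forall k, euler t k = (2 * conv s (euler s) k)%C).
  { intros k. rewrite Et, euler_conv, (conv_comm (euler s)). ring. }
  assert (E2 : (fun k => euler t k + 2 * t k)%C = (fun k => 2 * conv s (fun k => euler s k + s k)%C k)%C).
  { apply functional_extensionality. intros k. rewrite E1, Et, conv_plus_r. ring. }
  assert (Z : forall m, conv s (fun k => euler s k + (- (1)) * conv c (fun k => euler s k + s k)%C k)%C m = 0%C).
  { intros m. rewrite conv_plus_r, conv_scal_r.
    assert (K := H m). rewrite E1, E2, conv_scal_r, <- conv_assoc in K.
    replace (conv c s) with (conv s c) in K by (apply functional_extensionality; intros k; apply conv_comm).
    rewrite conv_assoc in K.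
    replace (conv s (euler s) m) with ((2 * conv s (euler s) m) / 2)%C.
    - rewrite K. field.
    - field. }
  assert (X := conv_cancel s _ n s0 Z). cbv beta in X.
  replace (euler s n) with ((euler s n + - (1) * conv c (fun k => euler s k + s k)%C n)
    + conv c (fun k => euler s k + s k)%C n)%C by ring.
  rewrite X. ring.
Qed.

(** Comparing square sums on both sides of the relation bounds [sum k^2 |s_k|^2] over [k <= n] by
    [sum (k + 1)^2 |s_k|^2] over [k < n]. If the earlier [|s_k|] are at most 1, the excess is at
    most the sum of the [2 k + 1] over [k < n], that is [n^2], which leaves [n^2 |s_n|^2 <= n^2]. *)
Lemma clunie (phi : C -> C) (c s : nat -> C) :
  power_series_in_disc c phi -> (forall z, disc z -> Cmod (phi z) <= 1) -> c 0%nat = 0%C ->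
  s 0%nat = 1%C -> (forall n, euler s n = conv c (fun k => euler s k + s k)%C n) ->
  forall n, Cmod (s n) <= 1.
Proof.
  intros Hc Hphi c0 s0 Hs.
  assert (Main : forall n, rsum (fun k => INR k ^ 2 * Cmod (s k) ^ 2) (S n)
      <= rsum (fun k => (INR k + 1) ^ 2 * Cmod (s k) ^ 2) n).
  { intros n. set (B := fun k => if Nat.ltb k n then (euler s k + s k)%C else 0%C).
    assert (F := finite_section phi c B (S n) Hc Hphi).
    rewrite (rsum_ext (fun k => Cmod (conv c B k) ^ 2) (fun k => INR k ^ 2 * Cmod (s k) ^ 2)) in F.
    - apply Rle_trans with (1 := F). right. rewrite rsum_S. unfold B at 2.
      rewrite Nat.ltb_irrefl, Cmod_0. rewrite (rsum_ext _ (fun k => (INR k + 1) ^ 2 * Cmod (s k) ^ 2)); [ring|].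
      intros k Hk. unfold B. rewrite (proj2 (Nat.ltb_lt k n) Hk). unfold euler.
      replace (RtoC (INR k) * s k + s k)%C with (RtoC (INR k + 1) * s k)%C by (rewrite RtoC_plus; ring).
      rewrite Cmod_mult, Cmod_R, Rabs_pos_eq by (generalize (pos_INR k); lra). ring.
    - intros k Hk. replace (conv c B k) with (euler s k).
      + unfold euler. rewrite Cmod_mult, Cmod_R, Rabs_pos_eq by apply pos_INR. ring.
      + rewrite Hs. destruct k as [|k]; [simpl; rewrite c0; ring|].
        rewrite !conv_S, c0, !Cmult_0_l. f_equal. apply conv_ext; [reflexivity|].
        intros j Hj. unfold B. now rewrite (proj2 (Nat.ltb_lt j n) ltac:(lia)). }
  intros n. induction n as [n IH] using lt_wf_ind.
  destruct n as [|n]; [rewrite s0, Cmod_1; lra|].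
  set (m := S n) in *.
  assert (K := Main m). rewrite rsum_S in K.
  assert (D : rsum (fun k => (INR k + 1) ^ 2 * Cmod (s k) ^ 2) m
    <= rsum (fun k => INR k ^ 2 * Cmod (s k) ^ 2) m + INR m ^ 2).
  { assert (G : forall j, (j <= m)%nat -> rsum (fun k => (INR k + 1) ^ 2 * Cmod (s k) ^ 2) j
      <= rsum (fun k => INR k ^ 2 * Cmod (s k) ^ 2) j + INR j ^ 2).
    { induction j as [|j IHj]; intros Hj; [simpl; lra|]. rewrite !rsum_S, S_INR.
      assert (A := IHj ltac:(lia)).
      assert (Q : Cmod (s j) ^ 2 <= 1).
      { rewrite <- (pow1 2). apply pow_incr. split; [apply Cmod_ge_0|apply IH; lia]. }
      assert (P := pos_INR j).
      assert ((2 * INR j + 1) * Cmod (s j) ^ 2 <= (2 * INR j + 1) * 1) by (apply Rmult_le_compat_l; lra).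
      lra. }
    apply G. lia. }
  assert (Pm : 0 < INR m) by (apply lt_0_INR; unfold m; lia).
  assert (Q : INR m ^ 2 * Cmod (s m) ^ 2 <= INR m ^ 2) by lra.
  rewrite <- Rpow_mult_distr in Q.
  apply Rnot_lt_le. intros L.
  assert (INR m < INR m * Cmod (s m)).
  { rewrite <- (Rmult_1_r (INR m)) at 1. apply Rmult_lt_compat_l; lra. }
  nra.
Qed.

(** * Quadratic estimates for Cauchy products *)

Lemma rsum_S_l (f : nat -> R) (n : nat) : rsum f (S n) = f 0%nat + rsum (fun k => f (S k)) n.
Proof. induction n as [|n IH]; [simpl; ring|]. rewrite rsum_S, IH, rsum_S. ring. Qed.

Lemma rsum_one (n : nat) : rsum (fun _ => 1) n = INR n.
Proof. induction n as [|n IH]; [reflexivity|]. rewrite rsum_S, IH, S_INR. ring. Qed.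

(** Young's inequality [2 a b <= p a^2 + q b^2] on each product. The weights are left free so that
    the Cauchy-Schwarz bound follows from [p = sqrt (B / A)] without normalising the sequences. *)
Lemma conv_young (x y : nat -> C) (p q : R) (n : nat) : 0 < p -> 0 < q -> p * q = 1 ->
  2 * Cmod (conv x y n) <= p * rsum (fun k => Cmod (x k) ^ 2) (S n) + q * rsum (fun k => Cmod (y k) ^ 2) (S n).
Proof.
  intros Hp Hq Hpq.
  assert (Y : forall a b : R, 2 * (a * b) <= p * a ^ 2 + q * b ^ 2).
  { intros a b. apply Rmult_le_reg_l with p; [exact Hp|].
    replace (p * (p * a ^ 2 + q * b ^ 2)) with ((p * a) ^ 2 + p * q * b ^ 2) by ring.
    rewrite Hpq. generalize (pow2_ge_0 (p * a - b)). lra. }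
  revert x. induction n as [|n IH]; intros x.
  - simpl conv. rewrite Cmod_mult, !rsum_S. simpl rsum. generalize (Y (Cmod (x 0%nat)) (Cmod (y 0%nat))). lra.
  - rewrite conv_S. generalize (Cmod_triangle (x 0%nat * y (S n)) (conv (shift x) y n)).
    rewrite Cmod_mult, (rsum_S_l (fun k => Cmod (x k) ^ 2)), (rsum_S (fun k => Cmod (y k) ^ 2) (S n)).
    assert (I := IH (shift x)). assert (J := Y (Cmod (x 0%nat)) (Cmod (y (S n)))).
    unfold shift at 2 in I. lra.
Qed.

Lemma conv_cauchy_schwarz (x y : nat -> C) (A B : R) (n : nat) : 0 < A -> 0 < B ->
  rsum (fun k => Cmod (x k) ^ 2) (S n) <= A -> rsum (fun k => Cmod (y k) ^ 2) (S n) <= B ->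
  Cmod (conv x y n) <= sqrt (A * B).
Proof.
  intros HA HB H1 H2.
  assert (SA := sqrt_lt_R0 A HA). assert (SB := sqrt_lt_R0 B HB).
  rewrite sqrt_mult by lra.
  set (u := sqrt A) in *. set (v := sqrt B) in *.
  assert (EA : A = u * u) by (unfold u; rewrite sqrt_sqrt; lra).
  assert (EB : B = v * v) by (unfold v; rewrite sqrt_sqrt; lra).
  assert (P1 : 0 < v / u) by now apply Rdiv_lt_0_compat.
  assert (P2 : 0 < u / v) by now apply Rdiv_lt_0_compat.
  assert (K := conv_young x y (v / u) (u / v) n P1 P2 ltac:(field; lra)).
  assert (K1 : v / u * rsum (fun k => Cmod (x k) ^ 2) (S n) <= v / u * A) by (apply Rmult_le_compat_l; lra).
  assert (K2 : u / v * rsum (fun k => Cmod (y k) ^ 2) (S n) <= u / v * B) by (apply Rmult_le_compat_l; lra).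
  replace (v / u * A) with (u * v) in K1 by (rewrite EA; field; lra).
  replace (u / v * B) with (u * v) in K2 by (rewrite EB; field; lra).
  lra.
Qed.

(* The contraction of [finite_section] on two coefficients, tested at [(1, conj(c_0) c_1 / (1 - |c_0|^2))]. *)
Lemma schwarz_pick_coeff (phi : C -> C) (c : nat -> C) :
  power_series_in_disc c phi -> (forall z, disc z -> Cmod (phi z) <= 1) -> Cmod (c 0%nat) < 1 ->
  Cmod (c 1%nat) <= 1 - Cmod (c 0%nat) ^ 2.
Proof.
  intros Hc Hphi H0. set (al := Cmod (c 0%nat)) in *. assert (Ha : 0 <= al) by apply Cmod_ge_0.
  assert (Hd : 0 < 1 - al ^ 2) by nra.
  set (tau := / (1 - al ^ 2)). assert (Ht : 0 < tau) by now apply Rinv_0_lt_compat.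
  set (B := fun k : nat => match k with O => RtoC 1 | _ => (RtoC tau * (Cconj (c 0%nat) * c 1%nat))%C end).
  assert (F := finite_section phi c B 2 Hc Hphi).
  rewrite !rsum_S in F. simpl rsum in F. rewrite conv_S in F. simpl conv in F. unfold shift in F.
  unfold B in F.
  replace (c 0%nat * 1)%C with (c 0%nat) in F by ring. fold al in F.
  replace (c 0%nat * (RtoC tau * (Cconj (c 0%nat) * c 1%nat)) + c 1%nat * 1)%C with (RtoC tau * c 1%nat)%C in F.
  2:{ replace (c 0%nat * (RtoC tau * (Cconj (c 0%nat) * c 1%nat)) + c 1%nat * 1)%C
        with ((RtoC tau * (c 0%nat * Cconj (c 0%nat)) + 1) * c 1%nat)%C by ring.
      rewrite <- Cmod_sq_conj. fold al. rewrite <- RtoC_mult, <- RtoC_plus. f_equal. f_equal.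
      unfold tau. field. lra. }
  rewrite !Cmod_mult, Cmod_conj, Cmod_1, Cmod_R, Rabs_pos_eq in F by lra. fold al in F.
  set (x := Cmod (c 1%nat)) in *. assert (Hx : 0 <= x) by apply Cmod_ge_0.
  (* The contraction reads [al^2 + (tau x)^2 <= 1 + (tau al x)^2]; moving the last term to the left
     factors out [1 - al^2]. *)
  assert (F2 : (tau * x) ^ 2 * (1 - al ^ 2) <= 1 * (1 - al ^ 2)).
  { replace ((tau * (al * x)) ^ 2) with ((tau * x) ^ 2 * al ^ 2) in F by ring. lra. }
  apply Rmult_le_reg_r in F2; [|exact Hd].
  assert (F3 : tau * x <= 1).
  { apply Rnot_lt_le. intros L. nra. }
  replace x with (tau * x * (1 - al ^ 2)) by (unfold tau; field; lra).
  rewrite <- (Rmult_1_l (1 - al ^ 2)) at 2. apply Rmult_le_compat_r; lra.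
Qed.

Theorem theorem2p2 (alpha : R) (f h g : C -> C) (b : nat -> C)
  (halpha : 0 <= alpha < 1)
  (hf : LH_check alpha f h g)
  (hb : power_series_in_disc b g) :
  Cmod (b 2%nat) <= 2 * alpha + (1 - alpha ^ 2) / 2 /\
  (forall n : nat, (3 <= n)%nat ->
     Cmod (b n) <= alpha + sqrt ((INR n - alpha ^ 2) * (INR n - 1))).
Proof.
  destruct hf as [[[Hh [Hg [g0 _]]] [_ [Hsp [h0 h'0]]]] [Hal [_ [h_inj [_ h_star]]]]].
  apply holo_analytic in Hh. destruct (holo_pseries h Hh) as [a [ha _]].
  destruct (pseries_deriv a h ha) as [ha' h_der]. destruct (pseries_deriv b g hb) as [hb' g_der].
  assert (Hlt : forall z, disc z -> Cmod (C_derive g z) < Cmod (C_derive h z)).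
  { intros z Hz. assert (J := Hsp z Hz). unfold jacobian in J.
    generalize (Cmod_ge_0 (C_derive g z)) (Cmod_ge_0 (C_derive h z)). nra. }
  assert (h'_neq : forall z, disc z -> C_derive h z <> 0%C).
  { intros z Hz. apply Cmod_gt_0. generalize (Hlt z Hz) (Cmod_ge_0 (C_derive g z)). lra. }
  (* [H] and [G] are [h / z] and [g / z] with the singularity at 0 filled in. *)
  destruct (pseries_shift a h ha) as [H [hH EH]]. destruct (pseries_shift b g hb) as [G [hG EG]].
  assert (a0 : a 0%nat = 0%C) by (now rewrite <- (pseries_at_0 a h ha)).
  assert (b0 : b 0%nat = 0%C) by (now rewrite <- (pseries_at_0 b g hb)).
  assert (a1 : a 1%nat = 1%C).
  { rewrite <- h'0, (pseries_at_0 _ _ ha'). unfold dcoef. simpl. ring. }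
  assert (Hb1 : Cmod (b 1%nat) = alpha).
  { rewrite <- Hal, (pseries_at_0 _ _ hb'). unfold dcoef. simpl. f_equal. ring. }
  assert (EH' : forall z, disc z -> h z = (z * H z)%C) by (intros z Hz; rewrite EH, a0 by exact Hz; ring).
  assert (EG' : forall z, disc z -> g z = (z * G z)%C) by (intros z Hz; rewrite EG, b0 by exact Hz; ring).
  assert (H0 : H 0%C = 1%C) by (rewrite (pseries_at_0 _ _ hH); exact a1).
  destruct (ex_formal_sqrt (shift a) a1) as [s [s0 Hs]].
  assert (Cayley := starlike_cayley h a ha h_inj h0 h_star h'_neq).
  assert (s_le : forall n, Cmod (s n) <= 1).
  (* [N = h' - H] and [P = h' + H] divide a factor [z] out of [z h' - h] and [z h' + h], so that
     [phi = N / P] is the Cayley quotient, also defined at 0, where [P] is 2 and [N] is 0. *)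
  { assert (hN := pseries_axpy (- (1)) _ _ _ _ ha' hH).
    assert (hP := pseries_axpy 1 _ _ _ _ ha' hH).
    set (N := fun z => (C_derive h z + - (1) * H z)%C) in hN.
    set (P := fun z => (C_derive h z + 1 * H z)%C) in hP.
    assert (EN : forall z, disc z -> (z * N z = z * C_derive h z - h z)%C).
    { intros z Hz. rewrite EH' by exact Hz. unfold N. ring. }
    assert (EP : forall z, disc z -> (z * P z = z * C_derive h z + h z)%C).
    { intros z Hz. rewrite EH' by exact Hz. unfold P. ring. }
    assert (P_neq : forall z, disc z -> P z <> 0%C).
    { intros z Hz. destruct (Ceq_dec z 0) as [->|Nz].
      - unfold P. rewrite H0, h'0. intros E. apply (f_equal fst) in E. simpl in E. lra.
      - intros E. apply (proj1 (Cayley z Hz Nz)). rewrite <- EP, E by exact Hz. ring. }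
    assert (hphi := holo_div N P (pseries_holo _ _ hN) (pseries_holo _ _ hP) P_neq).
    set (phi := fun z => (N z / P z)%C) in hphi.
    assert (phi0 : phi 0%C = 0%C).
    { unfold phi, N. rewrite H0, h'0. unfold Cdiv. ring. }
    destruct (holo_pseries phi hphi) as [c [hc _]].
    apply (clunie phi c s hc).
    - intros z Hz. destruct (Ceq_dec z 0) as [->|Nz]; [rewrite phi0, Cmod_0; lra|].
      destruct (Cayley z Hz Nz) as [C1 C2].
      replace (phi z) with ((z * C_derive h z - h z) / (z * C_derive h z + h z))%C.
      + rewrite Cmod_div by exact C1. assert (Q := proj1 (Cmod_gt_0 _) C1).
        apply Rmult_le_reg_r with (1 := Q). unfold Rdiv. rewrite Rmult_assoc, Rinv_l; lra.
      + rewrite <- EN, <- EP by exact Hz. unfold phi. field. auto.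
    - rewrite <- (pseries_at_0 _ _ hc). exact phi0.
    - exact s0.
    (* With [t = shift a] one has [dcoef a = E t + t], so [N] and [P] have coefficients [E t] and
       [E t + 2 t]. *)
    - apply (sqrt_euler_relation c (shift a) s s0 Hs). intros n.
      transitivity (dcoef a n + - (1) * shift a n)%C.
      { unfold euler, dcoef, shift. rewrite S_INR, RtoC_plus. ring. }
      rewrite (pseries_mult c _ _ phi P N hc hP hN).
      + apply conv_ext; [reflexivity|]. intros k _. unfold euler, dcoef, shift.
        rewrite S_INR, RtoC_plus. ring.
      + intros z Hz. unfold phi. field. now apply P_neq. }
  split.
  - assert (hom := holo_div _ _ (pseries_holo _ _ hb') (pseries_holo _ _ ha') h'_neq).
    set (om := fun z => (C_derive g z / C_derive h z)%C) in hom.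
    destruct (holo_pseries om hom) as [o [ho _]].
    assert (om_le : forall z, disc z -> Cmod (om z) <= 1).
    { intros z Hz. unfold om. rewrite Cmod_div by now apply h'_neq.
      assert (L := Hlt z Hz). assert (Q := proj1 (Cmod_gt_0 _) (h'_neq z Hz)).
      apply Rmult_le_reg_r with (1 := Q). unfold Rdiv. rewrite Rmult_assoc, Rinv_l; lra. }
    assert (Ko := pseries_mult o _ _ om _ _ ho ha' hb').
    assert (K : forall k, dcoef b k = conv o (dcoef a) k).
    { apply Ko. intros z Hz. unfold om. field. now apply h'_neq. }
    assert (o0 : Cmod (o 0%nat) = alpha).
    { rewrite <- Hb1. f_equal. generalize (K 0%nat). unfold dcoef. simpl. rewrite a1.
      intros E. transitivity (o 0%nat * (1 * 1))%C; [ring|]. rewrite <- E. ring. }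
    assert (o1 := schwarz_pick_coeff om o ho om_le ltac:(lra)). rewrite o0 in o1.
    (* The coefficient of [z] in [g' = om * h'], with [h' = 1 + 2 a_2 z + ...] and [a_2 = 2 s_1].
       Its modulus is at most [4 alpha + (1 - alpha^2)]. *)
    assert (E2 : (2 * b 2%nat = o 0%nat * (2 * (2 * s 1%nat)) + o 1%nat)%C).
    { assert (A2 : a 2%nat = (2 * s 1%nat)%C).
      { change (a 2%nat) with (shift a 1%nat). rewrite <- (Hs 1%nat). simpl. unfold shift. rewrite s0. ring. }
      generalize (K 1%nat). unfold dcoef. simpl. unfold shift. rewrite a1, A2. intros E.
      replace (2 * b 2%nat)%C with (RtoC (1 + 1) * b 2%nat)%C by (rewrite RtoC_plus; ring).
      rewrite E, RtoC_plus. ring. }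
    assert (E3 := f_equal Cmod E2). rewrite Cmod_mult, Cmod_R, Rabs_pos_eq in E3 by lra.
    generalize (Cmod_triangle (o 0%nat * (2 * (2 * s 1%nat))) (o 1%nat)).
    rewrite <- E3, !Cmod_mult, Cmod_R, Rabs_pos_eq, o0 by lra.
    assert (alpha * Cmod (s 1%nat) <= alpha * 1) by (apply Rmult_le_compat_l; [lra|apply s_le]).
    lra.
  - intros n Hn.
    (* A zero of [H] off 0 would be a second zero of the injective [h]. *)
    assert (H_neq : forall z, disc z -> H z <> 0%C).
    { intros z Hz. destruct (Ceq_dec z 0) as [->|Nz].
      - rewrite H0. exact C1_nz.
      - intros E. apply Nz. apply h_inj; [exact Hz|exact disc_0|].
        rewrite h0, EH', E by exact Hz. ring. }
    assert (hpsi := holo_div G H (pseries_holo _ _ hG) (pseries_holo _ _ hH) H_neq).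
    set (psi := fun z => (G z / H z)%C) in hpsi.
    destruct (holo_pseries psi hpsi) as [e [he _]].
    assert (psi_le : forall z, disc z -> Cmod (psi z) <= 1).
    { intros z Hz. unfold psi. destruct (Ceq_dec z 0) as [->|Nz].
      (* At 0 domination of [g] by [h] says nothing; there [psi] is [b 1], of modulus
         [alpha < 1]. *)
      - rewrite H0, (pseries_at_0 _ _ hG). unfold shift.
        replace (b 1%nat / 1)%C with (b 1%nat) by (field; exact C1_nz). lra.
      - assert (L := starlike_dominates h a ha h_inj h0 h_star h'_neq g z g_der g0
          (fun y Hy => Rlt_le _ _ (Hlt y Hy)) Hz).
        rewrite EG', EH', !Cmod_mult in L by exact Hz.
        apply Rmult_le_reg_l in L; [|now apply Cmod_gt_0].
        rewrite Cmod_div by now apply H_neq.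
        assert (Q := proj1 (Cmod_gt_0 _) (H_neq z Hz)).
        apply Rmult_le_reg_r with (1 := Q). unfold Rdiv. rewrite Rmult_assoc, Rinv_l; lra. }
    assert (K : forall k, shift b k = conv (conv e s) s k).
    { intros k. rewrite conv_assoc. rewrite (pseries_mult e _ _ psi H G he hH hG).
      - apply conv_ext; [reflexivity|]. intros j _. now rewrite Hs.
      - intros z Hz. unfold psi. field. now apply H_neq. }
    set (u := conv e s) in K.
    assert (u0 : Cmod (u 0%nat) = alpha).
    { rewrite <- Hb1. f_equal. generalize (K 0%nat). unfold shift. simpl. rewrite s0.
      intros ->. ring. }
    assert (s_sum : forall m, rsum (fun k => Cmod (s k) ^ 2) m <= INR m).
    { intros m. rewrite <- rsum_one. apply rsum_le. intros k _.
      rewrite <- (pow1 2). apply pow_incr. split; [apply Cmod_ge_0|apply s_le]. }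
    destruct n as [|[|m]]; [lia|lia|].
    assert (u_sum := finite_section psi e s (S (S m)) he psi_le). fold u in u_sum.
    rewrite rsum_S_l, u0 in u_sum.
    (* With [n = m + 2], [b_n] has index [n - 1] in [u s]. Its head is [u_0 s_(n-1)]; the tail pairs
       [u_1, ..., u_(n-1)], with square sum at most [n - alpha^2] once [|u_0|^2] is removed, with
       [s_0, ..., s_(n-2)]. *)
    change (b (S (S m))) with (shift b (S m)). rewrite K, conv_S.
    eapply Rle_trans; [apply Cmod_triangle|]. apply Rplus_le_compat.
    + rewrite Cmod_mult, u0. rewrite <- (Rmult_1_r alpha) at 2.
      apply Rmult_le_compat_l; [lra|apply s_le].
    + assert (I2 : INR (S (S m)) = INR (S m) + 1) by apply S_INR.
      assert (I1 : 0 < INR (S m)) by (apply lt_0_INR; lia).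
      apply conv_cauchy_schwarz.
      * nra.
      * lra.
      * generalize (s_sum (S (S m))). unfold shift. lra.
      * generalize (s_sum (S m)). lra.
Qed.
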